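(* Let $M\ge 2$ be an integer, let $R_1=\lfloor(\log M)^3\rfloor$, and for $r\ge 1$ let $$\operatorname{Pr}_{\mathsf P}(r)=M^{-r}\cdot\#\Big\{(\eta_1,\ldots,\eta_r)\in\{1,\ldots,M\}^r:\ \textstyle\sum_{i=1}^{\ell}\eta_i\notin\mathbb{P}\text{ for all }1\le\ell<r,\ \sum_{i=1}^r\eta_i\in\mathbb{P}\Big\}.$$ Then, as $M\to+\infty$, $$\sum_{r=1}^{R_1} r\operatorname{Pr}_{\mathsf P}(r)=\log M+O(\log\log M),\qquad \sum_{r>R_1} r\operatorname{Pr}_{\mathsf P}(r)=o(1).$$
   Context: $\mathbb{P}$ is the set of prime numbers; $\log$ is the natural logarithm. $\operatorname{Pr}_{\mathsf P}(r)$ is the probability that, when rolling a fair $M$-faced die (faces $1,\ldots,M$) repeatedly and summing, the running sum first becomes prime at roll $r$. $O$ and $o$ are the usual Bachmann–Landau symbols as $M\to+\infty$. *)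

(* Defs.v *)
From HB Require Import structures.
From mathcomp Require Import all_boot all_order all_algebra.
From mathcomp Require Import all_classical all_reals all_analysis.

Set Implicit Arguments.
Unset Strict Implicit.
Unset Printing Implicit Defensive.

Import Order.TTheory GRing.Theory Num.Theory.
Import numFieldNormedType.Exports.

Local Open Scope classical_set_scope.
Local Open Scope ring_scope.

(* The faces 1, ..., M are encoded by 'I_M: the value k : 'I_M stands for the
   face k.+1. *)
Definition roll_sum (M r : nat) (eta : {ffun 'I_r -> 'I_M}) (l : nat) : nat :=
  (\sum_(i < r | i < l) (eta i).+1)%N.

Definition first_prime_at (M r : nat) : {set {ffun 'I_r -> 'I_M}} :=
  [set eta : {ffun 'I_r -> 'I_M} |
    [forall l : 'I_r, (0 < l)%N ==> ~~ prime (roll_sum eta l)]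
    && prime (roll_sum eta r)]%SET.

Definition PrP (R : realType) (M r : nat) : R :=
  M%:R ^- r * #|first_prime_at M r|%:R.

(* For a nonnegative argument, [Num.truncn] is the integer floor, as a nat. *)
Definition R1 (R : realType) (M : nat) : nat :=
  Num.truncn ((ln (M%:R : R)) ^+ 3).

Definition head_sum (R : realType) (M : nat) : R :=
  \sum_(1 <= r < (R1 R M).+1) r%:R * PrP R M r.

(* The terms are nonnegative, so the series always has a value in [0, +oo]. *)
Definition tail_sum (R : realType) (M : nat) : \bar R :=
  (\sum_((R1 R M).+1 <= r <oo) (r%:R * PrP R M r)%:E)%E.

(* Main.v *)
(* Let [Q r] be the probability that the first [r] sums are all nonprime, so that
   [PrP r = Q (r - 1) - Q r] and, by Abel summation, [head_sum] is the sum of the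
   [Q r] for [r < R1] minus [R1 * Q R1]. Put [L = log M]. From any sum
   [s <= M L^3] the next roll hits a prime with probability
   [1 / (L + O(log L))], by the prime number theorem in the window [s, s + M]; it
   is needed only with a relative error [(log x) ^ -5]. Hence [Q] is squeezed
   between two geometric sequences, which gives the head sum. For the tail,
   [Q r <= Q R1 <= exp (- L^2 / 4)] and, for all [r],
   [Q r <= (1 - 1/M) ^ (number of primes up to r) <= exp (- sqrt r / M)]; the
   geometric mean of these two bounds has a sum over [r] of order [1 / M].

   The prime number theorem is proved without contour integrals. For Re z > 1 the
   sums [A_k z] of [(Lambda n - 1) * ln n ^ k * n ^ -z] are shown to be
   [O(log^C (|Im z| + 3))], uniformly up to the line Re z = 1: the functional
   identity [Lambda * 1 = log] expresses [A_k] through the regular parts of zeta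
   and its derivatives, divided by powers of zeta, and the 3-4-1 inequality bounds
   zeta from below. Expanding [cos ^ 2N] into frequencies gives a trigonometric
   polynomial whose primitive, as a function of [ln n], approximates the indicator
   of a short window; summing [A_k] over the frequencies compares the mass of
   [Lambda] with that of [1] on the window. *)
Require Import Defs.
From HB Require Import structures.
From mathcomp Require Import all_boot all_order all_algebra.
From mathcomp Require Import all_classical all_reals all_analysis.
From mathcomp Require Import complex ring lra zify.

Set Implicit Arguments.
Unset Strict Implicit.
Unset Printing Implicit Defensive.

Import Order.TTheory GRing.Theory Num.Theory.
Import numFieldNormedType.Exports.
Import ComplexField.Normc.

Local Open Scope classical_set_scope.
Local Open Scope ring_scope.

(** The index [k] does the work of a contour shift. To reach integers near [e^M], all series are
    evaluated at [Re z = 1 + 1/M], and the comparison through the kernel loses a power of [M] that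
    depends on the width of the window but not on [k]. The weight [ln n ^ k] is about [M ^ k] there,
    so derivatives that stay polylogarithmic up to the line yield a saving of any fixed power of
    [M]. Any polylogarithmic bound will do, whatever its exponent, because the frequencies are
    powers of [M] and their logarithms only [O(log M)].

    For the dice, a window of length [M] is as little as the fraction [L ^ -3] of the sums [M L^3]
    reached in [R1] rolls; a saving of [L ^ -5] then leaves a relative error [L ^ -2] on the window,
    less than the [log L / L] that is allowed. The cutoff [R1] far exceeds the typical number [L] of
    rolls because [exp (- sqrt r / M)] is small only for [r] well beyond [M^2]: before that, [Q R1]
    alone must beat every power of [M]. *)

Local Notation Re := complex.Re.
Local Notation Im := complex.Im.

(** * Complex series, powers and Dirichlet series *)

Section ComplexSeries.
Variable R : realType.
Local Notation C := R[i].
Implicit Types (a b : nat -> C) (x y : R) (z w : C).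

Lemma cReM z w : Re (z * w) = Re z * Re w - Im z * Im w.
Proof. by case: z w => [? ?] [? ?]. Qed.

Lemma cImM z w : Im (z * w) = Re z * Im w + Im z * Re w.
Proof. by case: z w => [? ?] [? ?]. Qed.

Lemma cReD z w : Re (z + w) = Re z + Re w.
Proof. by case: z w => [? ?] [? ?]. Qed.

Lemma cImD z w : Im (z + w) = Im z + Im w.
Proof. by case: z w => [? ?] [? ?]. Qed.

Lemma cReN z : Re (- z) = - Re z.
Proof. by case: z. Qed.

Lemma cImN z : Im (- z) = - Im z.
Proof. by case: z. Qed.

Lemma cReB z w : Re (z - w) = Re z - Re w.
Proof. by rewrite cReD cReN. Qed.

Lemma cImB z w : Im (z - w) = Im z - Im w.
Proof. by rewrite cImD cImN. Qed.

Lemma normcR x : normc x%:C%C = `|x|.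
Proof. by rewrite /= expr0n /= addr0 sqrtr_sqr. Qed.

Lemma normc_ge0 z : 0 <= normc z.
Proof. by case: z => ? ?; exact: sqrtr_ge0. Qed.

Lemma normc_sqr z : normc z ^+ 2 = Re z ^+ 2 + Im z ^+ 2.
Proof. by case: z => u v /=; rewrite sqr_sqrtr // addr_ge0 ?sqr_ge0. Qed.

Lemma normcX z n : normc (z ^+ n) = normc z ^+ n.
Proof. by elim: n => [|n ih]; rewrite ?expr0 ?normc1 // !exprS normcM ih. Qed.

Lemma ler_normcD z w : normc (z + w) <= normc z + normc w.
Proof. exact: (@le_normcD R z w). Qed.

Lemma normc_opp z : normc (- z) = normc z.
Proof. exact: (@normcN R z). Qed.

Lemma le_normc_sum (I : Type) (r : seq I) (P : pred I) (F : I -> C) :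
  normc (\sum_(i <- r | P i) F i) <= \sum_(i <- r | P i) normc (F i).
Proof.
elim/big_ind2 : _ => //; first by rewrite normc0.
move=> u x v y h1 h2; apply: (le_trans (ler_normcD _ _)); exact: lerD.
Qed.

Lemma le_normcB z w : normc (z - w) <= normc z + normc w.
Proof. by apply: (le_trans (ler_normcD _ _)); rewrite normc_opp. Qed.

Lemma normcBC z w : normc (z - w) = normc (w - z).
Proof. by rewrite -normc_opp opprB. Qed.

Lemma normc_triangle z w t : normc (z - t) <= normc (z - w) + normc (w - t).
Proof. have -> : z - t = (z - w) + (w - t) by ring.
exact: ler_normcD. Qed.

Lemma lerB_normc z w : normc z - normc w <= normc (z - w).
Proof. by have := ler_normcD (z - w) w; rewrite subrK; lra. Qed.

Lemma normc_Re z : `|Re z| <= normc z.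
Proof.
rewrite -ler_sqr ?nnegrE ?normc_ge0 // normc_sqr real_normK ?num_real //.
by rewrite lerDl sqr_ge0.
Qed.

Lemma normc_Im z : `|Im z| <= normc z.
Proof.
rewrite -ler_sqr ?nnegrE ?normc_ge0 // normc_sqr real_normK ?num_real //.
by rewrite lerDr sqr_ge0.
Qed.

Lemma normc_ReIm z : normc z <= `|Re z| + `|Im z|.
Proof.
rewrite -ler_sqr ?nnegrE ?normc_ge0 ?addr_ge0 // normc_sqr sqrrD.
rewrite !real_normK ?num_real // lerD2r lerDl mulrn_wge0 //.
Qed.

Lemma normc_eq0 z : (normc z == 0) = (z == 0).
Proof. by apply/eqP/eqP => [/eq0_normc|->] //; rewrite normc0. Qed.

Lemma normc_gt0 z : (0 < normc z) = (z != 0).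
Proof. by rewrite lt_def normc_ge0 andbT normc_eq0. Qed.

Lemma normc_small_eq0 z : (forall e, 0 < e -> normc z <= e) -> z = 0.
Proof.
move=> h; apply/eqP; apply/negPn/negP; rewrite -normc_gt0 => z0.
by have := h (normc z / 2) (divr_gt0 z0 (ltr0Sn _ _)); lra.
Qed.

(* Reduces norm bounds for complex vectors to real ones by a rotation. *)
Lemma rotate_to_norm z : exists w, normc w = 1 /\ Re (w * z) = normc z.
Proof.
have [->|z0] := eqVneq z 0.
  by exists 1; rewrite normc1 mulr0 normc0.
have n0 : normc z != 0 by rewrite normc_eq0.
have n1 : 0 < normc z by rewrite normc_gt0.
exists ((Re z / normc z) +i* (- Im z / normc z))%C; split.
  rewrite -[LHS]gtr0_norm; last first.
    rewrite normc_gt0 eq_complex /= !mulf_eq0 invr_eq0 (negbTE n0) !orbF oppr_eq0.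
    by move: z0; rewrite eq_complex.
  apply/eqP; rewrite -(@eqrXn2 _ 2) // ger0_norm ?normc_ge0 // normc_sqr /=.
  by rewrite !expr_div_n sqrrN -mulrDl -normc_sqr expr1n divff // expf_neq0.
rewrite cReM /= -!mulrA ![_^-1 * _]mulrC !mulrA mulNr -mulrBl.
by rewrite opprK -!expr2 -normc_sqr expr2 mulfK.
Qed.

(** [limn] is total, so every sequence gets a value; [csumP] identifies it as the sum for absolutely
    bounded series. *)
Definition csum a : C :=
  (limn (series (fun n => Re (a n))) +i*
   limn (series (fun n => Im (a n))))%C.

Definition has_sum a z := forall e : R, 0 < e ->
  exists N, forall n, (N <= n)%N -> normc (\sum_(i < n) a i - z) <= e.

Definition abs_bound a (B : R) := forall n, \sum_(i < n) normc (a i) <= B.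

Lemma real_series_cvg (u : nat -> R) (v : nat -> R) (B : R) :
  (forall n, `|u n| <= v n) -> (forall n, \sum_(i < n) v i <= B) ->
  forall e, 0 < e -> exists N, forall n, (N <= n)%N ->
    `|\sum_(i < n) u i - limn (series u)| <= e.
Proof.
move=> uv vB.
have cv : cvgn (series v).
  apply: nondecreasing_is_cvgn.
    apply: nondecreasing_series => n _ _; exact: le_trans (uv n).
  exists B => _ [n _ <-]; rewrite seriesEord; exact: vB.
have cu : cvgn (series u).
  apply: normed_cvg; apply: (series_le_cvg _ _ uv cv) => n //.
  exact: le_trans (uv n).
move=> e e0.
move/cvgrPdist_le : cu => /(_ e e0) [N _ hN].
by exists N => n Nn; have := hN n Nn; rewrite distrC seriesEord.
Qed.

Lemma csumP a B : abs_bound a B -> has_sum a (csum a).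
Proof.
move=> aB e e0.
have e2 : 0 < e / 2 by rewrite divr_gt0.
have [N1 h1] := real_series_cvg (fun n => normc_Re (a n)) aB e2.
have [N2 h2] := real_series_cvg (fun n => normc_Im (a n)) aB e2.
exists (maxn N1 N2) => n; rewrite geq_max => /andP[/h1 {}h1 /h2 {}h2].
apply: (le_trans (normc_ReIm _)); rewrite !raddfB /= !raddf_sum /=.
by rewrite [leRHS]splitr; exact: lerD.
Qed.

Lemma has_sum_unique a z w : has_sum a z -> has_sum a w -> z = w.
Proof.
move=> hz hw; apply/eqP; rewrite -subr_eq0; apply/eqP.
apply: normc_small_eq0 => e e0.
have e2 : 0 < e / 2 by rewrite divr_gt0.
have [N1 h1] := hz _ e2; have [N2 h2] := hw _ e2.
have {}h1 := h1 _ (leq_maxl N1 N2); have {}h2 := h2 _ (leq_maxr N1 N2).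
apply: (le_trans (normc_triangle _ (\sum_(i < maxn N1 N2) a i) _)).
by rewrite normcBC [leRHS]splitr; exact: lerD.
Qed.

Lemma csum_eq a B z : abs_bound a B -> has_sum a z -> csum a = z.
Proof. by move=> /csumP; exact: has_sum_unique. Qed.

Lemma eq_csum a b : (forall n, a n = b n) -> csum a = csum b.
Proof. by move=> /funext ->. Qed.

Lemma has_sumD a b z w :
  has_sum a z -> has_sum b w -> has_sum (fun n => a n + b n) (z + w).
Proof.
move=> hz hw e e0.
have e2 : 0 < e / 2 by rewrite divr_gt0.
have [N1 h1] := hz _ e2; have [N2 h2] := hw _ e2.
exists (maxn N1 N2) => n; rewrite geq_max => /andP[/h1 {}h1 /h2 {}h2].
rewrite big_split /=.
have -> : \sum_(i < n) a i + \sum_(i < n) b i - (z + w) =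
  (\sum_(i < n) a i - z) + (\sum_(i < n) b i - w) by ring.
by apply: (le_trans (ler_normcD _ _)); rewrite [leRHS]splitr; exact: lerD.
Qed.

Lemma has_sumZ c a z : has_sum a z -> has_sum (fun n => c * a n) (c * z).
Proof.
move=> hz e e0.
have c0 : 0 < normc c + 1 by have := normc_ge0 c; lra.
have [N h] := hz (e / (normc c + 1)) (divr_gt0 e0 c0).
exists N => n /h; rewrite -mulr_sumr -mulrBr normcM ler_pdivlMr // => {}h.
apply: le_trans h; rewrite mulrC ler_wpM2l ?normc_ge0 //; lra.
Qed.

Lemma abs_boundD a b A B :
  abs_bound a A -> abs_bound b B -> abs_bound (fun n => a n + b n) (A + B).
Proof.
move=> hA hB n; apply: (@le_trans _ _ (\sum_(i < n) (normc (a i) + normc (b i)))).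
  by apply: ler_sum => i _; exact: ler_normcD.
by rewrite big_split /=; apply: lerD; [exact: hA | exact: hB].
Qed.

Lemma abs_boundZ c a A : abs_bound a A -> abs_bound (fun n => c * a n) (normc c * A).
Proof.
move=> hA n; under eq_bigr do rewrite normcM.
by rewrite -mulr_sumr ler_wpM2l ?normc_ge0.
Qed.

Lemma csumD a b A B : abs_bound a A -> abs_bound b B ->
  csum (fun n => a n + b n) = csum a + csum b.
Proof.
move=> hA hB; apply: (csum_eq (abs_boundD hA hB)).
by apply: has_sumD; [exact: csumP hA | exact: csumP hB].
Qed.

Lemma csumZ c a A : abs_bound a A -> csum (fun n => c * a n) = c * csum a.
Proof.
move=> hA; apply: (csum_eq (abs_boundZ c hA)).
by apply: has_sumZ; exact: csumP hA.
Qed.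

Lemma abs_bound0 : abs_bound (fun=> 0) 0.
Proof. by move=> n; rewrite big1 // => i _; rewrite normc0. Qed.

Lemma csum0 : csum (fun=> 0) = 0.
Proof.
apply: (csum_eq abs_bound0) => e e0; exists 0%N => n _.
by rewrite big1 // subr0 normc0 ltW.
Qed.

Lemma abs_bound_sum (I : Type) (r : seq I) (F : I -> nat -> C) :
  (forall i, exists B, abs_bound (F i) B) ->
  exists B, abs_bound (fun n => \sum_(i <- r) F i n) B.
Proof.
move=> hF; elim: r => [|i r [B hB]].
  by exists 0 => n; rewrite big1 // => j _; rewrite big_nil normc0.
have [D hD] := hF i; exists (D + B).
have := abs_boundD hD hB; congr abs_bound.
by apply: funext => n; rewrite big_cons.
Qed.

Lemma csum_sum (I : Type) (r : seq I) (F : I -> nat -> C) :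
  (forall i, exists B, abs_bound (F i) B) ->
  csum (fun n => \sum_(i <- r) F i n) = \sum_(i <- r) csum (F i).
Proof.
move=> hF; elim: r => [|i r ih].
  by rewrite big_nil -[RHS]csum0; apply: eq_csum => n; rewrite big_nil.
have [D hD] := hF i; have [B hB] := abs_bound_sum r hF.
rewrite big_cons -ih -(csumD hD hB); apply: eq_csum => n.
by rewrite big_cons.
Qed.

Lemma has_sum_normc_le a z B :
  (forall n, normc (\sum_(i < n) a i) <= B) -> has_sum a z -> normc z <= B.
Proof.
move=> hB hz; rewrite leNgt; apply/negP => Bz.
have [N /(_ N (leqnn N))] := hz ((normc z - B) / 2) ltac:(lra).
by have := hB N; have := lerB_normc z (\sum_(i < N) a i); rewrite normcBC; lra.
Qed.

Lemma csum_le a B : abs_bound a B -> normc (csum a) <= B.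
Proof.
move=> hB; apply: has_sum_normc_le (csumP hB) => n.
exact: le_trans (le_normc_sum _ _ _) (hB n).
Qed.

Lemma has_sum_Re_ge a z B :
  (forall n, (0 < n)%N -> B <= Re (\sum_(i < n) a i)) ->
  has_sum a z -> B <= Re z.
Proof.
move=> hB hz; rewrite leNgt; apply/negP => Bz.
have [N /(_ N.+1 (leqnSn N))] := hz ((B - Re z) / 2) ltac:(lra).
have := hB N.+1 isT; have := normc_Re (\sum_(i < N.+1) a i - z).
rewrite raddfB /= ler_norml; lra.
Qed.

End ComplexSeries.

(** * Derivatives along a real variable, and complex powers *)

Section ComplexPowers.
Variable R : realType.
Local Notation C := R[i].
Implicit Types (x y v : R) (z w : C).

Definition der (f : R -> R) (d x : R) := is_derive x (1 : R) f d.

Lemma der_eq f d d' x : der f d x -> d = d' -> der f d' x.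
Proof. by move=> h <-. Qed.

Lemma der_cst (c x : R) : der (fun=> c) 0 x.
Proof. exact: is_derive_cst. Qed.

Lemma der_id x : der (fun y => y) 1 x.
Proof. exact: is_derive_id. Qed.

Lemma derD f g a b x : der f a x -> der g b x -> der (fun y => f y + g y) (a + b) x.
Proof. exact: is_deriveD. Qed.

Lemma derN f a x : der f a x -> der (fun y => - f y) (- a) x.
Proof. exact: is_deriveN. Qed.

Lemma derB f g a b x : der f a x -> der g b x -> der (fun y => f y - g y) (a - b) x.
Proof. exact: is_deriveB. Qed.

Lemma derM f g a b x :
  der f a x -> der g b x -> der (fun y => f y * g y) (a * g x + f x * b) x.
Proof.
move=> hf hg; apply: is_derive_eq; first exact: (is_deriveM hf hg).
by rewrite /GRing.scale /=; ring.
Qed.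

Lemma derZ c f a x : der f a x -> der (fun y => c * f y) (c * a) x.
Proof.
by move=> hf; apply: der_eq (derM (der_cst c x) hf) _; rewrite mul0r add0r.
Qed.

Lemma derX f a x n : der f a x -> der (fun y => f y ^+ n) (n%:R * f x ^+ n.-1 * a) x.
Proof.
move=> hf; have := @is_deriveX R R f n x 1 a hf.
by rewrite exprfctE.
Qed.

Lemma der_comp f g a b x : der f a (g x) -> der g b x -> der (fun y => f (g y)) (a * b) x.
Proof. by move=> hf hg; exact: (is_derive1_comp hf hg). Qed.

Lemma der_sum (I : Type) (r : seq I) (F : I -> R -> R) (d : I -> R) x :
  (forall i, der (F i) (d i) x) ->
  der (fun y => \sum_(i <- r) F i y) (\sum_(i <- r) d i) x.
Proof.
move=> h; elim: r => [|i r ih].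
  rewrite big_nil; under eq_fun do rewrite big_nil; exact: der_cst.
by rewrite big_cons; under eq_fun do rewrite big_cons; exact: derD.
Qed.

Lemma der_continuous f a x : der f a x -> {for x, continuous f}.
Proof. by move=> h; apply/differentiable_continuous/derivable1_diffP; exact: (@ex_derive _ _ _ _ _ _ _ h). Qed.

Lemma mvt (f f' : R -> R) (a b : R) : a <= b ->
  (forall x, a <= x <= b -> der f (f' x) x) ->
  exists2 c, a <= c <= b & f b - f a = f' c * (b - a).
Proof.
move=> ab h.
have [] := @MVT_segment R f f' a b ab.
- move=> x /[!in_itv]/= /andP[h1 h2]; apply: h; rewrite !ltW //.
- apply: continuous_in_subspaceT => x; rewrite inE /= in_itv /= => hx.
  exact: (der_continuous (h x hx)).
- by move=> c; rewrite in_itv /= => hc e; exists c.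
Qed.

Lemma der_ge0_ndecr (f f' : R -> R) (a b : R) : a <= b ->
  (forall x, a <= x <= b -> der f (f' x) x) ->
  (forall x, a <= x <= b -> 0 <= f' x) -> f a <= f b.
Proof.
move=> ab h h0; have [c hc e] := mvt ab h.
by rewrite -subr_ge0 e mulr_ge0 ?h0 ?subr_ge0.
Qed.

(** Allows a Dirichlet series to be differentiated by summing second-order bounds of its terms,
    instead of by uniform convergence of the differentiated series. *)
Lemma der_quadratic f d x (B r : R) : 0 < r ->
  (forall h, `|h| <= r -> `|f (x + h) - f x - h * d| <= B * h ^+ 2) -> der f d x.
Proof.
move=> r0 hB.
suff hc : (fun h => h^-1 *: (f (h *: (1 : R) + x) - f x)) h @[h --> 0^'] --> d.
  apply: DeriveDef; last exact: cvg_lim hc.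
  by apply/cvg_ex; exists d.
apply/cvgrPdist_le => e e0.
have B1 : 0 < `|B| + 1 by have := normr_ge0 B; lra.
near=> h.
have h0 : h != 0 by near: h; exact: nbhs_dnbhs_neq.
have hr : `|h| <= r.
  by near: h; apply: dnbhs0_le.
have he : `|h| <= e / (`|B| + 1).
  by near: h; apply: dnbhs0_le; rewrite divr_gt0.
have := hB h hr; rewrite /GRing.scale /= mulr1 [h + x]addrC [leLHS in _ -> leLHS <= _]distrC.
have -> : f (x + h) - f x - h * d = h * (h^-1 * (f (x + h) - f x) - d).
  by rewrite mulrBr mulrA mulfV // mul1r.
rewrite normrM -real_normK ?num_real // => hh.
have h1 : 0 < `|h| by rewrite normr_gt0.
have : `|h^-1 * (f (x + h) - f x) - d| <= B * `|h|.
  by rewrite -(ler_pM2l h1); apply: le_trans hh _; rewrite expr2 mulrCA.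
move=> /le_trans; apply.
apply: (@le_trans _ _ ((`|B| + 1) * `|h|)).
  by rewrite ler_wpM2r // ?normr_ge0 //; have := ler_norm B; lra.
by rewrite mulrC -ler_pdivlMr.
Unshelve. all: by end_near. Qed.

(** Only real variables are differentiated in: zeta along horizontal lines, and [v ^ -z] in [v].
    Complex differentiability never enters. *)
Definition cder (F : R -> C) (d : C) (x : R) :=
  der (fun y => Re (F y)) (Re d) x /\
  der (fun y => Im (F y)) (Im d) x.

Lemma cder_eq F d d' x : cder F d x -> d = d' -> cder F d' x.
Proof. by move=> h <-. Qed.

Lemma cder_cst c x : cder (fun=> c) 0 x.
Proof. by split; exact: der_cst. Qed.

Lemma cderB F G a b x : cder F a x -> cder G b x -> cder (fun y => F y - G y) (a - b) x.
Proof.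
move=> [f1 f2] [g1 g2]; split.
  by under eq_fun do rewrite cReB; rewrite cReB; exact: derB.
by under eq_fun do rewrite cImB; rewrite cImB; exact: derB.
Qed.

Lemma cderM F G a b x :
  cder F a x -> cder G b x -> cder (fun y => F y * G y) (a * G x + F x * b) x.
Proof.
move=> [f1 f2] [g1 g2]; split.
  under eq_fun do rewrite cReM.
  apply: (der_eq (derB (derM f1 g1) (derM f2 g2))).
  by rewrite cReD !cReM; ring.
under eq_fun do rewrite cImM.
apply: (der_eq (derD (derM f1 g2) (derM f2 g1))).
by rewrite cImD !cImM; ring.
Qed.

Lemma cderZ c F a x : cder F a x -> cder (fun y => c * F y) (c * a) x.
Proof.
by move=> hf; apply: cder_eq (cderM (cder_cst c x) hf) _; rewrite mul0r add0r.
Qed.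

Lemma cder_real f a x : der f a x -> cder (fun y => (f y)%:C%C) a%:C%C x.
Proof. by move=> h; split => //; exact: der_cst. Qed.

Lemma cder_comp F g a b x :
  cder F a (g x) -> der g b x -> cder (fun y => F (g y)) (a * b%:C%C) x.
Proof.
move=> [f1 f2] hg; split.
  by apply: (der_eq (der_comp f1 hg)); rewrite cReM /=; ring.
by apply: (der_eq (der_comp f2 hg)); rewrite cImM /=; ring.
Qed.

Lemma cder_Re w F a x : cder F a x ->
  der (fun y => Re (w * F y)) (Re (w * a)) x.
Proof. by move=> /(cderZ w) []. Qed.

Lemma cmvt (F f : R -> C) (a b B : R) : a <= b ->
  (forall x, a <= x <= b -> cder F (f x) x) ->
  (forall x, a <= x <= b -> normc (f x) <= B) ->
  normc (F b - F a) <= B * (b - a).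
Proof.
move=> ab h hB; have [w [w1 <-]] := rotate_to_norm (F b - F a).
have [x hx] := mvt ab (fun x hx => cder_Re w (h x hx)).
move=> e; rewrite mulrBr cReB e {e}.
rewrite ler_wpM2r ?subr_ge0 //; apply: le_trans (hB x hx).
by apply: (le_trans (ler_norm _)); rewrite -[leRHS]mul1r -w1 -normcM normc_Re.
Qed.

Definition cexp z : C := (expR (Re z))%:C%C * (cos (Im z) +i* sin (Im z))%C.

Lemma cexp0 : cexp 0 = 1.
Proof. by rewrite /cexp /= expR0 cos0 sin0 mul1r. Qed.

Lemma cexpD z w : cexp (z + w) = cexp z * cexp w.
Proof.
case: z w => a b [c d]; rewrite /cexp /= expRD cosD sinD.
by apply/eqP; rewrite eq_complex /=; apply/andP; split; apply/eqP; ring.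
Qed.

Lemma normc_cexp z : normc (cexp z) = expR (Re z).
Proof.
rewrite normcM normcR ger0_norm ?expR_ge0 //=.
by rewrite cos2Dsin2 sqrtr1 mulr1.
Qed.

Lemma cexp_real x : cexp x%:C%C = (expR x)%:C%C.
Proof. by rewrite /cexp /= cos0 sin0 mulr1. Qed.

Lemma cexpX z n : cexp (n%:R * z) = cexp z ^+ n.
Proof.
elim: n => [|n ih]; first by rewrite mul0r cexp0 expr0.
by rewrite -natr1 mulrDl mul1r cexpD ih exprSr.
Qed.

Lemma cder_cexp z x : cder (fun y => cexp (z * y%:C%C)) (z * cexp (z * x%:C%C)) x.
Proof.
case: z => a b; rewrite /cexp.
under eq_fun do rewrite cReM cImM /= !mulr0 subr0 add0r.
rewrite cReM cImM /= !mulr0 subr0 add0r.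
have da : der (fun y => a * y) a x.
  by apply: (der_eq (derZ a (der_id x))); rewrite mulr1.
have db : der (fun y => b * y) b x.
  by apply: (der_eq (derZ b (der_id x))); rewrite mulr1.
have de := der_comp (is_derive_expR (a * x)) da.
have dc := der_comp (is_derive_cos (b * x)) db.
have ds := der_comp (is_derive_sin (b * x)) db.
split=> /=.
  under eq_fun do rewrite mul0r subr0.
  by apply: (der_eq (derM de dc)); ring.
under eq_fun do rewrite mul0r addr0.
by apply: (der_eq (derM de ds)); ring.
Qed.

Definition cpow v z : C := cexp (- z * (ln v)%:C%C).

Lemma cpow1 z : cpow 1 z = 1.
Proof. by rewrite /cpow ln1 mulr0 cexp0. Qed.

Lemma cpowM x y z : 0 < x -> 0 < y -> cpow (x * y) z = cpow x z * cpow y z.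
Proof. by move=> x0 y0; rewrite /cpow lnM // rmorphD mulrDr cexpD. Qed.

Lemma cpowD v z w : cpow v (z + w) = cpow v z * cpow v w.
Proof. by rewrite /cpow opprD mulrDl cexpD. Qed.

Lemma normc_cpow v z : normc (cpow v z) = expR (- Re z * ln v).
Proof. by rewrite normc_cexp cReM /= mulr0 subr0 raddfN. Qed.

Lemma cpow_nat1 v : 0 < v -> cpow v 1 = v^-1%:C%C.
Proof.
move=> v0; have -> : cpow v 1 = cexp (- ln v)%:C%C.
  by rewrite /cpow mulN1r rmorphN.
by rewrite cexp_real expRN lnK.
Qed.

Lemma cpow_real v x : cpow v x%:C%C = (expR (- x * ln v))%:C%C.
Proof. by rewrite /cpow -rmorphN -rmorphM cexp_real. Qed.

(** Up to the sign [(-1)^j], the [j]-th derivative of [v ^ -z] in [z]. *)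
Definition lpow (j : nat) z v : C := (ln v ^+ j)%:C%C * cpow v z.

Lemma normc_lpow j z v : normc (lpow j z v) = `|ln v| ^+ j * expR (- Re z * ln v).
Proof. by rewrite normcM normcR normrX normc_cpow. Qed.

Lemma cder_lpow j z v : 0 < v ->
  cder (lpow j z) (- z * lpow j (z + 1) v + j%:R * lpow j.-1 (z + 1) v) v.
Proof.
move=> v0; have dl := is_derive1_ln v0.
have d1 := cder_real (derX j dl).
have d2 := cder_comp (cder_cexp (- z) (ln v)) dl.
apply: (cder_eq (cderM d1 d2)).
rewrite /lpow cpowD cpow_nat1 // /cpow !rmorphM /= rmorph_nat; ring.
Qed.

End ComplexPowers.

(** * Convergence of Dirichlet series and the primitives of their terms *)

Section DirichletSeries.
Variable R : realType.
Local Notation C := R[i].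
Implicit Types (x y v eta : R) (z w u : C).

Lemma nat_ge1 n : (0 < n)%N -> 1 <= n%:R :> R.
Proof. by move=> h; rewrite (ler_nat _ 1%N). Qed.

Lemma ltr0n_pos n : (0 < n)%N -> 0 < n%:R :> R.
Proof. by rewrite ltr0n. Qed.

Lemma ln_nat_ge0 n : 0 <= ln (n%:R : R).
Proof.
case: n => [|n]; first by rewrite ln0.
by rewrite ln_ge0 // nat_ge1.
Qed.

Lemma ler_ln_pos x y : 0 < x -> x <= y -> ln x <= ln y.
Proof. by move=> x0 xy; rewrite ler_ln // posrE // (lt_le_trans x0). Qed.

Lemma ge_ln x : 0 < x -> 1 - x^-1 <= ln x.
Proof.
move=> x0; have := expR_ge1Dx (- ln x).
by rewrite expRN lnK ?posrE //; lra.
Qed.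

Lemma exprn_le_expR x j : 0 <= x -> x ^+ j <= j`!%:R * expR x.
Proof.
move=> x0; case: j => [|j].
  by rewrite expr0 fact0 mul1r -expR0 ler_expR.
have := expR_ge1Dxn j x0 => h.
rewrite mulrC -ler_pdivrMr ?ltr0n ?fact_gt0 //.
by apply: le_trans h; rewrite lerDr.
Qed.

Lemma ln_exp_le x j eta : 0 < eta -> 0 <= x ->
  x ^+ j <= j`!%:R * eta ^- j * expR (eta * x).
Proof.
move=> e0 x0; rewrite mulrAC ler_pdivlMr ?exprn_gt0 // -exprMn mulrC.
by apply: exprn_le_expR; rewrite mulr_ge0 // ltW.
Qed.

(* [n ^ -x], with the value 0 at [n = 0]: all Dirichlet series are indexed
   from 0. *)
Definition npow x (n : nat) : R := if n is 0 then 0 else expR (- x * ln n%:R).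

Lemma npow_ge0 x n : 0 <= npow x n.
Proof. by case: n => // n; exact: expR_ge0. Qed.

Lemma npow_gt0 x n : (0 < n)%N -> 0 < npow x n.
Proof. by case: n => // n _; exact: expR_gt0. Qed.

Lemma npowD x y n : npow (x + y) n = npow x n * npow y n.
Proof. by case: n => [|n]; rewrite ?mul0r //= -expRD; congr expR; ring. Qed.

Lemma npow_le x y n : x <= y -> npow y n <= npow x n.
Proof.
move=> xy; case: n => // n; rewrite ler_expR ler_wpM2r ?ln_nat_ge0 //.
by rewrite lerN2.
Qed.

Lemma npow1 n : npow 1 n = n%:R^-1.
Proof.
case: n => [|n]; first by rewrite invr0.
by rewrite /npow mulN1r expRN lnK // posrE ltr0n_pos.
Qed.

(** The integral test in telescoped form: [eta * b^-(1+eta) <= a^-eta - b^-eta] for [b = a + 1],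
    which follows from [1/b <= ln (b / a)]. *)
Lemma sum_npow eta n : 0 < eta -> \sum_(i < n) npow (1 + eta) i <= 1 + eta^-1.
Proof.
move=> e0; have ei : 0 < eta^-1 by rewrite invr_gt0.
have step m : (0 < m)%N ->
    \sum_(i < m.+1) npow (1 + eta) i <= 1 + eta^-1 - eta^-1 * npow eta m.
  elim: m => // -[_ _|m ih _].
    rewrite 2!big_ord_recr big_ord0 /= ln1 !mulr0 expR0 !add0r; lra.
  rewrite big_ord_recr /=; apply: (le_trans (lerD (ih isT) (lexx _))).
  suff key : eta * expR (- (1 + eta) * ln m.+2%:R) <=
      npow eta m.+1 - expR (- eta * ln m.+2%:R).
    have := ler_wpM2l (ltW ei) key.
    by rewrite mulrA mulVf ?gt_eqF // mul1r mulrBr; lra.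
  set a : R := m.+1%:R; set b : R := m.+2%:R.
  have a0 : 0 < a by rewrite ltr0n.
  have b0 : 0 < b by rewrite ltr0n.
  have ab : b = a + 1 by rewrite /a /b natr1.
  have -> : expR (- (1 + eta) * ln b) = b^-1 * expR (- eta * ln b).
    by rewrite -[b^-1]lnK ?posrE ?invr_gt0 // -expRD lnV ?posrE //; congr expR; ring.
  have -> : npow eta m.+1 = expR (eta * (ln b - ln a)) * expR (- eta * ln b).
    by rewrite /npow -expRD; congr expR; rewrite /a; ring.
  rewrite mulrA -[X in _ <= _ - X]mul1r -mulrBl ler_wpM2r ?expR_ge0 //.
  have h1 := expR_ge1Dx (eta * (ln b - ln a)).
  have := ge_ln (divr_gt0 b0 a0); rewrite ln_div ?posrE // invf_div => h2.
  have h3 : 1 - a / b = b^-1 by rewrite {1}ab; field; rewrite gt_eqF //; lra.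
  have : eta * b^-1 <= eta * (ln b - ln a) by rewrite ler_pM2l // -h3.
  by move=> h4; apply: (le_trans h4); rewrite lerBrDl.
case: n => [|[|n]].
- by rewrite big_ord0 addr_ge0 // ltW.
- by rewrite big_ord_recr big_ord0 /= addr0 addr_ge0 // ltW.
apply: (le_trans (step n.+1 isT)).
by rewrite gerBl mulr_ge0 ?ltW ?npow_gt0.
Qed.

Lemma ln_npow_le j eta n : 0 < eta ->
  ln n%:R ^+ j * npow (1 + eta) n <=
  j`!%:R * (eta / 2) ^- j * npow (1 + eta / 2) n.
Proof.
move=> e0; case: n => [|n]; first by rewrite !mulr0.
have -> : npow (1 + eta) n.+1 = expR (- (eta / 2 * ln n.+1%:R)) * npow (1 + eta / 2) n.+1.
  by rewrite /npow -expRD; congr expR; field.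
rewrite mulrA ler_wpM2r ?npow_ge0 // expRN ler_pdivrMr ?expR_gt0 //.
by apply: ln_exp_le; rewrite ?ln_nat_ge0 // divr_gt0.
Qed.

(* A majorant of the sum of [ln n ^ j * n ^ -(1 + eta)]: half of [eta] absorbs
   the logarithms. *)
Definition mass (j : nat) eta : R := j`!%:R * (eta / 2) ^- j * (1 + (eta / 2)^-1).

Lemma mass_ge0 j eta : 0 < eta -> 0 <= mass j eta.
Proof.
move=> e0; have e1 : 0 < eta / 2 by rewrite divr_gt0.
have e2 : 0 <= (eta / 2)^-1 by rewrite invr_ge0 ltW.
by rewrite !mulr_ge0 ?ler0n ?invr_ge0 ?exprn_ge0 ?addr_ge0 // ltW.
Qed.

Lemma sum_ln_npow j eta n : 0 < eta ->
  \sum_(i < n) ln i%:R ^+ j * npow (1 + eta) i <= mass j eta.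
Proof.
move=> e0.
apply: (@le_trans _ _ (\sum_(i < n) (j`!%:R * (eta / 2) ^- j * npow (1 + eta / 2) i))).
  by apply: ler_sum => i _; exact: ln_npow_le.
rewrite -mulr_sumr ler_wpM2l //; last by apply: sum_npow; rewrite divr_gt0.
by rewrite mulr_ge0 ?ler0n // invr_ge0 exprn_ge0 // divr_ge0 // ltW.
Qed.

Definition dterm j z (n : nat) : C := if n is 0 then 0 else lpow j z n%:R.

Lemma normc_dterm j z n :
  normc (dterm j z n) = ln n%:R ^+ j * npow (Re z) n.
Proof.
case: n => [|n]; first by rewrite normc0 mulr0.
by rewrite normc_lpow ger0_norm // ln_nat_ge0.
Qed.

Lemma abs_bound_dterm j z eta : 0 < eta -> 1 + eta <= Re z ->
  abs_bound (dterm j z) (mass j eta).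
Proof.
move=> e0 hz n; apply: le_trans (sum_ln_npow j n e0).
apply: ler_sum => i _; rewrite normc_dterm ler_wpM2l ?npow_le //.
by rewrite exprn_ge0 // ln_nat_ge0.
Qed.

(* Repeated integration by parts: an antiderivative of [lpow j (u + 1)]. *)
Fixpoint lpow_prim j u v : C :=
  if j is i.+1 then (i.+1%:R * lpow_prim i u v - lpow i.+1 u v) / u
  else - lpow 0 u v / u.

Lemma cder_lpow_prim j u v : u != 0 -> 0 < v -> cder (lpow_prim j u) (lpow j (u + 1) v) v.
Proof.
move=> u0 v0; elim: j => [|j ih] /=.
  have := cderZ (- u^-1) (cder_lpow 0 u v0).
  congr cder; first by apply: funext => y; ring.
  by rewrite mul0r addr0 mulrA mulrNN mulVf // mul1r.
have := cderZ u^-1 (cderB (cderZ j.+1%:R ih) (cder_lpow j.+1 u v0)).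
congr cder; first by apply: funext => y; rewrite mulrC.
by rewrite /=; field.
Qed.

Lemma lpow_prim1 j u : lpow_prim j u 1 = - j`!%:R / u ^+ j.+1.
Proof.
elim: j => [|j ih] /=; first by rewrite /lpow expr0 cpow1 mulr1 fact0.
rewrite ih /lpow ln1 expr0n /= mul0r subr0 factS natrM [u ^+ j.+2]exprS invfM -!mulrA [u^-1 * _]mulrC; ring.
Qed.

Lemma normc_lpow_le j u v eta : 0 < eta -> Re u = eta -> 1 <= v ->
  normc (lpow j u v) <= j`!%:R * (eta / 2) ^- j * expR (- (eta / 2) * ln v).
Proof.
move=> e0 ue v1; rewrite normc_lpow ue ger0_norm ?ln_ge0 //.
have -> : expR (- eta * ln v) = expR (- (eta / 2 * ln v)) * expR (- (eta / 2) * ln v).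
  by rewrite -expRD; congr expR; field.
rewrite mulrA ler_wpM2r ?expR_ge0 // expRN ler_pdivrMr ?expR_gt0 //.
by apply: ln_exp_le; rewrite ?ln_ge0 // divr_gt0.
Qed.

Lemma lpow_prim_decay j u eta : 0 < eta -> Re u = eta ->
  exists B, forall v, 1 <= v -> normc (lpow_prim j u v) <= B * expR (- (eta / 2) * ln v).
Proof.
move=> e0 ue; elim: j => [|j [B hB]].
  exists (0`!%:R * (eta / 2) ^- 0 / normc u) => v v1 /=.
  rewrite normcM normc_opp normcV mulrAC ler_wpM2r ?invr_ge0 ?normc_ge0 //.
  exact: normc_lpow_le.
exists ((j.+1%:R * B + j.+1`!%:R * (eta / 2) ^- j.+1) / normc u) => v v1.
rewrite /= normcM normcV mulrAC ler_wpM2r ?invr_ge0 ?normc_ge0 //.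
apply: (le_trans (le_normcB _ _)); rewrite mulrDl lerD ?normc_lpow_le //.
rewrite normcM -mulrA.
have -> : normc (j.+1%:R : C) = j.+1%:R.
  by rewrite -(rmorph_nat (real_complex R)) normcR normr_nat.
by rewrite ler_wpM2l ?ler0n // hB.
Qed.

Lemma nat_above x : exists N, forall n, (N <= n)%N -> x <= n%:R.
Proof.
exists (Num.truncn x).+1 => n hn; apply: (@le_trans _ _ (Num.truncn x).+1%:R).
  by rewrite ltW // truncnS_gt.
by rewrite ler_nat.
Qed.

Lemma lpow_prim_to0 j u e : 0 < Re u -> 0 < e ->
  exists N, forall n, (N <= n)%N -> normc (lpow_prim j u n%:R) <= e.
Proof.
move=> u0 e0; have [B hB] := lpow_prim_decay j u0 erefl.
set eta := Re u in hB.
have B1 : 0 < `|B| + 1 by have := normr_ge0 B; lra.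
have e1 : 0 < e / (`|B| + 1) by rewrite divr_gt0.
have [N hN] := nat_above (expR (- ln (e / (`|B| + 1)) / (eta / 2))).
exists N.+1 => n Nn; have n0 : (0 < n)%N by exact: leq_ltn_trans Nn.
apply: (le_trans (hB _ (nat_ge1 n0))).
have h2 : 0 < eta / 2 by rewrite divr_gt0.
have h1 : expR (- (eta / 2) * ln n%:R) <= e / (`|B| + 1).
  rewrite -[leRHS]lnK ?posrE // ler_expR mulNr lerNl -ler_pdivrMl // mulrC.
  by rewrite -[leLHS]expRK ler_ln_pos ?expR_gt0 // hN // ltnW.
apply: (@le_trans _ _ ((`|B| + 1) * (e / (`|B| + 1)))); last first.
  by rewrite mulrCA divff ?mulr1 // gt_eqF.
apply: ler_pM; rewrite ?expR_ge0 //; last by have := ler_norm B; lra.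
have := hB 1 (lexx _); rewrite ln1 mulr0 expR0 mulr1.
by apply: le_trans; exact: normc_ge0.
Qed.

End DirichletSeries.

(** * The zeta function to the right of the line Re z = 1 *)

Section PolarPart.
Variable R : realType.
Local Notation C := R[i].
Implicit Types (x y v t : R) (z w u : C).

(** The summand 1 makes [ell] at least 1, so its powers increase with the exponent, and lets
    [expR (ell (Im z))] dominate [normc z] in the strip. *)
Definition ell t : R := 1 + ln (`|t| + 3).

Lemma ell_ge1 t : 1 <= ell t.
Proof. by rewrite lerDl ln_ge0 //; have := normr_ge0 t; lra. Qed.

Lemma ell_gt0 t : 0 < ell t.
Proof. exact: lt_le_trans (ell_ge1 t). Qed.

Lemma normc_le_expR_ell z : 1 < Re z <= 2 -> normc z <= expR (ell (Im z)).
Proof.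
move=> /andP[h1 h2]; apply: (le_trans (normc_ReIm _)).
have t0 := normr_ge0 (Im z).
rewrite expRD lnK ?posrE; last by lra.
have e1 : 1 <= expR (1 : R) by rewrite -expR0 ler_expR.
rewrite [X in X + _]ger0_norm; last by lra.
by apply: (@le_trans _ _ (1 * (`|Im z| + 3))); [lra | rewrite ler_wpM2r //; lra].
Qed.

Lemma normc_nat n : normc (n%:R : C) = n%:R.
Proof. by rewrite -(rmorph_nat (real_complex R)) normcR normr_nat. Qed.

(* The telescoping sum of the primitive is the polar part, so the sum of these
   errors is the regular part of the series. *)
Definition prim_error j z (n : nat) : C :=
  if n is 0 then 0 else
  lpow j z n%:R - (lpow_prim j (z - 1) n.+1%:R - lpow_prim j (z - 1) n%:R).

Lemma prim_errorE j z n : (0 < n)%N -> prim_error j z n =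
  lpow j z n%:R - (lpow_prim j (z - 1) n.+1%:R - lpow_prim j (z - 1) n%:R).
Proof. by case: n. Qed.

Lemma cder_prim j z v : Re z != 1 -> 0 < v ->
  cder (lpow_prim j (z - 1)) (lpow j z v) v.
Proof.
move=> z1 v0; have u0 : z - 1 != 0.
  by apply: contra z1; rewrite subr_eq0 => /eqP ->.
by have := cder_lpow_prim j u0 v0; rewrite subrK.
Qed.

Lemma normc_lpow_unit j z n v : 1 <= Re z -> (0 < n)%N ->
  n%:R <= v <= n.+1%:R -> normc (lpow j z v) <= ln n.+1%:R ^+ j / n%:R.
Proof.
move=> z1 n0 /andP[v1 v2]; have n1 := nat_ge1 R n0.
have v0 : 1 <= v by exact: le_trans v1.
have l0 : 0 <= ln v by exact: ln_ge0.
rewrite normc_lpow ger0_norm // ler_pM ?exprn_ge0 ?expR_ge0 //.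
  by rewrite lerXn2r ?nnegrE ?ln_nat_ge0 // ler_ln_pos //; lra.
rewrite -[leRHS]lnK ?posrE ?invr_gt0; last by lra.
rewrite ler_expR lnV ?posrE; last by lra.
rewrite mulNr lerN2 -[leLHS]mul1r ler_pM ?ln_nat_ge0 //.
by rewrite ler_ln_pos //; lra.
Qed.

(** The term and the increment of the primitive are bounded separately; without any cancellation the
    bound is free of [Im z]. *)
Lemma prim_error_le1 j z n : 1 < Re z -> (0 < n)%N ->
  normc (prim_error j z n) <= 2 * (ln n.+1%:R ^+ j / n%:R).
Proof.
move=> z1 n0; rewrite /prim_error; case: n n0 => // n _.
apply: (le_trans (le_normcB _ _)).
have h1 : normc (lpow j z n.+1%:R) <= ln n.+2%:R ^+ j / n.+1%:R :> R.
  by apply: normc_lpow_unit => //; [exact: ltW | rewrite lexx /= ler_nat].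
suff : normc (lpow_prim j (z - 1) n.+2%:R - lpow_prim j (z - 1) n.+1%:R) <=
   ln n.+2%:R ^+ j / n.+1%:R :> R.
  by move=> h2; rewrite mulrDl mul1r lerD.
have -> : ln n.+2%:R ^+ j / n.+1%:R = ln n.+2%:R ^+ j / n.+1%:R * (n.+2%:R - n.+1%:R) :> R.
  by rewrite -natrB // subSnn mulr1.
apply: (cmvt (f := lpow j z)); first by rewrite ler_nat.
  move=> v /andP[v1 _]; apply: cder_prim; first by rewrite gt_eqF.
  by apply: lt_le_trans v1; rewrite ltr0n.
by move=> v hv; apply: normc_lpow_unit => //; exact: ltW.
Qed.

(** Up to sign the error is the increment of the auxiliary [F], whose derivative vanishes at [n].
    Two mean value inequalities gain a factor [1/n] over [prim_error_le1], at the price of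
    [normc z]. *)
Lemma prim_error_le2 j z n : 1 < Re z -> (0 < n)%N ->
  normc (prim_error j z n) <=
  (normc z + j%:R) * (1 + ln n.+1%:R) ^+ j / n%:R ^+ 2.
Proof.
move=> z1 n0; have n1 := nat_ge1 R n0.
have zn : Re z != 1 by rewrite gt_eqF.
set D := _ / _.
have dg v : n%:R <= v <= n.+1%:R -> cder (lpow j z)
    (- z * lpow j (z + 1) v + j%:R * lpow j.-1 (z + 1) v) v.
  by move=> /andP[v1 _]; apply: cder_lpow; lra.
have dgB v : n%:R <= v <= n.+1%:R ->
    normc (- z * lpow j (z + 1) v + j%:R * lpow j.-1 (z + 1) v) <= D.
  move=> hv; have /andP[v1 v2] := hv.
  have e2 : expR (- Re (z + 1) * ln v) <= n%:R ^- 2.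
    have -> : n%:R ^- 2 = expR (- (2 * ln n%:R)) :> R.
      rewrite expRN expRM_natl lnK // posrE; lra.
    rewrite ler_expR mulNr lerN2 cReD ler_pM ?ln_nat_ge0 //; first by rewrite /=; lra.
    by rewrite ler_ln_pos //; lra.
  have l0 : 0 <= ln v by rewrite ln_ge0 //; lra.
  have lv : ln v <= 1 + ln n.+1%:R.
    by apply: (@le_trans _ _ (ln n.+1%:R)); [rewrite ler_ln_pos //; lra | lra].
  have L1 : 1 <= 1 + ln n.+1%:R :> R by rewrite lerDl ln_nat_ge0.
  have q i : (i <= j)%N -> normc (lpow i (z + 1) v) <= (1 + ln n.+1%:R) ^+ j / n%:R ^+ 2.
    move=> ij; rewrite normc_lpow ger0_norm // ler_pM ?exprn_ge0 ?expR_ge0 //.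
    apply: (@le_trans _ _ ((1 + ln n.+1%:R) ^+ i)).
      by rewrite lerXn2r ?nnegrE //; lra.
    by rewrite ler_weXn2l.
  apply: (le_trans (ler_normcD _ _)).
  rewrite (normcM (- z)) (normcM j%:R) normc_opp normc_nat /D mulrDl mulrDl -!mulrA.
  by rewrite lerD // ler_wpM2l ?normc_ge0 ?ler0n ?q // leq_pred.
have D1 : D = D * (n.+1%:R - n%:R) by rewrite -natrB // subSnn mulr1.
have D0 : 0 <= D.
  apply: le_trans (dgB n%:R _); first exact: normc_ge0.
  by rewrite lexx ler_nat leqnSn.
pose F v := lpow_prim j (z - 1) v - v%:C%C * lpow j z n%:R.
have -> : normc (prim_error j z n) = normc (F n.+1%:R - F n%:R).
  rewrite prim_errorE // normcBC /F; congr normc.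
  have -> : (n.+1%:R : R)%:C%C = (n%:R : R)%:C%C + 1 :> C.
    by rewrite -[n.+1]addn1 natrD rmorphD.
  by ring.
rewrite D1; apply: (cmvt (f := fun v => lpow j z v - lpow j z n%:R)).
- by rewrite ler_nat.
- move=> v hv; have /andP[v1 _] := hv.
  have v0 : 0 < v by lra.
  have := cderB (cder_prim j zn v0)
     (cderM (cder_real (der_id v)) (cder_cst (lpow j z n%:R) v)).
  by rewrite mul1r mulr0 addr0.
- move=> v hv; have /andP[v1 v2] := hv.
  apply: (@le_trans _ _ (D * (v - n%:R))).
    apply: (cmvt (f := fun v => - z * lpow j (z + 1) v + j%:R * lpow j.-1 (z + 1) v)) => //.
    + by move=> y /andP[h1 h2]; apply: dg; rewrite h1 (le_trans h2).
    + by move=> y /andP[h1 h2]; apply: dgB; rewrite h1 (le_trans h2).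
  rewrite -[leRHS]mulr1 ler_wpM2l // lerBlDl.
  by move: v2; rewrite -natr1.
Qed.

Lemma ln_succ_le n : (0 < n)%N -> ln n.+1%:R <= 1 + ln n%:R :> R.
Proof.
move=> n0; have n1 := nat_ge1 R n0.
rewrite -lerBlDr -ln_div ?posrE ?ltr0n //.
have -> : n.+1%:R / n%:R = 1 + n%:R^-1 :> R.
  by rewrite -natr1 mulrDl divff ?gt_eqF ?ltr0n // mul1r.
apply: (le_trans (le_ln1Dx _)); first by apply: (@lt_le_trans _ _ 0); rewrite // invr_ge0 ler0n.
by rewrite invf_le1 // ltr0n.
Qed.

(* With [l = ell (Im z)]: for [ln n <= 4 l] use [prim_error_le1], as then
   [n ^ -1 = O(n ^ -(1 + 1/l))]; for larger [n] use [prim_error_le2], as then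
   [normc z <= e^l <= n ^ (1/4)]. *)
Lemma prim_error_le j : exists2 K : R, 0 < K & forall z n, 1 < Re z <= 2 ->
  normc (prim_error j z n) <= K * (ell (Im z) ^+ j *
    npow (1 + (ell (Im z))^-1) n + npow (1 + 1 / 2) n).
Proof.
pose K1 : R := 2 * 4 ^+ j * expR 4.
pose K2 : R := (1 + j%:R) * (j`!%:R * (1 / 4) ^- j) * expR 1.
have K10 : 0 < K1 by rewrite !mulr_gt0 ?exprn_gt0 ?expR_gt0.
have K20 : 0 < K2.
  rewrite !mulr_gt0 ?expR_gt0 ?ltr0n ?fact_gt0 ?invr_gt0 ?exprn_gt0 //.
exists (K1 + K2) => [|z n zz]; first exact: addr_gt0.
set l := ell _.
have /andP[z1 z2] := zz.
have l1 : 1 <= l := ell_ge1 _.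
have l0 : 0 < l := ell_gt0 _.
have A0 : 0 <= l ^+ j * npow (1 + l^-1) n.
  by rewrite mulr_ge0 ?exprn_ge0 ?npow_ge0 // ltW.
have B0 : 0 <= npow (1 + 1 / 2) n :> R := npow_ge0 _ _.
suff : normc (prim_error j z n) <= K1 * (l ^+ j * npow (1 + l^-1) n) \/
       normc (prim_error j z n) <= K2 * npow (1 + 1 / 2) n.
  have p1 := mulr_ge0 (ltW K10) A0; have p2 := mulr_ge0 (ltW K10) B0.
  have p3 := mulr_ge0 (ltW K20) A0; have p4 := mulr_ge0 (ltW K20) B0.
  by rewrite mulrDl !mulrDr; case; lra.
case: n {A0 B0} => [|n]; first by left; rewrite normc0 !mulr0.
set N := n.+1; have N0 : (0 < N)%N by [].
have NR : 0 < N%:R :> R by rewrite ltr0n.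
have L0 := ln_nat_ge0 R N.+1.
have [hl|hl] := lerP (ln N.+1%:R) (4 * l); [left|right].
  apply: (le_trans (prim_error_le1 j z1 N0)).
  have e4 : 1 <= expR 4 * npow l^-1 N :> R.
    rewrite -expRD -[leLHS]expR0 ler_expR mulNr subr_ge0.
    rewrite ler_pdivrMl // mulrC; apply: le_trans hl.
    by rewrite ler_ln_pos // ler_nat.
  have h4 : ln N.+1%:R ^+ j <= 4 ^+ j * l ^+ j :> R.
    by rewrite -exprMn lerXn2r ?nnegrE // mulr_ge0 // ltW.
  have -> : K1 * (l ^+ j * npow (1 + l^-1) N) =
      2 * ((4 ^+ j * l ^+ j) * N%:R^-1 * (expR 4 * npow l^-1 N)).
    by rewrite npowD npow1 /K1; ring.
  rewrite ler_pM2l // -[leLHS]mulr1 ler_pM //.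
    by rewrite mulr_ge0 ?invr_ge0 ?ler0n ?exprn_ge0.
  by rewrite ler_wpM2r // invr_ge0 ler0n.
apply: (le_trans (prim_error_le2 j z1 N0)).
set L := ln N.+1%:R in L0 hl *.
have h1 : normc z + j%:R <= (1 + j%:R) * expR (1 / 4 * L).
  have hz := normc_le_expR_ell zz; rewrite -/l in hz.
  have h2 : expR l <= expR (1 / 4 * L) by rewrite ler_expR; lra.
  have h3 : 1 <= expR (1 / 4 * L) by rewrite -[leLHS]expR0 ler_expR; lra.
  rewrite mulrDl mul1r lerD //; first exact: le_trans h2.
  by rewrite -[leLHS]mulr1 ler_wpM2l ?ler0n.
have h2 : (1 + L) ^+ j <= j`!%:R * (1 / 4) ^- j * expR (1 / 4 * (1 + L)).
  by apply: ln_exp_le; lra.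
have h3 : expR (1 / 4 * L) * expR (1 / 4 * (1 + L)) <=
    expR 1 * expR (1 / 2 * ln N%:R).
  rewrite -!expRD ler_expR; have := ln_succ_le N0; rewrite -/L; lra.
have -> : K2 * npow (1 + 1 / 2) N = (1 + j%:R) * (j`!%:R * (1 / 4) ^- j) *
    (expR 1 * expR (1 / 2 * ln N%:R)) / N%:R ^+ 2.
  have -> : N%:R ^- 2 = expR (- (2 * ln N%:R)) :> R.
    by rewrite expRN expRM_natl lnK // posrE.
  have -> : npow (1 + 1 / 2) N = expR (1 / 2 * ln N%:R) * expR (- (2 * ln N%:R)) :> R.
    by rewrite -expRD /npow; congr expR; field.
  by rewrite /K2; ring.
rewrite ler_wpM2r ?invr_ge0 ?exprn_ge0 ?ler0n //.
apply: (@le_trans _ _ ((1 + j%:R) * expR (1 / 4 * L) *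
    (j`!%:R * (1 / 4) ^- j * expR (1 / 4 * (1 + L))))).
  rewrite ler_pM // ?exprn_ge0 ?addr_ge0 ?normc_ge0 ?ler0n //.
rewrite mulrACA ler_wpM2l // mulr_ge0 ?addr_ge0 ?ler0n //.
Qed.

(** [(-1)^j] times the [j]-th derivative of zeta. Each derivative is a series of its own, so
    relations between them are proved on coefficients. *)
Definition zeta_j (j : nat) z : C := csum (dterm j z).

Lemma has_sum_zeta_j j z : 1 < Re z -> has_sum (dterm j z) (zeta_j j z).
Proof.
move=> z1; apply: (csumP (abs_bound_dterm j (eta := Re z - 1) _ _)); lra.
Qed.

Lemma has_sum_prim j z : 1 < Re z ->
  has_sum (fun n => if n is 0 then 0 else
    lpow_prim j (z - 1) n.+1%:R - lpow_prim j (z - 1) n%:R)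
  (- lpow_prim j (z - 1) 1).
Proof.
move=> z1 e e0.
have u0 : 0 < Re (z - 1) by rewrite cReB subr_gt0.
have [N hN] := lpow_prim_to0 j u0 e0.
exists N.+1 => n Nn; case: n Nn => // n Nn.
have -> : \sum_(i < n.+1) (if val i is 0 then 0 else
    lpow_prim j (z - 1) i.+1%:R - lpow_prim j (z - 1) i%:R) =
    lpow_prim j (z - 1) n.+1%:R - lpow_prim j (z - 1) 1.
  elim: n {Nn} => [|n ih]; first by rewrite big_ord_recr big_ord0 /= add0r subrr.
  by rewrite big_ord_recr ih /=; ring.
by rewrite opprK subrK hN // ltnW.
Qed.

(** The subtracted term is [(-1)^j] times the [j]-th derivative of [1 / (z - 1)]. *)
Definition zeta_reg j z := zeta_j j z - j`!%:R / (z - 1) ^+ j.+1.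

(** Summing the exponent [1 + 1/l] of [prim_error_le] costs one more factor [l]; the 5 comes from
    [l^j (1 + l) + 3 <= 5 l^(j+1)]. *)
Lemma zeta_reg_bound j : exists2 K : R, 0 < K & forall z, 1 < Re z <= 2 ->
  normc (zeta_reg j z) <= K * ell (Im z) ^+ j.+1.
Proof.
have [K K0 hK] := prim_error_le j.
exists (K * 5) => [|z zz]; first exact: mulr_gt0.
have /andP[z1 z2] := zz; set l := ell _.
have l1 : 1 <= l := ell_ge1 _.
have l0 : 0 < l := ell_gt0 _.
have hs : has_sum (prim_error j z) (zeta_reg j z).
  have h1 := has_sumD (has_sum_zeta_j j z1) (has_sumZ (-1) (has_sum_prim j z1)).
  rewrite lpow_prim1 mulNr opprK mulN1r in h1.
  have -> : prim_error j z = fun n => dterm j z n + -1 * (if n is 0 then 0 else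
    lpow_prim j (z - 1) n.+1%:R - lpow_prim j (z - 1) n%:R).
    by apply: funext => -[|n] /=; rewrite mulN1r // oppr0 addr0.
  exact: h1.
apply: (has_sum_normc_le _ hs) => n.
apply: (le_trans (le_normc_sum _ _ _)).
apply: (@le_trans _ _ (\sum_(i < n) K * (l ^+ j * npow (1 + l^-1) i + npow (1 + 1 / 2) i))).
  by apply: ler_sum => i _; exact: hK.
rewrite -mulr_sumr -mulrA ler_pM2l // big_split /= -mulr_sumr.
have s1 : \sum_(i < n) npow (1 + l^-1) i <= 1 + l.
  by have := sum_npow n (_ : 0 < l^-1); rewrite invrK invr_gt0; apply.
have s2 : \sum_(i < n) npow (1 + 1 / 2) i <= 3 :> R.
  by have := sum_npow n (_ : 0 < 1 / 2 :> R); move=> h; apply: (le_trans (h _)); lra.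
have lj : 1 <= l ^+ j by exact: exprn_ege1.
have : l ^+ j * (\sum_(i < n) npow (1 + l^-1) i) <= l ^+ j * (1 + l).
  by rewrite ler_wpM2l // (le_trans _ lj).
have : l ^+ j <= l ^+ j * l by rewrite -[leLHS]mulr1 ler_wpM2l // (le_trans _ lj).
rewrite exprSr; lra.
Qed.

End PolarPart.

(** * The von Mangoldt function and Dirichlet convolution *)

Section Mangoldt.
Variable R : realType.
Local Notation C := R[i].

(** The indicator form needs no case distinction on prime powers: its ranges can be enlarged
    ([mangoldt_widen]) until they are the same for all [n], and the sums exchanged. *)
Definition mangoldt (n : nat) : R :=
  \sum_(p < n.+1 | prime p) \sum_(1 <= a < n.+1) (p ^ a == n)%N%:R * ln p%:R.

Lemma mangoldt_ge0 n : 0 <= mangoldt n.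
Proof.
apply: sumr_ge0 => p _; apply: sumr_ge0 => a _.
by rewrite mulr_ge0 ?ler0n ?ln_nat_ge0.
Qed.

Lemma mangoldt_widen N n : (n <= N)%N -> mangoldt n =
  \sum_(p < N.+1 | prime p) \sum_(1 <= a < N.+1) (p ^ a == n)%N%:R * ln p%:R.
Proof.
move=> nN; rewrite /mangoldt.
rewrite (big_ord_widen_cond N.+1 prime
  (fun p => \sum_(1 <= a < n.+1) (p ^ a == n)%N%:R * ln p%:R)) //.
rewrite [LHS]big_mkcondr /=; apply: eq_bigr => p pp.
have [pn|pn] := ltnP p n.+1.
  rewrite [RHS](big_cat_nat (n := n.+1)) //= [X in _ = _ + X]big1_seq ?addr0 //.
  move=> a; rewrite mem_index_iota => /and3P[_ an _].
  have [e|_] := eqVneq; last by rewrite mul0r.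
  have : (a < p ^ a)%N by rewrite ltn_expl // prime_gt1.
  by rewrite e => h; have := leq_trans h (ltnW an); rewrite ltnn.
rewrite big1_seq // => a; rewrite mem_index_iota => /and3P[_ a0 _].
have [e|_] := eqVneq; last by rewrite mul0r.
have : (p <= p ^ a)%N by rewrite -[X in (X <= _)%N]expn1 leq_pexp2l // prime_gt0.
by rewrite e leqNgt pn.
Qed.

Lemma ln_prime_decomp n : (0 < n)%N ->
  ln (n%:R : R) = \sum_(p < n.+1 | prime p) (logn p n)%:R * ln p%:R.
Proof.
move=> n0; rewrite -[in LHS](partnT n0) /partn big_mkord natr_prod.
rewrite (_ : \sum_(p < n.+1 | prime p) _ = \sum_(p < n.+1) (logn p n)%:R * ln p%:R); last first.
  rewrite big_mkcond; apply: eq_bigr => p _; case: ifP => // /negbT pp.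
  by rewrite lognE (negbTE pp) mul0r.
suff key m : ln (\prod_(p < m) (p ^ logn p n)%:R) =
    \sum_(p < m) (logn p n)%:R * ln p%:R :> R by exact: key.
elim: m => [|m ih]; first by rewrite !big_ord0 ln1.
rewrite !big_ord_recr /= lnM ?posrE ?ih.
- congr (_ + _); rewrite natrX.
  case: m {ih} => [|m]; first by rewrite lognE /= mul0r expr0 ln1.
  by rewrite lnXn ?ltr0n // mulr_natl.
- apply: prodr_gt0 => p _; rewrite ltr0n expn_gt0.
  by case: (nat_of_ord p) => //; rewrite lognE.
- by rewrite ltr0n expn_gt0; case: m {ih} => //; rewrite lognE.
Qed.

(** For a fixed prime [p], the powers [p ^ a] with [a >= 1] that divide [n] are counted by
    [logn p n]. *)
Lemma sum_mangoldt_dvd n : (0 < n)%N ->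
  \sum_(d < n.+1 | (d %| n)%N) mangoldt d = ln n%:R.
Proof.
move=> n0; rewrite ln_prime_decomp //.
rewrite (eq_bigr (fun d : 'I_n.+1 => \sum_(p < n.+1 | prime p)
   \sum_(1 <= a < n.+1) (p ^ a == d)%N%:R * ln p%:R)); last first.
  by move=> d _; apply: mangoldt_widen; rewrite -ltnS.
rewrite exchange_big /=; apply: eq_bigr => p pp.
rewrite exchange_big /=.
transitivity (\sum_(1 <= a < n.+1) (a <= logn p n)%N%:R * ln p%:R : R).
  apply: eq_bigr => a _; rewrite -mulr_suml; congr (_ * _).
  rewrite -pfactor_dvdn //.
  have [dv|ndv] := boolP (p ^ a %| n)%N.
    have lt : (p ^ a < n.+1)%N by rewrite ltnS dvdn_leq.
    rewrite (bigD1 (Ordinal lt)) //= eqxx big1 ?addr0 // => d /andP[_ h].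
    case: eqP => // e; case/negP: h; apply/eqP/val_inj; exact: esym.
  rewrite big1 // => d dn; case: eqP => // e.
  by rewrite e dn in ndv.
rewrite -mulr_suml; congr (_ * _).
have ln_ : (logn p n < n.+1)%N by rewrite ltnS ltnW // ltn_logl.
rewrite (big_cat_nat (n := (logn p n).+1)) //= [X in _ + X]big1_seq ?addr0; last first.
  by move=> a; rewrite mem_index_iota => /and3P[_ h _]; rewrite leqNgt h.
rewrite (eq_big_nat _ _ (F2 := fun=> 1)); last by move=> a /andP[_]; rewrite ltnS => ->.
by rewrite big_const_nat subn1 /= iter_addr addr0.
Qed.

Lemma mangoldt0 : mangoldt 0 = 0.
Proof. by rewrite /mangoldt big_mkcond big_ord_recr big_ord0 /= add0r. Qed.

Lemma mangoldt_le_ln n : mangoldt n <= ln n%:R.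
Proof.
case: n => [|n]; first by rewrite mangoldt0 ln0.
rewrite -sum_mangoldt_dvd // (bigD1 ord_max) //= lerDl.
by apply: sumr_ge0 => d _; exact: mangoldt_ge0.
Qed.

Lemma mangoldt_prime p : prime p -> mangoldt p = ln p%:R.
Proof.
move=> pp; rewrite /mangoldt (bigD1 ord_max) //= [X in _ + X]big1 ?addr0; last first.
  move=> q /andP[pq qp]; rewrite big1_seq // => a _.
  case: eqP => [e|]; last by rewrite mul0r.
  case/negP: qp; apply/eqP/val_inj => /=.
  have a0 : (0 < a)%N.
    by case: a e => // e; have := prime_gt1 pp; rewrite -[X in (_ < X)%N]e.
  by apply/eqP; rewrite -dvdn_prime2 // -[X in (_ %| X)%N]e dvdn_exp.
rewrite big_ltn ?ltnS ?prime_gt0 // expn1 eqxx mul1r big1_seq ?addr0 //.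
move=> a; rewrite mem_index_iota => /and3P[_ a2 _].
case: eqP => [e|]; last by rewrite mul0r.
have : (p ^ 1 < p ^ a)%N by rewrite ltn_exp2l // prime_gt1.
by rewrite e expn1 ltnn.
Qed.

End Mangoldt.

Section Convolution.
Variable R : realType.
Local Notation C := R[i].
Implicit Types a b : nat -> C.

(** Dirichlet convolution. At [n = 0] the only index is [d = 0] and the value is [a 0 * b 0], hence
    the requirement below that both sequences vanish at 0. *)
Definition dconv a b (n : nat) : C := \sum_(d < n.+1 | (d %| n)%N) a d * b (n %/ d)%N.

Lemma dconv_widen a b X n : a 0%N = 0 -> b 0%N = 0 -> (n < X)%N ->
  dconv a b n = \sum_(d < X) \sum_(e < X) (d * e == n)%N%:R * (a d * b e).
Proof.
move=> a0 b0 nX; case: n nX => [|n] nX.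
  rewrite /dconv big_mkcond big_ord_recr big_ord0 /= a0 mul0r addr0.
  rewrite big1 // => d _; rewrite big1 // => e _; rewrite muln_eq0.
  by case: eqP => [->|_]; case: eqP => [->|_]; rewrite ?a0 ?b0 ?mul0r ?mulr0.
rewrite /dconv (big_ord_widen_cond X (fun d => d %| n.+1)%N
   (fun d => a d * b (n.+1 %/ d)%N)) //.
rewrite [LHS]big_mkcondl /= [LHS]big_mkcond /=; apply: eq_bigr => d _.
have [dn|dn] := boolP (d %| n.+1)%N; last first.
  rewrite if_same big1 // => e _; case: eqP => [h|_]; last by rewrite mul0r.
  by move: dn; rewrite -h dvdn_mulr.
have d0 : (0 < d)%N by exact: dvdn_gt0 dn.
have -> : (d < n.+2)%N by rewrite ltnS dvdn_leq.
have lt : (n.+1 %/ d < X)%N by rewrite (leq_ltn_trans _ nX) // leq_div.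
rewrite (bigD1 (Ordinal lt)) //= mulnC divnK // eqxx mul1r big1 ?addr0 //.
move=> e /eqP ne; case: eqP => [h|_]; last by rewrite mul0r.
by case: ne; apply: val_inj; rewrite /= -h mulKn.
Qed.

Lemma abs_bound_cauchy a A e : abs_bound a A -> 0 < e ->
  exists N, forall X, (N <= X)%N ->
    \sum_(i < X) normc (a i) - \sum_(i < N) normc (a i) <= e.
Proof.
move=> hA e0; have e2 : 0 < e / 2 by rewrite divr_gt0.
have ha n : `|normc (a n)| <= normc (a n) by rewrite ger0_norm ?normc_ge0.
have [N hN] := real_series_cvg ha hA e2.
exists N => X NX; have := hN X NX; have := hN N (leqnn N).
by rewrite !ler_norml; lra.
Qed.

Lemma sum_nat_mono (f : nat -> R) (m n : nat) : (forall i, 0 <= f i) -> (m <= n)%N ->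
  \sum_(i < m) f i <= \sum_(i < n) f i.
Proof.
move=> f0 mn; rewrite -!(big_mkord xpredT) (big_cat_nat (n := m) (p := n)) //= lerDl.
by apply: sumr_ge0.
Qed.

Lemma le_normc_dconv a b n :
  normc (dconv a b n) <=
  Re (dconv (fun i => (normc (a i))%:C%C) (fun i => (normc (b i))%:C%C) n).
Proof.
rewrite /dconv raddf_sum /=; apply: (le_trans (le_normc_sum _ _ _)).
by apply: ler_sum => d _; rewrite normcM mul0r subr0.
Qed.

Lemma sum_dconv a b X : a 0%N = 0 -> b 0%N = 0 ->
  \sum_(n < X) dconv a b n =
  \sum_(d < X) \sum_(e < X) (d * e < X)%N%:R * (a d * b e).
Proof.
move=> a0 b0.
rewrite (eq_bigr (fun n : 'I_X => \sum_(d < X) \sum_(e < X) (d * e == n)%N%:R * (a d * b e))); last first.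
  by move=> n _; exact: dconv_widen.
rewrite exchange_big; apply: eq_bigr => d _ /=.
rewrite exchange_big; apply: eq_bigr => e _ /=.
rewrite -mulr_suml; congr (_ * _).
have [lt|ge] := ltnP.
  rewrite (bigD1 (Ordinal lt)) //= eqxx big1 ?addr0 // => n /eqP ne.
  by case: eqP => // h; case: ne; apply: val_inj.
by rewrite big1 // => n _; case: eqP => // h; move: ge; rewrite h leqNgt ltn_ord.
Qed.

Lemma abs_bound_dconv a b A B : a 0%N = 0 -> b 0%N = 0 ->
  abs_bound a A -> abs_bound b B -> abs_bound (dconv a b) (A * B).
Proof.
move=> a0 b0 hA hB X.
apply: (@le_trans _ _ (\sum_(n < X) Re
   (dconv (fun i => (normc (a i))%:C%C) (fun i => (normc (b i))%:C%C) n))).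
  by apply: ler_sum => n _; exact: le_normc_dconv.
rewrite -raddf_sum sum_dconv /=; try by rewrite ?a0 ?b0 normc0.
apply: (@le_trans _ _ ((\sum_(d < X) normc (a d)) * (\sum_(e < X) normc (b e)))); last first.
  by apply: ler_pM; rewrite ?sumr_ge0 // => *; exact: normc_ge0.
rewrite raddf_sum mulr_suml; apply: ler_sum => d _.
rewrite raddf_sum mulr_sumr; apply: ler_sum => e _ /=.
rewrite -(rmorph_nat (real_complex R)) -!rmorphM /=.
by case: ltnP => _; rewrite ?mul1r ?mul0r // mulr_ge0 ?normc_ge0.
Qed.

(** Once [N * N <= X], the pairs with [d * e < X] include the square of side [N], so the partial sum
    differs from a product of partial sums by no more than the tails of the absolute series. *)
Lemma has_sum_dconv a b A B : a 0%N = 0 -> b 0%N = 0 ->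
  abs_bound a A -> abs_bound b B -> has_sum (dconv a b) (csum a * csum b).
Proof.
move=> a0 b0 hA hB e e0.
have A0 : 0 <= A by apply: le_trans (hA 0%N); rewrite big_ord0.
have B0 : 0 <= B by apply: le_trans (hB 0%N); rewrite big_ord0.
(* Two comparisons below cost [A * (e / D) + B * (e / D)] each; the added 1 keeps [D] positive. *)
pose D := 2 * (A + B + 1).
have D0 : 0 < D by rewrite /D; lra.
have e1 : 0 < e / D by rewrite divr_gt0.
have [N1 h1] := abs_bound_cauchy hA e1; have [N2 h2] := abs_bound_cauchy hB e1.
have [N3 h3] := csumP hA e1; have [N4 h4] := csumP hB e1.
set N := maxn (maxn N1 N2) (maxn N3 N4).
exists (N * N + N)%N => X NX.
have NNX : (N * N <= X)%N by apply: leq_trans NX; rewrite leq_addr.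
have NX' : (N <= X)%N by apply: leq_trans NX; rewrite leq_addl.
have [N1N N2N N3N N4N] : [/\ (N1 <= N)%N, (N2 <= N)%N, (N3 <= N)%N & (N4 <= N)%N].
  by rewrite /N; split; lia.
have q1 := h1 X (leq_trans N1N NX').
have q2 := h2 X (leq_trans N2N NX').
have q3 := h3 X (leq_trans N3N NX').
have q4 := h4 X (leq_trans N4N NX').
have m1 := sum_nat_mono (fun i => normc_ge0 (a i)) N1N.
have m2 := sum_nat_mono (fun i => normc_ge0 (b i)) N2N.
have p1 : normc (\sum_(n < X) dconv a b n - (\sum_(d < X) a d) * (\sum_(e < X) b e)) <=
   (\sum_(d < X) normc (a d)) * (\sum_(e < X) normc (b e)) -
   (\sum_(d < N) normc (a d)) * (\sum_(e < N) normc (b e)).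
  rewrite sum_dconv // normcBC mulr_suml -sumrB.
  rewrite (eq_bigr (fun d : 'I_X => \sum_(e < X) (X <= d * e)%N%:R * (a d * b e))); last first.
    move=> d _; rewrite mulr_sumr -sumrB; apply: eq_bigr => i _.
    by case: leqP => _ /=; ring.
  apply: (le_trans (le_normc_sum _ _ _)).
  apply: (@le_trans _ _ (\sum_(d < X) \sum_(e < X)
      (1 - ((d < N) && (e < N))%N%:R) * (normc (a d) * normc (b e)))).
    apply: ler_sum => d _; apply: (le_trans (le_normc_sum _ _ _)).
    apply: ler_sum => i _; rewrite !normcM normc_nat.
    rewrite ler_wpM2r ?mulr_ge0 ?normc_ge0 //.
    have [/andP[dN iN]|_] := boolP (_ && _); last by rewrite subr0; case: (X <= _)%N.
    rewrite subrr leqNgt (leq_trans _ NNX) //.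
    by apply: (@leq_ltn_trans (d * N)); [rewrite leq_mul2l ltnW ?orbT | rewrite ltn_mul2r dN (leq_ltn_trans _ dN)].
  have w (f : nat -> R) : \sum_(d < N) f d = \sum_(d < X) (d < N)%N%:R * f d.
    rewrite (big_ord_widen X f NX') big_mkcond; apply: eq_bigr => d _.
    by case: ltnP; rewrite ?mul1r ?mul0r.
  rewrite (w (fun d => normc (a d))) (w (fun d => normc (b d))) {w}.
  rewrite !mulr_suml -sumrB ler_sum // => d _.
  rewrite !mulr_sumr -sumrB ler_sum // => i _.
  by case: (d < N)%N; case: (i < N)%N; rewrite ?(mul0r, mul1r, mulr0, subr0, subrr).
have p2 : normc ((\sum_(d < X) a d) * (\sum_(e < X) b e) - csum a * csum b) <=
    A * (e / D) + B * (e / D).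
  have -> : (\sum_(d < X) a d) * (\sum_(e < X) b e) - csum a * csum b =
    (\sum_(d < X) a d) * (\sum_(e < X) b e - csum b) +
    csum b * (\sum_(d < X) a d - csum a) by ring.
  apply: (le_trans (ler_normcD _ _)); rewrite !normcM lerD // ler_pM ?normc_ge0 //.
    exact: le_trans (le_normc_sum _ _ _) (hA X).
  exact: csum_le.
have p3 : (\sum_(d < X) normc (a d)) * (\sum_(e < X) normc (b e)) -
   (\sum_(d < N) normc (a d)) * (\sum_(e < N) normc (b e)) <= A * (e / D) + B * (e / D).
  have -> : (\sum_(d < X) normc (a d)) * (\sum_(e < X) normc (b e)) -
   (\sum_(d < N) normc (a d)) * (\sum_(e < N) normc (b e)) =
   (\sum_(d < X) normc (a d)) * (\sum_(e < X) normc (b e) - \sum_(e < N) normc (b e)) +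
   (\sum_(e < N) normc (b e)) * (\sum_(d < X) normc (a d) - \sum_(d < N) normc (a d)).
    by ring.
  have s0 (f : nat -> C) m : 0 <= \sum_(d < m) normc (f d).
    by apply: sumr_ge0 => ? _; exact: normc_ge0.
  have mA := sum_nat_mono (fun i => normc_ge0 (a i)) NX'.
  have mB := sum_nat_mono (fun i => normc_ge0 (b i)) NX'.
  have hAX := hA X; have hBN := hB N.
  by rewrite lerD // ler_pM ?subr_ge0 ?s0 //; lra.
apply: (le_trans (normc_triangle _ ((\sum_(d < X) a d) * (\sum_(e < X) b e)) _)).
have -> : e = D * (e / D) by rewrite mulrCA divff ?mulr1 // gt_eqF.
apply: (le_trans (lerD (le_trans p1 p3) p2)).
move: e1; move: (e / D) => q q0.
by rewrite /D -subr_ge0 (_ : _ - _ = 2 * q) ?mulr_ge0 ?ltW //; ring.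
Qed.

End Convolution.

(** * Derivatives of the logarithmic derivative of zeta, as formal power series *)

Section MangoldtSeries.
Variable R : realType.
Local Notation C := R[i].
Implicit Types (z w u : C) (f g h : nat -> C).

Definition lam_term (j : nat) z (n : nat) : C := (mangoldt R n)%:C%C * dterm j z n.

(** [(-1)^j] times the [j]-th derivative of [- zeta' / zeta]. *)
Definition lam_j (j : nat) z : C := csum (lam_term j z).

Lemma normc_lam_term j z n :
  normc (lam_term j z n) <= ln n%:R ^+ j.+1 * npow (Re z) n.
Proof.
rewrite normcM normcR ger0_norm ?mangoldt_ge0 // normc_dterm mulrA exprS.
rewrite ler_wpM2r ?npow_ge0 // ler_wpM2r ?exprn_ge0 ?ln_nat_ge0 //.
exact: mangoldt_le_ln.
Qed.

Lemma abs_bound_lam j z eta : 0 < eta -> 1 + eta <= Re z ->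
  abs_bound (lam_term j z) (mass j.+1 eta).
Proof.
move=> e0 ez n; apply: le_trans (abs_bound_dterm j.+1 e0 ez n).
by apply: ler_sum => i _; rewrite normc_dterm normc_lam_term.
Qed.

Lemma dtermM i j z (d e : nat) : (0 < d)%N -> (0 < e)%N ->
  dterm i z d * dterm j z e =
  (ln d%:R ^+ i * ln e%:R ^+ j)%:C%C * dterm 0 z (d * e)%N.
Proof.
case: d e => // d [//|e] _ _.
have -> : dterm 0 z (d.+1 * e.+1) = cpow d.+1%:R z * cpow e.+1%:R z.
  by rewrite mulSn /= /lpow expr0 mul1r -cpowM ?ltr0n // -natrM mulSn.
by rewrite /= /lpow rmorphM /=; ring.
Qed.

Lemma dterm_ln k z n : dterm k z n = (ln n%:R ^+ k)%:C%C * dterm 0 z n.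
Proof. by case: n => [|n]; rewrite ?mulr0 //= /lpow expr0 mul1r. Qed.

(** Leibniz' rule for [(- zeta' / zeta) * zeta = - zeta'], obtained on coefficients by expanding
    [ln n ^ k = (ln d + ln (n / d)) ^ k]. *)
Lemma lam_zeta_conv k z : 1 < Re z ->
  \sum_(i < k.+1) 'C(k, i)%:R * (lam_j i z * zeta_j (k - i) z) = zeta_j k.+1 z.
Proof.
move=> z1; set eta := Re z - 1.
have e0 : 0 < eta by rewrite subr_gt0.
have ez : 1 + eta <= Re z by rewrite addrC subrK.
have bl i := abs_bound_lam i e0 ez.
have bz i := abs_bound_dterm i e0 ez.
have l0 i : lam_term i z 0 = 0 by rewrite /lam_term mulr0.
pose c i := dconv (lam_term i z) (dterm (k - i) z).
have cb i : exists B, abs_bound (fun n => 'C(k, i)%:R * c i n) B.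
  by eexists; apply: abs_boundZ; apply: abs_bound_dconv (bl i) (bz _) => //.
transitivity (\sum_(i < k.+1) csum (fun n => 'C(k, i)%:R * c i n)).
  apply: eq_bigr => i _.
  have cB : abs_bound (c i) (mass i.+1 eta * mass (k - i) eta).
    exact: abs_bound_dconv (bl i) (bz _).
  have hs : has_sum (c i) (lam_j i z * zeta_j (k - i) z).
    exact: has_sum_dconv (bl i) (bz _).
  by rewrite (csumZ _ cB) (csum_eq cB hs).
have <- := @csum_sum R 'I_k.+1 (index_enum _) (fun i n => 'C(k, i)%:R * c i n)
  (fun i => cb i).
apply: eq_csum => n; case: n => [|n].
  rewrite /= big1 // => i _; rewrite /c /dconv big_mkcond big_ord_recr big_ord0 /=.
  by rewrite add0r l0 mul0r mulr0.
rewrite /c /dconv.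
transitivity (\sum_(d < n.+2 | (d %| n.+1)%N)
   (mangoldt R d * ln n.+1%:R ^+ k)%:C%C * dterm 0 z n.+1).
  under eq_bigr do rewrite mulr_sumr.
  rewrite exchange_big /=; apply: eq_bigr => d dn.
  have d0 : (0 < d)%N by exact: dvdn_gt0 dn.
  have e0' : (0 < n.+1 %/ d)%N by rewrite divn_gt0 // dvdn_leq.
  have -> : ln (n.+1%:R : R) = ln (n.+1 %/ d)%N%:R + ln d%:R.
    by rewrite -lnM ?posrE ?ltr0n // -natrM divnK.
  rewrite exprDn mulr_sumr rmorph_sum mulr_suml; apply: eq_bigr => i _.
  rewrite /lam_term -[_ * dterm i z d * _]mulrA dtermM // mulnC divnK //.
  by rewrite -[(_ * _) *+ _]mulr_natl !rmorphM rmorph_nat /=; ring.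
rewrite -mulr_suml -rmorph_sum /= -mulr_suml sum_mangoldt_dvd //.
by rewrite [in RHS]/lpow -exprS /lpow expr0 mul1r.
Qed.

Definition bconv f g k := \sum_(i < k.+1) 'C(k, i)%:R * (f i * g (k - i)%N).

(* Exponential generating polynomials turn binomial convolutions of sequences
   into products modulo ['X^K.+1]. *)
Definition egf K f : {poly C} := \poly_(i < K.+1) (f i / i`!%:R).

Lemma fact_neq0 n : n`!%:R != 0 :> C.
Proof. by rewrite pnatr_eq0 -lt0n fact_gt0. Qed.

Lemma coef_egf K f k : (k <= K)%N -> (egf K f)`_k = f k / k`!%:R.
Proof. by move=> kK; rewrite coef_poly ltnS kK. Qed.

Lemma egfD K f g : egf K (fun i => f i + g i) = egf K f + egf K g.
Proof.
apply/polyP => i; rewrite coefD !coef_poly.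
by case: ifP => _; rewrite ?addr0 // mulrDl.
Qed.

Lemma egfB K f g : egf K (fun i => f i - g i) = egf K f - egf K g.
Proof.
apply/polyP => i; rewrite coefB !coef_poly.
by case: ifP => _; rewrite ?subr0 // mulrBl.
Qed.

Lemma egfM K f g h : (forall k, (k <= K)%N -> bconv f g k = h k) ->
  exists r, egf K f * egf K g = egf K h + r * 'X^(K.+1).
Proof.
move=> hk; exists (drop_poly K.+1 (egf K f * egf K g)).
rewrite -{1}(poly_take_drop K.+1 (egf K f * egf K g)); congr (_ + _).
apply/polyP => k; rewrite coef_take_poly coef_poly; case: ifP => // kK.
rewrite ltnS in kK; rewrite coefM -(hk k kK) /bconv mulr_suml; apply: eq_bigr => i _.
have iK : (i <= k)%N by rewrite -ltnS.
rewrite !coef_egf ?(leq_trans iK) ?(leq_trans (leq_subr _ _)) //.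
have := bin_fact iK => /(congr1 (fun m => m%:R : C)); rewrite !natrM => e.
have b0 : 'C(k, i)%:R != 0 :> C by rewrite pnatr_eq0 -lt0n bin_gt0.
by rewrite -e; field; rewrite ?fact_neq0 ?b0.
Qed.

(** The three jets list [(-1)^k] times the [k]-th derivatives of [1/u], [u] and 1; their generating
    series are [1 / (u - X)], [u - X] and 1. *)
Definition inv_jet u (k : nat) : C := k`!%:R / u ^+ k.+1.
Definition lin_jet u (k : nat) : C := if k is k'.+1 then (if k' is 0 then -1 else 0) else u.
Definition one_jet (k : nat) : C := (k == 0)%:R.

Lemma bconv_inv u k : u != 0 -> bconv (inv_jet u) (inv_jet u) k = inv_jet u k.+1.
Proof.
move=> u0; rewrite /bconv (eq_bigr (fun=> k`!%:R / u ^+ k.+2)).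
  by rewrite sumr_const card_ord -[LHS]mulr_natl /inv_jet factS natrM mulrA.
move=> i _; have ik : (i <= k)%N by rewrite -ltnS.
rewrite /inv_jet -(bin_fact ik) !natrM.
have -> : u ^+ k.+2 = u ^+ i.+1 * u ^+ (k - i).+1.
  by rewrite -exprD; congr (_ ^+ _); lia.
by field; rewrite !expf_neq0.
Qed.

Lemma bconv_lin_inv u k : u != 0 -> bconv (lin_jet u) (inv_jet u) k = one_jet k.
Proof.
move=> u0; rewrite /bconv big_ord_recl /= bin0 mul1r subn0.
case: k => [|k]; first by rewrite big_ord0 addr0 /inv_jet expr1 fact0 mul1r mulfV.
rewrite big_ord_recl /= big1 ?addr0; last by move=> i _; rewrite mul0r mulr0.
rewrite bin1 subSS subn0 /inv_jet factS natrM exprS mulN1r mulrN /one_jet /=.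
by field; rewrite u0 expf_neq0.
Qed.

Lemma egf_one K : egf K one_jet = 1.
Proof.
apply/polyP => k; rewrite coef_poly coef1 /one_jet.
case: k => [|k] //=; first by rewrite fact0 divr1.
by rewrite mul0r if_same.
Qed.

Lemma egf_lin1 K u : egf K (lin_jet (u + 1)) = egf K (lin_jet u) + 1.
Proof.
rewrite -(egf_one K) -egfD; apply/polyP => k; rewrite !coef_poly.
by case: ifP => // _; congr (_ / _); case: k => [|[|k]]; rewrite /one_jet /= ?addr0.
Qed.

Definition err_j k z := lam_j k z - zeta_j k z.

(* With [Z = 1/u + E], [u = z - 1] and [A = L - Z], the identity [L Z = Z1] of
   [lam_zeta_conv] becomes [A (1 + u E) = u (E1 - E^2) - 2 E]. Dividing by
   [z = 1 + u] makes every coefficient polylogarithmic in [Im z]. *)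
Definition den_poly K z : {poly C} :=
  egf K (inv_jet z) + (1 - egf K (inv_jet z)) * egf K (fun j => zeta_reg j z).

Definition num_poly K z : {poly C} :=
  (1 - egf K (inv_jet z)) *
    (egf K (fun j => zeta_reg j.+1 z) - egf K (fun j => zeta_reg j z) ^+ 2)
  - egf K (inv_jet z) * egf K (fun j => zeta_reg j z) *+ 2.

Lemma err_den_num K z : 1 < Re z ->
  exists r, egf K (fun j => err_j j z) * den_poly K z = num_poly K z + r * 'X^(K.+1).
Proof.
move=> z1.
have u0 : z - 1 != 0.
  by apply: contraTneq z1 => /eqP; rewrite subr_eq0 => /eqP ->; rewrite ltxx.
have z0 : z != 0.
  by apply: contraTneq z1 => ->; rewrite -leNgt ler01.
set u := z - 1 in u0 *.
have [r1 h1] := egfM (K := K) (f := fun j => lam_j j z) (g := fun j => zeta_j j z)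
  (h := fun j => zeta_j j.+1 z) (fun k _ => lam_zeta_conv k z1).
have [r2 h2] := egfM (K := K) (fun k _ => bconv_lin_inv k u0).
have [r3 h3] := egfM (K := K) (fun k _ => bconv_inv k u0).
have [r4 h4] := egfM (K := K) (fun k _ => bconv_lin_inv k z0).
have eZ : egf K (fun j => zeta_j j z) = egf K (inv_jet u) + egf K (fun j => zeta_reg j z).
  rewrite -egfD; congr egf; apply: funext => j.
  by rewrite /zeta_reg /inv_jet addrC subrK.
have eZ' : egf K (fun k => zeta_j k.+1 z) =
    egf K (fun k => inv_jet u k.+1) + egf K (fun k => zeta_reg k.+1 z).
  rewrite -egfD; congr egf; apply: funext => j.
  by rewrite /zeta_reg /inv_jet addrC subrK.
have eA : egf K (fun j => err_j j z) = egf K (fun j => lam_j j z) - egf K (fun j => zeta_j j z) by exact: egfB.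
rewrite egf_one in h2; rewrite egf_one in h4.
rewrite -[z in lin_jet z](subrK 1) egf_lin1 -/u in h4.
rewrite /den_poly /num_poly eA eZ {eA}; move: h1; rewrite eZ' eZ.
move: h2 h3 h4 {eZ eZ'}.
move: (egf K (lin_jet u)) (egf K (inv_jet u)) (egf K (inv_jet z)).
move: (egf K (fun j => lam_j j z)) (egf K (fun j => zeta_reg j z)) (egf K (fun k => zeta_reg k.+1 z)).
move: (egf K (fun k => inv_jet u k.+1)) ('X^(K.+1)).
move=> v' T L E E' U v q h2 h3 h4 h1.
(* Modulo [T] one has [U v = 1], [(U + 1) q = 1] and [L (v + E) = v^2 + E']. The witness collects
   the multiples of [T] that appear when these relations are substituted. *)
exists (q * (U * (r1 - r3) - 2 * r2 * E - r2 * (L - (v + E))) +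
        r4 * (E' - E ^+ 2 - (L - (v + E)) * E)).
have e1 : L * (v + E) - v * v - E' - (r1 - r3) * T = 0 by rewrite h1 h3; ring.
have e2 : U * v - 1 - r2 * T = 0 by rewrite h2; ring.
have e4 : (U + 1) * q - 1 - r4 * T = 0 by rewrite h4; ring.
apply/eqP; rewrite -subr_eq0; apply/eqP.
transitivity (- ((U + 1) * q - 1 - r4 * T) * ((L - (v + E)) * E - E' + E ^+ 2)
   - q * (L - (v + E)) * (U * v - 1 - r2 * T)
   + q * U * (L * (v + E) - v * v - E' - (r1 - r3) * T)
   - 2 * q * (U * v - 1 - r2 * T) * E); first by ring.
by rewrite e1 e2 e4; ring.
Qed.

(** The coefficient of ['X^k] determines [err_j k] from the lower ones by one division, so only the
    constant coefficient of [den_poly] needs a lower bound. *)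
Lemma err_recursion k z : 1 < Re z ->
  err_j k z / k`!%:R * (den_poly k z)`_0 =
  (num_poly k z)`_k - \sum_(i < k) err_j i z / i`!%:R * (den_poly k z)`_(k - i).
Proof.
move=> z1; have [r e] := err_den_num k z1.
have := congr1 (fun p : {poly C} => p`_k) e.
rewrite coefD coefMXn ltnSn addr0 coefM big_ord_recr /= subnn coef_egf // => <-.
rewrite addrAC addrC -[LHS]addr0; congr (_ + _); apply/esym/eqP.
rewrite subr_eq0; apply/eqP/eq_bigr => i _.
by rewrite coef_egf // ltnW.
Qed.

End MangoldtSeries.

(** * The 3-4-1 inequality and lower bounds for zeta *)

Section NonVanishing.
Variable R : realType.
Local Notation C := R[i].
Implicit Types (s t h : R) (z w : C).

Lemma cReMr h z : Re (h%:C%C * z) = h * Re z.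
Proof. by rewrite cReM /= mul0r subr0. Qed.

Lemma cImMr h z : Im (h%:C%C * z) = h * Im z.
Proof. by rewrite cImM /= mul0r addr0. Qed.

Lemma expR_second_order (y : R) : `|expR (- y) - 1 + y| <= y ^+ 2 * expR `|y|.
Proof.
have e1 := expR_ge1Dx (- y).
have e2 : (1 + y) * expR (- y) <= 1.
  by rewrite -[leRHS](@expRxMexpNx_1 R y) ler_wpM2r ?expR_ge0 // expR_ge1Dx.
rewrite ger0_norm; last by lra.
apply: (@le_trans _ _ (y * (1 - expR (- y)))); first by lra.
rewrite expr2 -mulrA; have [y0|y0] := lerP 0 y.
  rewrite ler_wpM2l // (@le_trans _ _ y) //; first by lra.
  by rewrite ger0_norm // ler_peMr // -[leLHS]expR0 ler_expR.
rewrite ltr0_norm // (ler_wnM2l (ltW y0)) // lerBrDl.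
by move: e2; rewrite mulrDl mul1r.
Qed.

Lemma dterm_shift j z h n :
  dterm j (z + h%:C%C) n = dterm j z n * (expR (- (h * ln n%:R)))%:C%C.
Proof.
case: n => [|n]; first by rewrite mul0r.
by rewrite /= /lpow cpowD cpow_real mulNr mulrA.
Qed.

(** The remainder of each term carries [ln n ^ 2] and a factor [n ^ |h|]; half of [eta] pays for the
    latter. *)
Lemma zeta_second_order z h eta : 0 < eta -> Re z = 1 + eta ->
  `|h| <= eta / 2 ->
  normc (zeta_j 0 (z + h%:C%C) - zeta_j 0 z - h%:C%C * - zeta_j 1 z) <=
  mass 2 (eta / 2) * h ^+ 2.
Proof.
move=> e0 ez he; have e2 : 0 < eta / 2 by rewrite divr_gt0.
have z1 : 1 < Re z by rewrite ez; lra.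
have z2 : 1 < Re (z + h%:C%C).
  by rewrite cReD /= ez; move: he; rewrite ler_norml; lra.
have hs := has_sumD (has_sumD (has_sum_zeta_j 0 z2) (has_sumZ (-1) (has_sum_zeta_j 0 z1)))
  (has_sumZ h%:C%C (has_sum_zeta_j 1 z1)).
have -> : zeta_j 0 (z + h%:C%C) - zeta_j 0 z - h%:C%C * - zeta_j 1 z =
  zeta_j 0 (z + h%:C%C) + -1 * zeta_j 0 z + h%:C%C * zeta_j 1 z by ring.
apply: has_sum_normc_le hs => n; apply: (le_trans (le_normc_sum _ _ _)).
apply: (@le_trans _ _ (\sum_(i < n) h ^+ 2 * (ln i%:R ^+ 2 * npow (1 + eta / 2) i))).
  apply: ler_sum => i _; set L : R := ln i%:R.
  have -> : dterm 0 (z + h%:C%C) i + -1 * dterm 0 z i + h%:C%C * dterm 1 z i =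
      dterm 0 z i * (expR (- (h * L)) - 1 + h * L)%:C%C.
    by rewrite dterm_shift (dterm_ln 1) expr1 -/L !rmorphD rmorphN !rmorphM rmorph1 /=; ring.
  rewrite normcM normc_dterm normcR expr0 mul1r ez.
  have L0 : 0 <= L := ln_nat_ge0 _ _.
  apply: (@le_trans _ _ (npow (1 + eta) i * ((h * L) ^+ 2 * expR `|h * L|))).
    by rewrite ler_wpM2l ?npow_ge0 // expR_second_order.
  have -> : npow (1 + eta) i * ((h * L) ^+ 2 * expR `|h * L|) =
      h ^+ 2 * (L ^+ 2 * (npow (1 + eta) i * expR `|h * L|)) by ring.
  rewrite ler_wpM2l ?sqr_ge0 // ler_wpM2l ?sqr_ge0 //.
  case: i @L L0 => [[|i] il] L L0; first by rewrite mul0r.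
  rewrite /= -expRD ler_expR -/L normrM [`|L|]ger0_norm //.
  have := ler_wpM2r L0 he; lra.
rewrite -mulr_sumr mulrC ler_wpM2r ?sqr_ge0 //.
exact: sum_ln_npow.
Qed.

Lemma cder_zeta t s : 1 < s ->
  cder (fun s => zeta_j 0 (s +i* t)%C) (- zeta_j 1 (s +i* t)%C) s.
Proof.
move=> s1; set z := (s +i* t)%C.
have e0 : 0 < s - 1 by rewrite subr_gt0.
have ez : Re z = 1 + (s - 1) by rewrite /=; lra.
have shift h : ((s + h) +i* t)%C = z + h%:C%C.
  by apply/eqP; rewrite eq_complex /= addr0 !eqxx.
have e2 : 0 < (s - 1) / 2 by rewrite divr_gt0.
split; apply: (der_quadratic e2) => h hh.
  apply: le_trans (zeta_second_order e0 ez hh); rewrite shift.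
  by apply: le_trans (normc_Re _); rewrite !cReB cReMr.
apply: le_trans (zeta_second_order e0 ez hh); rewrite shift.
by apply: le_trans (normc_Im _); rewrite !cImB cImMr.
Qed.

Lemma zeta1_lam z : 1 < Re z -> zeta_j 1 z = lam_j 0 z * zeta_j 0 z.
Proof. by move=> /(lam_zeta_conv 0) <-; rewrite big_ord_recl big_ord0 bin0 mul1r addr0. Qed.

Definition zeta_sq t s : R := normc (zeta_j 0 (s +i* t)%C) ^+ 2.

(** Minus the derivative of [ln |zeta|] along the horizontal line. [der_zeta_sq] expresses this
    without a quotient, so zeta need not be known to be nonzero beforehand. *)
Definition log_der t s : R := Re (lam_j 0 (s +i* t)%C).

Lemma der_zeta_sq t s : 1 < s -> der (zeta_sq t) (- 2 * zeta_sq t s * log_der t s) s.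
Proof.
move=> s1; have [h1 h2] := cder_zeta t s1.
have -> : zeta_sq t = fun s => Re (zeta_j 0 (s +i* t)%C) ^+ 2 +
    Im (zeta_j 0 (s +i* t)%C) ^+ 2.
  by apply: funext => x; rewrite /zeta_sq normc_sqr.
apply: (der_eq (derD (derX 2 h1) (derX 2 h2))).
rewrite /log_der cReN cImN zeta1_lam // cReM cImM /=; ring.
Qed.

Lemma zeta_sq_ge0 t s : 0 <= zeta_sq t s.
Proof. exact: sqr_ge0. Qed.

Lemma lam_term_Re t s n :
  Re (lam_term 0 (s +i* t)%C n) = mangoldt R n * npow s n * cos (t * ln n%:R).
Proof.
case: n => [|n]; first by rewrite /lam_term mulr0 /= mulr0 mul0r.
have cexpRe z : Re (cexp z) = expR (Re z) * cos (Im z).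
  by rewrite /cexp cReMr.
rewrite /lam_term cReMr /dterm /lpow expr0 mul1r /cpow cexpRe -mulrA; congr (_ * (_ * _)).
  by congr expR; rewrite cReM cReN /= mulr0 subr0.
by rewrite cImM /= mulr0 add0r mulNr cosN.
Qed.

(** With [c = cos (t ln n)], each term carries the factor [3 + 4 c + (2 c^2 - 1) = 2 (1 + c)^2]. *)
Lemma log_der_341 t s : 1 < s ->
  0 <= 3 * log_der 0 s + 4 * log_der t s + log_der (2 * t) s.
Proof.
move=> s1; have e0 : 0 < s - 1 by rewrite subr_gt0.
have hs y : has_sum (lam_term 0 (s +i* y)%C) (lam_j 0 (s +i* y)%C).
  by apply: csumP; apply: (abs_bound_lam 0 e0); rewrite /=; lra.
have := has_sum_Re_ge (B := 0) _ (has_sumD (has_sumD (has_sumZ 3%:R (hs 0))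
  (has_sumZ 4%:R (hs t))) (hs (2 * t))).
have n3 n y : Re (n%:R * y) = n%:R * Re y :> R.
  by rewrite -(rmorph_nat (real_complex R)) cReM /= mul0r subr0.
rewrite !cReD !n3; apply => n _.
rewrite raddf_sum; apply: sumr_ge0 => i _ /=.
rewrite !cReD !n3 !lam_term_Re mul0r cos0.
have -> : cos (2 * t * ln (i%:R : R)) = 2 * cos (t * ln i%:R) ^+ 2 - 1.
  by rewrite -mulrA mulr_natl cos_mulr2n mulr_natl.
set c := cos _.
have -> : 3 * (mangoldt R i * npow s i * 1) + 4 * (mangoldt R i * npow s i * c) +
  mangoldt R i * npow s i * (2 * c ^+ 2 - 1) =
  2 * (mangoldt R i * npow s i * (1 + c) ^+ 2) by ring.
apply: mulr_ge0 => //; apply: mulr_ge0; last exact: sqr_ge0.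
by apply: mulr_ge0; [exact: mangoldt_ge0 | exact: npow_ge0].
Qed.

(** The endpoint value for the monotonicity in [zeta_341]. After the first term, which is 1, the
    rest of the series is at most [1/2] by [sum_npow]. *)
Lemma zeta_sq3 t : 4^-1 <= zeta_sq t 3.
Proof.
rewrite /zeta_sq; set z := (3 +i* t)%C.
have z1 : 1 < Re z by rewrite /=; lra.
suff h : 2^-1 <= normc (zeta_j 0 z).
  apply: (@le_trans _ _ (2^-1 ^+ 2)); first by lra.
  by rewrite lerXn2r ?nnegrE ?normc_ge0 // invr_ge0.
have hN n : normc (\sum_(i < n.+2) dterm 0 z i - 1) <= 2^-1.
  rewrite 2!big_ord_recl /= add0r /lpow expr0 mul1r cpow1 addrAC subrr add0r.
  have := sum_npow n.+2 (ltr0n R 2).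
  have -> : \sum_(i < n.+2) npow (1 + 2) i = 1 + \sum_(i < n) npow (1 + 2) i.+2 :> R.
    by rewrite 2!big_ord_recl /= add0r ln1 mulr0 expR0.
  rewrite lerD2l => hn; apply: le_trans hn; apply: (le_trans (le_normc_sum _ _ _)).
  apply: ler_sum => i _; rewrite (_ : bump 0 (bump 0 i) = i.+2) //.
  have := normc_dterm 0 z i.+2; rewrite /dterm expr0 mul1r => ->.
  by rewrite (_ : 1 + 2 = Re z) //=; lra.
rewrite leNgt; apply/negP => hlt.
have d0 : 0 < (2^-1 - normc (zeta_j 0 z)) / 2 by rewrite divr_gt0 // subr_gt0.
have [N hZ] := has_sum_zeta_j 0 z1 d0.
have q1 := hZ N.+2 (leqW (leqnSn N)); have q2 := hN N.
have := lerB_normc (1 : C) (1 - \sum_(i < N.+2) dterm 0 z i).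
rewrite (_ : 1 - (1 - _) = \sum_(i < N.+2) dterm 0 z i); last by ring.
rewrite normc1 [normc (1 - _)]normcBC => q3.
have := lerB_normc (\sum_(i < N.+2) dterm 0 z i) (zeta_j 0 z).
by move: q1 q2 q3 hlt d0; set A := normc _; lra.
Qed.

(* The product on the right is nonincreasing in [s]: its logarithmic derivative
   is [-2] times the expression of [log_der_341]. *)
Lemma zeta_341 t s : 1 < s <= 3 ->
  4^-1 ^+ 8 <= zeta_sq 0 s ^+ 3 * zeta_sq t s ^+ 4 * zeta_sq (2 * t) s.
Proof.
move=> /andP[s1 s3].
pose P x := zeta_sq 0 x ^+ 3 * zeta_sq t x ^+ 4 * zeta_sq (2 * t) x.
have -> : zeta_sq 0 s ^+ 3 * zeta_sq t s ^+ 4 * zeta_sq (2 * t) s = P s by [].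
apply: (@le_trans _ _ (P 3)).
  rewrite /P (_ : 4^-1 ^+ 8 = 4^-1 ^+ 3 * 4^-1 ^+ 4 * 4^-1); last by ring.
  have h3 y n : 4^-1 ^+ n <= zeta_sq y 3 ^+ n.
    by rewrite lerXn2r ?nnegrE ?zeta_sq_ge0 ?zeta_sq3 // invr_ge0.
  rewrite ler_pM ?mulr_ge0 ?exprn_ge0 ?invr_ge0 ?zeta_sq3 //.
  by rewrite ler_pM ?exprn_ge0 ?invr_ge0.
rewrite -lerN2.
apply: (der_ge0_ndecr (f := fun x => - P x)
  (f' := fun x => 2 * P x * (3 * log_der 0 x + 4 * log_der t x + log_der (2 * t) x))) => //.
  move=> x /andP[sx _]; have x1 : 1 < x by exact: lt_le_trans sx.
  apply: (der_eq (derN (derM (derM (derX 3 (der_zeta_sq 0 x1)) (derX 4 (der_zeta_sq t x1)))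
     (der_zeta_sq (2 * t) x1)))).
  by rewrite /P /=; ring.
move=> x /andP[sx _]; rewrite mulr_ge0 ?log_der_341 ?(lt_le_trans s1) //.
apply: mulr_ge0 => //; apply: mulr_ge0; last exact: zeta_sq_ge0.
by apply: mulr_ge0; apply: exprn_ge0; exact: zeta_sq_ge0.
Qed.

End NonVanishing.

Section LowerBound.
Variable R : realType.
Local Notation C := R[i].
Implicit Types (s t h : R) (z w : C).

Lemma ell_mono t t' : `|t| <= `|t'| -> ell t <= ell t'.
Proof.
move=> h; rewrite lerD2l ler_ln_pos // ?lerD2r //.
Qed.

Lemma ell_double t : ell (2 * t) <= 2 * ell t.
Proof.
have t0 := normr_ge0 t; have l1 := ell_ge1 t.
suff : ln (`|2 * t| + 3) <= 1 + ln (`|t| + 3) by rewrite /ell in l1 *; lra.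
rewrite -[X in _ <= X + _]expRK -lnM ?posrE ?expR_gt0 //.
have := expR_ge1Dx (1 : R) => e1.
have h : 2 * (`|t| + 3) <= expR 1 * (`|t| + 3) by rewrite ler_wpM2r //; lra.
by rewrite normrM [`|2|]ger0_norm // ler_ln_pos //; lra.
Qed.

Lemma zeta_real_le s : 1 < s <= 2 -> zeta_sq 0 s <= 4 / (s - 1) ^+ 2.
Proof.
move=> /andP[s1 s2]; have e0 : 0 < s - 1 by rewrite subr_gt0.
have h : normc (zeta_j 0 (s +i* 0)%C) <= 2 / (s - 1).
  apply: (@le_trans _ _ (1 + (s - 1)^-1)).
    apply: csum_le => n; have := sum_npow n e0.
    rewrite (_ : 1 + (s - 1) = s); last by lra.
    by move=> hn; apply: le_trans hn; apply: ler_sum => i _; rewrite normc_dterm expr0 mul1r.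
  rewrite mulrDl mul1r lerD2r -invr1 lef_pV2 ?posrE //; lra.
rewrite /zeta_sq (_ : 4 / (s - 1) ^+ 2 = (2 / (s - 1)) ^+ 2); last first.
  by rewrite expr_div_n; congr (_ / _); ring.
by rewrite lerXn2r ?nnegrE ?normc_ge0 // divr_ge0 // ltW.
Qed.

Lemma normc_inv_le z (r : R) (n : nat) : 0 < r -> r <= normc z ->
  normc (z ^- n) <= r ^- n.
Proof.
move=> r0 rz; have z0 : 0 < normc z by exact: lt_le_trans rz.
by rewrite normcV normcX lef_pV2 ?posrE ?exprn_gt0 // lerXn2r ?nnegrE // ltW.
Qed.

Lemma zeta_j_away j (r : R) : 0 < r -> exists2 K, 0 < K & forall z,
  1 < Re z <= 2 -> r <= `|Im z| ->
  normc (zeta_j j z) <= K * ell (Im z) ^+ j.+1.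
Proof.
move=> r0; have [K K0 hK] := zeta_reg_bound R j.
have c0 : 0 <= j`!%:R * r ^- j.+1 by rewrite mulr_ge0 ?ler0n ?invr_ge0 ?exprn_ge0 ?ltW.
exists (K + j`!%:R * r ^- j.+1) => [|z zz rz]; first exact: ltr_pwDl.
have -> : zeta_j j z = zeta_reg j z + j`!%:R / (z - 1) ^+ j.+1.
  by rewrite /zeta_reg subrK.
apply: (le_trans (ler_normcD _ _)); rewrite mulrDl lerD ?hK //.
rewrite normcM normc_nat.
have l1 : 1 <= ell (Im z) ^+ j.+1 by rewrite exprn_ege1 // ell_ge1.
apply: (@le_trans _ _ (j`!%:R * r ^- j.+1)); last by rewrite ler_peMr.
rewrite ler_wpM2l ?ler0n // normc_inv_le //.
by apply: le_trans (normc_Im _); rewrite cImB /= subr0.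
Qed.

(** This is [(z - 1) / z * zeta z], by [den0E], in a form that can be estimated near the pole. *)
Definition den0 z : C := z^-1 + (1 - z^-1) * zeta_reg 0 z.

Lemma den0E z : 1 < Re z -> den0 z = (z - 1) / z * zeta_j 0 z.
Proof.
move=> z1.
have u0 : z - 1 != 0.
  by apply: contraTneq z1 => /eqP; rewrite subr_eq0 => /eqP ->; rewrite ltxx.
have z0 : z != 0.
  by apply: contraTneq z1 => ->; rewrite -leNgt ler01.
by rewrite /den0 /zeta_reg fact0 expr1; field; rewrite u0 z0.
Qed.

(** The 3-4-1 inequality gives [|zeta|^8 >= c1 (s - 1)^6 / l^2]. When [s - 1 >= b^4 / l^9] this is
    at least a constant times [b^24 / l^56], whence [b^3 / l^7]. Closer to the line one compares
    with the point [x = 1 + b^4 / l^9]: the derivative bound [K3 l^2] changes zeta by at most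
    [K3 b^4 / l^7], which is half of the value at [x] when [b] is small. The exponent 9 balances
    both regimes. *)
Lemma zeta_lower (r : R) : 0 < r -> exists2 c, 0 < c & forall s t,
  1 < s <= 2 -> r <= `|t| -> c <= normc (zeta_j 0 (s +i* t)%C) * ell t ^+ 7.
Proof.
move=> r0.
have [K2 K20 hK2] := zeta_j_away 0 r0.
have [K3 K30 hK3] := zeta_j_away 1 r0.
pose c1 : R := 4^-1 ^+ 8 / (4 ^+ 3 * (2 * K2) ^+ 2).
have c10 : 0 < c1 by rewrite divr_gt0 ?exprn_gt0 ?mulr_gt0 ?exprn_gt0 ?mulr_gt0.
(* [d <= 1] gives [d^8 <= d <= c1], which stands in for an eighth root of [c1]. *)
pose d := Num.min 1 c1.
have d0 : 0 < d by rewrite lt_min ltr01 c10.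
have d1 : d <= 1 by rewrite ge_min lexx.
have dc : d <= c1 by rewrite ge_min lexx orbT.
pose b := d / (2 * K3 + 1).
have k1 : 0 < 2 * K3 + 1 by lra.
have b0 : 0 < b by rewrite divr_gt0.
have b1 : b <= 1 by rewrite ler_pdivrMr // mul1r; lra.
have bK : 2 * b * K3 <= d.
  rewrite /b mulrAC mulrA ler_pdivrMr //; nra.
clearbody b.
have d00 := ltW d0; have b00 := ltW b0; have K200 := ltW K20; have K300 := ltW K30.
have c100 := ltW c10.
have db0 : 0 < d * b ^+ 3 by rewrite mulr_gt0 // exprn_gt0.
exists (d * b ^+ 3 / 2) => [|s t ss rt]; first by rewrite divr_gt0.
set l := ell t; have l1 : 1 <= l := ell_ge1 t; have l0 : 0 < l := ell_gt0 t.
have l00 := ltW l0.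
have far x : 1 < x <= 2 -> b ^+ 4 <= (x - 1) * l ^+ 9 ->
    d * b ^+ 3 <= normc (zeta_j 0 (x +i* t)%C) * l ^+ 7.
  move=> xx hx; have /andP[x1 x2] := xx.
  have x0 : 0 < x - 1 by rewrite subr_gt0.
  have x00 := ltW x0.
  have h2t : zeta_sq (2 * t) x <= (2 * K2) ^+ 2 * l ^+ 2.
    have K2l : 0 <= 2 * K2 * l by rewrite !mulr_ge0 // ltW.
    rewrite -exprMn lerXn2r ?nnegrE ?normc_ge0 //.
    have := hK2 (x +i* (2 * t))%C xx; rewrite /= expr1 => h.
    apply: (le_trans (h _)); first by rewrite normrM ger0_norm //; lra.
    by rewrite -mulrA mulrCA (ler_wpM2l (ltW K20)) // ell_double.
  have h1 := zeta_341 t (_ : 1 < x <= 3).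
  have {}h1 : 4^-1 ^+ 8 <= (4 / (x - 1) ^+ 2) ^+ 3 * zeta_sq t x ^+ 4 * ((2 * K2) ^+ 2 * l ^+ 2).
    apply: le_trans (h1 _) _; first by rewrite x1 /=; lra.
    apply: ler_pM => //; first by apply: mulr_ge0; apply: exprn_ge0; exact: zeta_sq_ge0.
      exact: zeta_sq_ge0.
    apply: ler_wpM2r; first by apply: exprn_ge0; exact: zeta_sq_ge0.
    by apply: lerXn2r; rewrite ?nnegrE ?zeta_sq_ge0 ?zeta_real_le // divr_ge0 ?exprn_ge0.
  have h4 : c1 * (x - 1) ^+ 6 <= zeta_sq t x ^+ 4 * l ^+ 2.
    rewrite /c1 mulrAC ler_pdivrMr ?mulr_gt0 ?exprn_gt0 ?mulr_gt0 //.
    rewrite -ler_pdivlMr ?exprn_gt0 //; apply: (le_trans h1); rewrite le_eqVlt; apply/orP; left.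
    by apply/eqP; field; rewrite gt_eqF.
  rewrite -(@ler_pXn2r _ 8) ?nnegrE ?mulr_ge0 ?normc_ge0 ?exprn_ge0 //.
  have -> : (normc (zeta_j 0 (x +i* t)%C) * l ^+ 7) ^+ 8 = zeta_sq t x ^+ 4 * l ^+ 2 * l ^+ 54.
    rewrite /zeta_sq; ring.
  apply: (@le_trans _ _ (c1 * (x - 1) ^+ 6 * l ^+ 54)); last by rewrite ler_wpM2r ?exprn_ge0.
  have -> : (d * b ^+ 3) ^+ 8 = d ^+ 8 * (b ^+ 4) ^+ 6 by ring.
  have -> : c1 * (x - 1) ^+ 6 * l ^+ 54 = c1 * ((x - 1) * l ^+ 9) ^+ 6 by ring.
  apply: ler_pM; rewrite ?exprn_ge0 //.
    by apply: le_trans dc; rewrite exprS ler_piMr ?exprn_ile1 .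
  apply: lerXn2r => //; rewrite nnegrE; first exact: exprn_ge0.
  by apply: mulr_ge0 => //; exact: exprn_ge0.
have half : d * b ^+ 3 / 2 <= d * b ^+ 3.
  by lra.
have [hs|hs] := lerP (b ^+ 4) ((s - 1) * l ^+ 9).
  exact: le_trans half (far s ss hs).
have /andP[s1 s2] := ss.
pose x := 1 + b ^+ 4 / l ^+ 9.
have l9 : 0 < l ^+ 9 by rewrite exprn_gt0.
have xs : s <= x by rewrite /x -lerBlDl ler_pdivlMr // ltW.
have x2 : x <= 2.
  rewrite /x -lerBrDl ler_pdivrMr // (_ : 2 - 1 = 1); last by lra.
  rewrite mul1r; apply: (@le_trans _ _ 1); first by rewrite exprn_ile1 // ltW.
  by rewrite exprn_ege1.
have x1 : 1 < x by exact: lt_le_trans xs.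
have fx := far x; rewrite x1 x2 in fx.
have {}fx := fx isT; rewrite /x [1 + _ - 1]addrAC subrr add0r divfK ?gt_eqF // lexx in fx.
have {}fx := fx isT; rewrite -/x in fx.
have hd : normc (zeta_j 0 (x +i* t)%C - zeta_j 0 (s +i* t)%C) <= K3 * l ^+ 2 * (x - s).
  apply: (@cmvt R (fun s => zeta_j 0 (s +i* t)%C) (fun s => - zeta_j 1 (s +i* t)%C)) => //.
    by move=> y /andP[y1 _]; apply: cder_zeta; exact: lt_le_trans y1.
  move=> y /andP[y1 y2]; rewrite normc_opp; apply: hK3 => //=.
  by rewrite (lt_le_trans s1 y1) (le_trans y2).
have := lerB_normc (zeta_j 0 (x +i* t)%C) (zeta_j 0 (s +i* t)%C).
set Zx := normc (zeta_j 0 (x +i* t)%C) in fx hd *.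
set Zs := normc (zeta_j 0 (s +i* t)%C) => h3.
have h5 : (Zx - Zs) * l ^+ 7 <= K3 * b ^+ 4.
  apply: (@le_trans _ _ (K3 * l ^+ 2 * (x - 1) * l ^+ 7)).
    rewrite ler_wpM2r ?exprn_ge0 //; apply: (le_trans h3); apply: (le_trans hd).
    by rewrite ler_wpM2l ?mulr_ge0 ?exprn_ge0 //; lra.
  rewrite /x [1 + _ - 1]addrAC subrr add0r le_eqVlt; apply/orP; left.
  by apply/eqP; field; rewrite gt_eqF.
have h6 : K3 * b ^+ 4 <= d * b ^+ 3 / 2.
  have -> : K3 * b ^+ 4 = (2 * b * K3) * b ^+ 3 / 2 by field.
  by rewrite ler_pM2r // ler_wpM2r ?exprn_ge0 // ltW.
by move: h5; rewrite mulrBl; lra.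
Qed.

(** Near the pole [den0 z * z = 1 + (z - 1) * zeta_reg 0 z] stays close to 1, which fixes [r]; for
    [|Im z| >= r] the bound [zeta_lower] applies. *)
Lemma den0_lower : exists r c : R, [/\ 0 < r, r <= 1, 0 < c & forall z,
  1 < Re z <= 1 + r -> c <= normc (den0 z) * ell (Im z) ^+ 7].
Proof.
have [K0 K00 hK0] := zeta_reg_bound R 0.
have e1 := ell_gt0 (1 : R).
pose r : R := (1 + 4 * K0 * ell 1)^-1.
have q0 : 0 < 4 * K0 * ell 1 by rewrite !mulr_gt0.
have r0 : 0 < r by rewrite invr_gt0; lra.
have r1 : r <= 1 by rewrite invf_le1; lra.
have rK : 2 * r * (K0 * ell 1) <= 2^-1.
  have : r * (1 + 4 * K0 * ell 1) = 1 by rewrite mulVf // gt_eqF //; lra.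
  move: q0 r0; rewrite -mulrA; move: (K0 * ell 1) => q; nra.
have [c c0 hc] := zeta_lower r0.
(* For [|t| < r], [1/6] is [1/2] divided by the bound 3 on [normc z]; for [|t| >= r], [r / 3] bounds
   [normc (z - 1) / normc z] from below. *)
pose c' := Num.min (6^-1) (r / 3 * c).
exists r, c'; split => // [|[s t]].
  by rewrite lt_min invr_gt0 ltr0n /= mulr_gt0 // divr_gt0.
rewrite [Re _]/= [Im _]/= => /andP[s1 s2].
set z := (s +i* t)%C.
have zz : 1 < Re z <= 2 by rewrite /= s1 /=; lra.
have zl : normc z <= 2 + `|t|.
  by apply: (le_trans (normc_ReIm _)) => /=; rewrite lerD2r gtr0_norm; lra.
have z0 : 0 < normc z.
  by apply: lt_le_trans (normc_Re _) => /=; rewrite normr_gt0 gt_eqF //; lra.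
have l1 := ell_ge1 t.
rewrite ge_min; apply/orP; have [tr|tr] := ltrP `|t| r; [left|right].
  have hE : normc (zeta_reg 0 z) <= K0 * ell 1.
    have := hK0 z zz; rewrite /= expr1 => h; apply: (le_trans h).
    by rewrite ler_pM2l // ell_mono // [`|1|]ger0_norm //; lra.
  have hu : normc (z - 1) <= 2 * r.
    apply: (le_trans (normc_ReIm _)); rewrite cReB cImB /= subr0.
    by rewrite [X in X + _]gtr0_norm ?subr_gt0 //; lra.
  have hN : 2^-1 <= normc (den0 z * z).
    have -> : den0 z * z = 1 - - ((z - 1) * zeta_reg 0 z).
      by rewrite /den0; field; rewrite -normc_eq0 gt_eqF.
    apply: le_trans (lerB_normc _ _); rewrite normc1 normc_opp normcM.
    have : normc (z - 1) * normc (zeta_reg 0 z) <= 2 * r * (K0 * ell 1).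
      by rewrite ler_pM ?normc_ge0.
    lra.
  rewrite normcM in hN.
  have h3 : 6^-1 <= normc (den0 z).
    have : normc (den0 z) * normc z <= normc (den0 z) * 3.
      by rewrite ler_wpM2l ?normc_ge0 //; lra.
    lra.
  by apply: (le_trans h3); rewrite ler_peMr ?normc_ge0 // exprn_ege1.
rewrite den0E //.
rewrite normcM -[leRHS]mulrA; apply: ler_pM; rewrite ?(ltW c0) //.
- by rewrite divr_ge0 // ltW.
- rewrite normcM normcV ler_pdivlMr // mulrAC ler_pdivrMr //.
  have : `|t| <= normc (z - 1).
  by apply: le_trans (normc_Im _); rewrite cImB /= subr0.
  have : r * normc z <= r * (2 + `|t|) by rewrite ler_pM2l.
  have : r * `|t| <= `|t| by rewrite ler_piMl.
  lra.
by apply: hc => //; case/andP: zz => _ z2; rewrite s1.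
Qed.

End LowerBound.

(** * Polylogarithmic bounds up to the line Re z = 1 *)

Section PolyLog.
Variable R : realType.
Local Notation C := R[i].
Implicit Types (z w : C) (f g : C -> C) (p q : C -> {poly C}).

Definition polylog (r : R) f := exists K : R, exists N : nat,
  forall z, 1 < Re z <= 1 + r -> normc (f z) <= K * ell (Im z) ^+ N.

Definition polylog_poly r p := forall i, polylog r (fun z => (p z)`_i).

Lemma polylog_pos r f : polylog r f -> exists2 K : R, 0 < K & exists N : nat,
  forall z, 1 < Re z <= 1 + r -> normc (f z) <= K * ell (Im z) ^+ N.
Proof.
move=> [K [N h]]; exists (`|K| + 1); first by rewrite ltr_pwDr.
exists N => z zr; apply: (le_trans (h z zr)).
rewrite ler_wpM2r ?exprn_ge0 ?ltW ?ell_gt0 //.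
by have := ler_norm K; lra.
Qed.

Lemma polylogD r f g : polylog r f -> polylog r g -> polylog r (fun z => f z + g z).
Proof.
move=> /polylog_pos[K K0 [N h]] /polylog_pos[K' K0' [N' h']].
exists (K + K'), (N + N')%N => z zr.
have l1 := ell_ge1 (Im z).
apply: (le_trans (ler_normcD _ _)); rewrite mulrDl lerD //.
  apply: (le_trans (h z zr)); rewrite ler_pM2l // ler_weXn2l //; exact: leq_addr.
apply: (le_trans (h' z zr)); rewrite ler_pM2l // ler_weXn2l //; exact: leq_addl.
Qed.

Lemma polylogM r f g : polylog r f -> polylog r g -> polylog r (fun z => f z * g z).
Proof.
move=> [K [N h]] [K' [N' h']]; exists (K * K'), (N + N')%N => z zr.
rewrite normcM exprD mulrACA ler_pM ?normc_ge0 ?h ?h' //.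
Qed.

Lemma polylog_cst r c : polylog r (fun=> c).
Proof. by exists (normc c), 0%N => z _; rewrite expr0 mulr1. Qed.

Lemma polylog_sum r n (F : 'I_n -> C -> C) :
  (forall i, polylog r (F i)) -> polylog r (fun z => \sum_(i < n) F i z).
Proof.
elim: n F => [|n ih] F hF.
  by under eq_fun do rewrite big_ord0; exact: polylog_cst.
under eq_fun do rewrite big_ord_recr; apply: polylogD => //.
by apply: ih.
Qed.

Lemma polylog_polyD r p q :
  polylog_poly r p -> polylog_poly r q -> polylog_poly r (fun z => p z + q z).
Proof. by move=> hp hq i; under eq_fun do rewrite coefD; exact: polylogD. Qed.

Lemma polylog_polyM r p q :
  polylog_poly r p -> polylog_poly r q -> polylog_poly r (fun z => p z * q z).
Proof.
move=> hp hq i; under eq_fun do rewrite coefM.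
by apply: polylog_sum => j; exact: polylogM.
Qed.

Lemma polylog_poly_cst r (a : {poly C}) : polylog_poly r (fun=> a).
Proof. by move=> i; exact: polylog_cst. Qed.

Lemma polylog_polyN r p : polylog_poly r p -> polylog_poly r (fun z => - p z).
Proof.
move=> hp; under [X in polylog_poly _ X]eq_fun do rewrite -mulN1r.
by apply: polylog_polyM => //; exact: polylog_poly_cst.
Qed.

Lemma polylog_egf r K (F : nat -> C -> C) : (forall j, polylog r (F j)) ->
  polylog_poly r (fun z => egf K (fun j => F j z)).
Proof.
move=> hF i; under eq_fun do rewrite coef_poly.
case: (i < K.+1)%N; last exact: polylog_cst.
by apply: polylogM => //; exact: polylog_cst.
Qed.

Lemma polylog_zeta_reg r j : r <= 1 -> polylog r (fun z => zeta_reg j z).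
Proof.
move=> r1; have [K K0 h] := zeta_reg_bound R j; exists K, j.+1 => z /andP[z1 z2].
by apply: h; rewrite z1; lra.
Qed.

Lemma polylog_inv_jet r j : polylog r (fun z => inv_jet z j).
Proof.
exists (j`!%:R), 0%N => z /andP[z1 _]; rewrite expr0 mulr1.
rewrite /inv_jet normcM normc_nat -[leRHS]mulr1 ler_wpM2l ?ler0n //.
have := @normc_inv_le R z 1 j.+1 ltr01; rewrite expr1n invr1; apply.
by apply: le_trans (normc_Re _); apply: le_trans (ler_norm _); exact: ltW.
Qed.

Lemma coef0_den_poly k z : (den_poly k z)`_0 = den0 z.
Proof.
rewrite /den_poly coefD coefM big_ord_recl big_ord0 addr0 subnn coefB coef1 eqxx.
by rewrite !coef_egf // /inv_jet fact0 !divr1 expr1 mul1r.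
Qed.

(** Strong induction along [err_recursion]: all the data are polylogarithmic, and each division by
    [den0] adds 7 to the exponent. *)
Lemma err_polylog : exists r : R, [/\ 0 < r, r <= 1 &
  forall k, polylog r (fun z => err_j k z)].
Proof.
have [r [c [r0 r1 c0 hc]]] := den0_lower R.
exists r; split => // k.
have one : polylog_poly r (fun=> 1) := polylog_poly_cst r 1.
have hi K := polylog_egf K (polylog_inv_jet r).
have hz K := polylog_egf K (fun j => polylog_zeta_reg j r1).
have hd K : polylog_poly r (fun z => den_poly K z).
  apply: polylog_polyD => //; apply: polylog_polyM => //.
  by apply: polylog_polyD => //; exact: polylog_polyN.
have hn K : polylog_poly r (fun z => num_poly K z).
  apply: polylog_polyD.
    apply: polylog_polyM.
      by apply: polylog_polyD => //; exact: polylog_polyN.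
    apply: polylog_polyD; first exact: (polylog_egf K (fun j => polylog_zeta_reg j.+1 r1)).
    apply: polylog_polyN; under [X in polylog_poly _ X]eq_fun do rewrite expr2.
    exact: polylog_polyM.
  apply: polylog_polyN; under [X in polylog_poly _ X]eq_fun do rewrite mulr2n.
  by apply: polylog_polyD; apply: polylog_polyM.
elim/ltn_ind: k => k ih.
pose F z := (num_poly k z)`_k - \sum_(i < k) err_j i z / i`!%:R * (den_poly k z)`_(k - i).
have hF : polylog r F.
  apply: polylogD; first exact: hn.
  under eq_fun do rewrite -mulN1r.
  apply: polylogM; first exact: polylog_cst.
  apply: polylog_sum => i; apply: polylogM; last exact: hd.
  by apply: polylogM; [exact: ih | exact: polylog_cst].
have [K [N hK]] := hF.
exists (k`!%:R * K / c), (N + 7)%N => z zr; have /andP[z1 _] := zr.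
have := err_recursion k z1; rewrite coef0_den_poly => e.
have := hK z zr; rewrite /F -e !normcM normcV normc_nat => h.
have d0 := hc z zr; set l := ell _ in h d0 *.
have l0 : 0 < l := ell_gt0 _.
have f0 : 0 < k`!%:R :> R by rewrite ltr0n fact_gt0.
rewrite mulrAC ler_pdivlMr // exprD mulrA.
apply: (@le_trans _ _ (normc (err_j k z) * (normc (den0 z) * l ^+ 7))).
  by rewrite ler_wpM2l ?normc_ge0.
rewrite mulrA ler_wpM2r ?exprn_ge0 ?(ltW l0) //.
by rewrite -mulrA -ler_pdivrMl // mulrA [_^-1 * _]mulrC.
Qed.

End PolyLog.

(** * A trigonometric approximation of the indicator of an interval *)

Section Kernel.
Variable R : realType.
Local Notation C := R[i].
Variables (N : nat) (delta : R).
Hypothesis delta_gt0 : 0 < delta.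

(* [kprim] is the primitive of [cos (delta * y / 2) ^ 2N]; up to [pi / delta] it
   is close to [ktop] times the sign of [y], and it is a finite combination of
   [y] and of the [sin (kfreq i * y)]. *)
Definition kfreq (i : nat) : R := (i%:R - N%:R) * delta.
Definition kweight (i : nat) : R := 'C(N.*2, i)%:R / 4 ^+ N.
Definition kprim_term (i : nat) (y : R) : R :=
  if i == N then y else sin (kfreq i * y) / kfreq i.
Definition kprim (y : R) : R := \sum_(i < N.*2.+1) kweight i * kprim_term i y.
Definition kmean : R := kweight N.

Definition cis (x : R) : C := cexp (0 +i* x)%C.

Lemma cisD x y : cis (x + y) = cis x * cis y.
Proof. by rewrite -cexpD; congr cexp; apply/eqP; rewrite eq_complex /= addr0 !eqxx. Qed.

Lemma cisMn n x : cis (n%:R * x) = cis x ^+ n.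
Proof.
rewrite -cexpX; congr cexp.
by rewrite -(rmorph_nat (real_complex R)); apply/eqP; rewrite eq_complex /= !(mulr0, mul0r, subr0, addr0) !eqxx.
Qed.

Lemma cis_Re x : Re (cis x) = cos x.
Proof. by rewrite /cis /cexp cReMr expR0 mul1r. Qed.

Lemma cis_Im x : Im (cis x) = sin x.
Proof. by rewrite /cis /cexp cImMr expR0 mul1r. Qed.

Lemma normc_cis x : normc (cis x) = 1.
Proof. by rewrite normc_cexp expR0. Qed.

Lemma cos_pow_expand x :
  cos x ^+ N.*2 = \sum_(i < N.*2.+1) kweight i * cos ((i%:R - N%:R) * (2 * x)).
Proof.
have e2 : cis x + cis (- x) = (2 * cos x)%:C%C.
  apply/eqP; rewrite eq_complex cReD cImD !cis_Re !cis_Im cosN sinN /= subrr eqxx andbT.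
  by apply/eqP; ring.
have e : ((2 * cos x) ^+ N.*2)%:C%C =
    \sum_(i < N.*2.+1) 'C(N.*2, i)%:R * cis ((N%:R - i%:R) * (2 * x)).
  have -> : ((2 * cos x) ^+ N.*2)%:C%C = (cis x + cis (- x)) ^+ N.*2.
    by rewrite e2 -rmorphXn.
  rewrite exprDn; apply: eq_bigr => i _.
  rewrite -!cisMn -cisD -mulr_natl; congr (_ * cis _).
  have iN : (i <= N.*2)%N by rewrite -ltnS.
  have d2 : N.*2%:R = N%:R + N%:R :> R by rewrite -addnn natrD.
  by rewrite natrB // d2; ring.
have := congr1 (@Re R) e; rewrite [LHS]/= exprMn => e3.
have -> : cos x ^+ N.*2 = (2 ^+ N.*2 * cos x ^+ N.*2) / 4 ^+ N.
  have -> : 2 ^+ N.*2 = 4 ^+ N :> R.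
    by rewrite -muln2 mulnC exprM; congr (_ ^+ _); ring.
  by rewrite mulrAC mulfV ?mul1r // expf_neq0.
rewrite e3 raddf_sum mulr_suml; apply: eq_bigr => i _ /=.
rewrite -(rmorph_nat (real_complex R)) cReMr cis_Re /kweight mulrAC; congr (_ * _).
by rewrite -cosN; congr cos; ring.
Qed.

Lemma der_kprim y : der kprim (cos (delta * y / 2) ^+ N.*2) y.
Proof.
rewrite cos_pow_expand; apply: (der_sum (index_enum 'I_N.*2.+1)) => i.
apply: derZ; rewrite /kprim_term.
have -> : (i%:R - N%:R) * (2 * (delta * y / 2)) = kfreq i * y.
  by rewrite /kfreq; field.
have [iN|iN] := eqVneq (i : nat) N.
  by rewrite /kfreq iN subrr !mul0r cos0; exact: der_id.
have f0 : kfreq i != 0.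
  by rewrite mulf_eq0 negb_or subr_eq0 eqr_nat iN gt_eqF.
have d1 : der (fun y => kfreq i * y) (kfreq i) y.
  by apply: (der_eq (derZ (kfreq i) (der_id y))); rewrite mulr1.
have := derM (der_comp (is_derive_sin (kfreq i * y)) d1) (der_cst (kfreq i)^-1 y).
by move/der_eq; apply; field.
Qed.

Lemma kprim_mono x y : x <= y -> kprim x <= kprim y.
Proof.
move=> xy; apply: (der_ge0_ndecr xy (fun z _ => der_kprim z)) => z _.
by rewrite -muln2 mulnC exprM exprn_ge0 // sqr_ge0.
Qed.

Lemma kprimN y : kprim (- y) = - kprim y.
Proof.
rewrite /kprim -sumrN; apply: eq_bigr => i _; rewrite -mulrN; congr (_ * _).
by rewrite /kprim_term; case: eqP => // _; rewrite mulrN sinN mulNr.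
Qed.

Lemma sin_add_2npi (x : R) (n : nat) : sin (x + n%:R * (2 * pi)) = sin x.
Proof.
elim: n => [|n ih]; first by rewrite mul0r addr0.
have -> : x + n.+1%:R * (2 * pi) = x + n%:R * (2 * pi) + pi *+ 2.
  by rewrite -natr1 -mulr_natl; ring.
by rewrite sinD2pi.
Qed.

Lemma kprim_period y : kprim (y + 2 * pi / delta) = kprim y + 2 * pi / delta * kmean.
Proof.
have kN : (N < N.*2.+1)%N by rewrite ltnS -addnn leq_addr.
rewrite /kprim (bigD1 (Ordinal kN)) //= [in RHS](bigD1 (Ordinal kN)) //=.
rewrite {1 3}/kprim_term eqxx mulrDr addrAC -!addrA -/kmean; congr (_ + _).
rewrite [kmean * _]mulrC; congr (_ + _); apply: eq_bigr => i iN; congr (_ * _).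
rewrite /kprim_term; case: eqP => [e|_]; first by case/eqP: iN; apply: val_inj.
congr (_ / _); rewrite /kfreq mulrDr.
have -> : (i%:R - N%:R) * delta * (2 * pi / delta) = (i%:R - N%:R) * (2 * pi).
  by field; rewrite gt_eqF.
have [Ni|iN'] := leqP N i; first by rewrite -natrB // sin_add_2npi.
have := sin_add_2npi ((i%:R - N%:R) * delta * y + (i%:R - N%:R) * (2 * pi)) (N - i).
move=> <-; congr sin; rewrite natrB ?(ltnW iN') //; ring.
Qed.

(** The integral of the kernel over half a period, from 0 to [pi / delta]. *)
Definition ktop : R := pi / delta * kmean.

Lemma kprim_half : kprim (pi / delta) = ktop.
Proof.
have := kprim_period (- (pi / delta)).
have -> : - (pi / delta) + 2 * pi / delta = pi / delta by field; rewrite gt_eqF.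
by rewrite kprimN /ktop -!mulrA; lra.
Qed.

(** From [kappa] to [pi / delta] the kernel is at most [cos (delta * kappa / 2) ^ 2N], so its
    primitive hardly moves. *)
Lemma kprim_near_top kappa y : 0 <= kappa -> kappa <= y <= pi / delta ->
  ktop - pi / delta * cos (delta * kappa / 2) ^+ N.*2 <= kprim y <= ktop.
Proof.
move=> k0 /andP[ky yp]; rewrite -{2}kprim_half kprim_mono // andbT.
have [c /andP[yc cp] e] := mvt yp (fun z _ => der_kprim z).
rewrite lerBlDl -lerBlDr -kprim_half e mulrC.
have y0 : 0 <= y by exact: le_trans ky.
apply: ler_pM; rewrite ?subr_ge0 //.
- by rewrite -muln2 mulnC exprM exprn_ge0 // sqr_ge0.
- by rewrite gerBl.
have c0 : 0 <= c by exact: le_trans yc.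
have dc : delta * c / 2 <= pi / 2.
  by rewrite ler_pM2r // mulrC -ler_pdivlMr.
have k2 : 0 <= delta * kappa / 2 by rewrite divr_ge0 // mulr_ge0 // ltW.
have kc : delta * kappa / 2 <= delta * c / 2.
  by rewrite ler_pM2r // ler_pM2l // (le_trans ky).
have pi0 := pi_gt0 R.
have hc : cos (delta * c / 2) <= cos (delta * kappa / 2).
  by rewrite leNgt ltr_cos ?in_itv /= -?leNgt //; apply/andP; split; lra.
rewrite lerXn2r ?nnegrE //; first by apply: cos_ge0_pihalf; lra.
by apply: cos_ge0_pihalf; apply/andP; split; lra.
Qed.

(** The integral of the kernel centred at [y] over [[y1, y2]]: a smoothed indicator of height
    [2 * ktop]. The linear terms cancel in the dependence on [y], so it is a trigonometric
    polynomial in [y], of period [2 pi / delta]. *)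
Definition ktest (y1 y2 y : R) : R := kprim (y2 - y) - kprim (y1 - y).

Lemma ktest_ge0 y1 y2 y : y1 <= y2 -> 0 <= ktest y1 y2 y.
Proof. by move=> h; rewrite subr_ge0 kprim_mono // lerD2r. Qed.

Lemma ktest_le y1 y2 y : y2 - y1 <= 2 * pi / delta -> ktest y1 y2 y <= 2 * ktop.
Proof.
move=> h; rewrite /ktest lerBlDl; apply: (@le_trans _ _ (kprim (y1 - y + 2 * pi / delta))).
  by apply: kprim_mono; lra.
by rewrite kprim_period lerD2l /ktop -!mulrA.
Qed.

Definition ktail (kappa : R) : R := pi / delta * cos (delta * kappa / 2) ^+ N.*2.

Lemma ktest_inside kappa y1 y2 y : 0 <= kappa ->
  y1 + kappa <= y <= y2 - kappa -> y2 - y <= pi / delta -> y - y1 <= pi / delta ->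
  2 * ktop - 2 * ktail kappa <= ktest y1 y2 y.
Proof.
move=> k0 /andP[h1 h2] h3 h4; rewrite /ktest -[y1 - y]opprB kprimN opprK.
have /andP[q1 _] := @kprim_near_top kappa (y2 - y) k0 ltac:(lra).
have /andP[q2 _] := @kprim_near_top kappa (y - y1) k0 ltac:(lra).
by rewrite /ktail; lra.
Qed.

Lemma ktest_outside kappa y1 y2 y : 0 <= kappa -> y1 <= y2 ->
  y <= y1 - kappa \/ y2 + kappa <= y -> `|y - y1| <= pi / delta -> `|y - y2| <= pi / delta ->
  ktest y1 y2 y <= ktail kappa.
Proof.
move=> k0 y12 h; rewrite !ler_norml => /andP[a1 a2] /andP[b1 b2].
rewrite /ktest; case: h => h.
  have /andP[q1 _] := @kprim_near_top kappa (y1 - y) k0 ltac:(lra).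
  have /andP[_ q2] := @kprim_near_top kappa (y2 - y) k0 ltac:(lra).
  by rewrite /ktail; lra.
rewrite -[y2 - y]opprB -[y1 - y]opprB !kprimN.
have /andP[q1 _] := @kprim_near_top kappa (y - y2) k0 ltac:(lra).
have /andP[_ q2] := @kprim_near_top kappa (y - y1) k0 ltac:(lra).
by rewrite /ktail; lra.
Qed.

(** Induction with the recursion of the central binomial coefficient. The loss against the true
    order [N ^ (-1/2)] is a power of [M], which a larger [k] recovers. *)
Lemma kmean_ge : (2 * N%:R + 1)^-1 <= kmean.
Proof.
rewrite /kmean /kweight ler_pdivlMr ?exprn_gt0 // mulrC ler_pdivrMr; last by rewrite ltr_pwDr // mulr_ge0.
rewrite mulrC; elim: (N) => [|n ih]; first by rewrite expr0 mulr0 add0r mul1r bin0.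
have e : (n.+1%:R : R) * 'C(n.+1.*2, n.+1)%:R = 2 * (2 * n%:R + 1) * 'C(n.*2, n)%:R.
  have e1 : ('C(n.+1.*2, n.+1) * n.+1 = n.+1.*2 * 'C(n.*2.+1, n))%N.
    by rewrite doubleS; have := mul_bin_diag n.*2.+2 n => /= ->; rewrite mulnC.
  have e2 : ('C(n.*2.+1, n) * n.+1 = n.*2.+1 * 'C(n.*2, n))%N.
    have := mul_bin_down n.*2.+1 n; rewrite /= => ->.
    by rewrite mulnC (_ : n.*2.+1 - n = n.+1)%N // -addnn -addSn addnK.
  have n1 : n.+1%:R != 0 :> R by rewrite pnatr_eq0.
  have {}e1 := congr1 (fun m => m%:R : R) e1; have {}e2 := congr1 (fun m => m%:R : R) e2.
  rewrite !natrM in e1 e2; have d1 : n.*2.+1%:R = 2 * n%:R + 1 :> R.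
    by rewrite -addn1 natrD -muln2 natrM; ring.
  have d2 : n.+1.*2%:R = 2 * n.+1%:R :> R by rewrite -muln2 natrM; ring.
  rewrite d1 in e2; rewrite d2 in e1.
  rewrite mulrC e1.
  have -> : 2 * (2 * n%:R + 1) * 'C(n.*2, n)%:R = 2 * ('C(n.*2.+1, n)%:R * n.+1%:R) :> R.
    by rewrite e2; ring.
  by ring.
have n0 : 0 < n.+1%:R :> R by rewrite ltr0n.
rewrite -(ler_pM2l n0) exprS.
have -> : n.+1%:R * ((2 * n.+1%:R + 1) * 'C(n.+1.*2, n.+1)%:R) =
  (2 * n.+1%:R + 1) * 2 * ((2 * n%:R + 1) * 'C(n.*2, n)%:R) :> R.
  by rewrite mulrCA e; ring.
have -> : n.+1%:R * (4 * 4 ^+ n) = (4 * n.+1%:R) * 4 ^+ n :> R by ring.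
by apply: ler_pM => //; lra.
Qed.

End Kernel.

Section CosineDecay.
Variable R : realType.

Lemma sin_le_id (x : R) : 0 <= x -> sin x <= x.
Proof.
move=> x0; have := der_ge0_ndecr (f := fun y => y - sin y) (f' := fun y => 1 - cos y) x0.
rewrite sin0 subr0 subr_ge0; apply => y _.
  exact: derB (der_id y) (is_derive_sin y).
by rewrite subr_ge0 cos_le1.
Qed.

(** The mean value theorem writes [sin x = x cos c] with [cos c ^ 2 >= 3/4], so
    [cos x ^ 2 <= 1 - 3 x^2 / 4]. *)
Lemma cos_sq_le (x : R) : 0 <= x <= 2^-1 -> cos x ^+ 2 <= expR (- (x ^+ 2 / 2)).
Proof.
move=> /andP[x0 x1].
have cge y : 0 <= y <= x -> 3 / 4 <= cos y ^+ 2.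
  move=> /andP[y0 yx]; rewrite cos2sin2.
  have s0 : 0 <= sin y.
    by apply: sin_ge0_pi; rewrite y0 /=; have := pi_ge2 R; lra.
  have : sin y ^+ 2 <= 2^-1 ^+ 2.
    rewrite lerXn2r ?nnegrE ?invr_ge0 //; apply: (le_trans (sin_le_id y0)); lra.
  by rewrite expr2; lra.
have [c hc e] := mvt x0 (fun y _ => is_derive_sin y).
rewrite sin0 !subr0 in e.
rewrite cos2sin2 e; have := cge c hc; have := expR_ge1Dx (- (x ^+ 2 / 2)).
rewrite exprMn; have := sqr_ge0 x; move: (x ^+ 2) (cos c ^+ 2) => a b.
nra.
Qed.

Lemma ktail_le N (delta kappa : R) : 0 < delta -> 0 <= kappa -> delta * kappa <= 1 ->
  ktail N delta kappa <= pi / delta * expR (- (N%:R * (delta * kappa) ^+ 2 / 8)).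
Proof.
move=> d0 k0 dk; have dk0 : 0 <= delta * kappa by rewrite mulr_ge0 // ltW.
rewrite /ktail ler_wpM2l ?divr_ge0 ?pi_ge0 ?(ltW d0) //.
have h := @cos_sq_le (delta * kappa / 2) ltac:(lra).
rewrite -muln2 mulnC exprM.
have -> : expR (- (N%:R * (delta * kappa) ^+ 2 / 8)) =
   expR (- ((delta * kappa / 2) ^+ 2 / 2)) ^+ N.
  by rewrite -expRM_natl; congr expR; field.
by rewrite lerXn2r ?nnegrE ?sqr_ge0 ?expR_ge0.
Qed.

End CosineDecay.

(** * Weighted sums over windows, tested against the kernel *)

Section TestSums.
Variable R : realType.
Local Notation C := R[i].

Lemma has_sum_Re (a : nat -> C) z :
  has_sum a z -> has_sum (fun n => (Re (a n))%:C%C) (Re z)%:C%C.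
Proof.
move=> h e e0; have [N hN] := h e e0; exists N => n /hN.
apply: le_trans; rewrite -rmorph_sum -rmorphB normcR.
by rewrite -raddf_sum -cReB normc_Re.
Qed.

Lemma has_sum_Im (a : nat -> C) z :
  has_sum a z -> has_sum (fun n => (Im (a n))%:C%C) (Im z)%:C%C.
Proof.
move=> h e e0; have [N hN] := h e e0; exists N => n /hN.
apply: le_trans; rewrite -rmorph_sum -rmorphB normcR.
by rewrite -raddf_sum -cImB normc_Im.
Qed.

Lemma has_sum_lincomb n (c : 'I_n -> C) (F : 'I_n -> nat -> C) (z : 'I_n -> C) :
  (forall i, has_sum (F i) (z i)) ->
  has_sum (fun j => \sum_(i < n) c i * F i j) (\sum_(i < n) c i * z i).
Proof.
elim: n c F z => [|n ih] c F z h.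
  rewrite big_ord0; under eq_fun do rewrite big_ord0.
  by move=> e e0; exists 0%N => k _; rewrite big1 // subr0 normc0 ltW.
rewrite big_ord_recr /=.
have -> : (fun j => \sum_(i < n.+1) c i * F i j) = fun j =>
    \sum_(i < n) c (widen_ord (leqnSn n) i) * F (widen_ord (leqnSn n) i) j +
    c ord_max * F ord_max j.
  by apply: funext => j; rewrite big_ord_recr.
apply: has_sumD; last exact: has_sumZ.
by apply: (ih (fun i => c (widen_ord (leqnSn n) i)) (fun i => F (widen_ord (leqnSn n) i))
  (fun i => z (widen_ord (leqnSn n) i))).
Qed.

Definition rho (k : nat) (s : R) (n : nat) : R := ln n%:R ^+ k * npow s n.

Lemma rho_ge0 k s n : 0 <= rho k s n.
Proof. by rewrite mulr_ge0 ?npow_ge0 // exprn_ge0 // ln_nat_ge0. Qed.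

Lemma dterm_cis k s f n :
  dterm k (s +i* f)%C n = (rho k s n)%:C%C * cis (- (f * ln n%:R)).
Proof.
case: n => [|n]; first by rewrite /rho mulr0 mul0r.
rewrite /dterm /lpow /rho rmorphM /= -mulrA; congr (_ * _).
rewrite /cpow /cis -cexp_real -cexpD; congr cexp.
by apply/eqP; rewrite eq_complex /=; apply/andP; split; apply/eqP; ring.
Qed.

Definition excess k s n : R := (mangoldt R n - 1) * rho k s n.

Lemma has_sum_excess k s f : 1 < s ->
  has_sum (fun n => (excess k s n)%:C%C * cis (- (f * ln n%:R))) (err_j k (s +i* f)%C).
Proof.
move=> s1; set z := (s +i* f)%C.
have e0 : 0 < s - 1 by rewrite subr_gt0.
have ez : 1 + (s - 1) <= Re z by rewrite /=; lra.
have := has_sumD (csumP (abs_bound_lam k e0 ez)) (has_sumZ (-1) (csumP (abs_bound_dterm k e0 ez))).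
rewrite mulN1r -[_ - _]/(err_j k z); congr has_sum; apply: funext => n.
have -> : (excess k s n)%:C%C = (mangoldt R n)%:C%C * (rho k s n)%:C%C - (rho k s n)%:C%C.
  by rewrite -rmorphM -rmorphB; congr (_%:C%C); rewrite /excess mulrBl mul1r.
by rewrite /lam_term dterm_cis; ring.
Qed.

Lemma kweight_ge0 N i : 0 <= kweight R N i.
Proof. by rewrite divr_ge0 ?ler0n // exprn_ge0. Qed.

Lemma sum_kweight N : \sum_(i < N.*2.+1) kweight R N i = 1.
Proof.
have := cos_pow_expand N (0 : R); rewrite cos0 expr1n => ->.
by apply: eq_bigr => i _; rewrite !mulr0 cos0 mulr1.
Qed.

(* Each frequency of the kernel contributes one value of [err_j k] on the line
   [Re z = s], so no contour integral is needed. *)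
Lemma ktest_sum k (K r s delta y1 y2 : R) (p N : nat) :
  (forall z, 1 < Re z <= 1 + r ->
    normc (err_j k z) <= K * ell (Im z) ^+ p) ->
  0 < K -> 1 < s <= 1 + r -> 0 < delta -> y1 <= y2 ->
  exists X0, forall X, (X0 <= X)%N ->
  `|\sum_(n < X) excess k s n * ktest N delta y1 y2 (ln n%:R)| <=
  (y2 - y1 + 2 / delta) * (K * ell (N%:R * delta) ^+ p) + 1.
Proof.
move=> hK K0 ss d0 y12; have /andP[s1 s2] := ss.
set E := K * ell _ ^+ p.
have E0 : 0 <= E by rewrite mulr_ge0 ?exprn_ge0 ?(ltW (ell_gt0 _)) ?(ltW K0).
pose T i y := kprim_term N delta i (y2 - y) - kprim_term N delta i (y1 - y).
have step (i : 'I_N.*2.+1) : exists z,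
    has_sum (fun n => (excess k s n * T i (ln n%:R))%:C%C) z /\
    normc z <= (y2 - y1 + 2 / delta) * E.
  pose f := kfreq N delta i.
  have fE : normc (err_j k (s +i* f)%C) <= E.
    apply: (le_trans (hK (s +i* f)%C ss)).
    rewrite /E ler_pM2l // lerXn2r ?nnegrE ?(ltW (ell_gt0 _)) //.
    apply: ell_mono; rewrite /f /kfreq !normrM [`|N%:R|]ger0_norm ?ler0n //.
    rewrite ler_wpM2r // ler_norml; have := ler0n R i.
    have : i%:R <= N.*2%:R :> R by rewrite ler_nat -ltnS.
    have -> : N.*2%:R = N%:R + N%:R :> R by rewrite -addnn natrD.
    by have := ler0n R N; lra.
  have dd : 0 <= 2 / delta by rewrite divr_ge0 // ltW.
  have [iN|iN] := eqVneq (i : nat) N.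
    have f0 : f = 0 by rewrite /f /kfreq iN subrr mul0r.
    exists ((y2 - y1)%:C%C * (Re (err_j k (s +i* f)%C))%:C%C); split.
      have := has_sumZ (y2 - y1)%:C%C (has_sum_Re (has_sum_excess k f s1)).
      congr has_sum; apply: funext => n; rewrite cReMr cis_Re f0 mul0r oppr0 cos0 mulr1.
      by rewrite -rmorphM /T /kprim_term iN eqxx; congr (_%:C%C); ring.
    rewrite normcM !normcR mulrDl ger0_norm ?subr_ge0 //.
    apply: ler_wpDr; first by rewrite mulr_ge0.
    by rewrite ler_wpM2l ?subr_ge0 // (le_trans (normc_Re _)).
  have df : delta <= `|f|.
    rewrite /f /kfreq normrM (gtr0_norm d0); apply: (ler_peMl (ltW d0)).
    have [lt|ge] := ltnP i N.
      rewrite ler0_norm; last by rewrite subr_le0 ler_nat ltnW.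
      by rewrite opprB -natrB ?(ltnW lt) // nat_ge1 // subn_gt0.
    rewrite -natrB // normr_nat nat_ge1 // subn_gt0 ltn_neqAle ge andbT eq_sym.
    exact: iN.
  have f0 : f != 0 by rewrite -normr_gt0 (lt_le_trans d0).
  (* The term is the imaginary part of [c * cis (- f y)], and the coefficients [excess] are real, so
     imaginary parts can be taken of the whole sum. As [|f| >= delta], [normc c <= 2 / delta]. *)
  pose c : C := (cis (f * y2) - cis (f * y1)) * (f^-1)%:C%C.
  exists (Im (c * err_j k (s +i* f)%C))%:C%C; split.
    have := has_sum_Im (has_sumZ c (has_sum_excess k f s1)).
    congr has_sum; apply: funext => n; congr (_%:C%C).
    have -> : c * ((excess k s n)%:C%C * cis (- (f * ln n%:R))) = (excess k s n)%:C%C *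
        ((f^-1)%:C%C * (cis (f * y2) * cis (- (f * ln n%:R)) -
        cis (f * y1) * cis (- (f * ln n%:R)))) by rewrite /c; ring.
    rewrite !cImMr cImB -!cisD !cis_Im.
    by rewrite /T /kprim_term (negbTE iN) !mulrBr -/f; field.
  rewrite normcR; apply: (le_trans (normc_Im _)); rewrite normcM mulrDl.
  apply: ler_wpDl; first by rewrite mulr_ge0 ?subr_ge0.
  rewrite ler_pM ?normc_ge0 // /c normcM normcR normfV.
  rewrite ler_pM ?normc_ge0 ?invr_ge0 //.
    by apply: (le_trans (le_normcB _ _)); rewrite !normc_cis; lra.
  by rewrite lef_pV2 // posrE ?normr_gt0.
have /boolp.choice[z hz] := step.
have hs := has_sum_lincomb (fun i : 'I_N.*2.+1 => (kweight R N i)%:C%C) (fun i => (hz i).1).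
have hn : normc (\sum_(i < N.*2.+1) (kweight R N i)%:C%C * z i) <=
    (y2 - y1 + 2 / delta) * E.
  apply: (le_trans (le_normc_sum _ _ _)).
  apply: (@le_trans _ _ (\sum_(i < N.*2.+1) kweight R N i * ((y2 - y1 + 2 / delta) * E)));
    last by rewrite -mulr_suml sum_kweight mul1r.
  apply: ler_sum => i _.
  rewrite normcM normcR ger0_norm ?kweight_ge0 // ler_wpM2l ?kweight_ge0 //.
  exact: (hz i).2.
have [X0 hX] := hs 1 ltr01.
exists X0 => X /hX; set Z := \sum_(i < N.*2.+1) _ => h.
have := le_trans (lerB_normc _ _) h.
have -> : \sum_(n < X) \sum_(i < N.*2.+1) (kweight R N i)%:C%C *
    (excess k s n * T i (ln n%:R))%:C%C =
    (\sum_(n < X) excess k s n * ktest N delta y1 y2 (ln n%:R))%:C%C.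
  rewrite rmorph_sum; apply: eq_bigr => n _.
  rewrite /ktest /kprim -sumrB mulr_sumr rmorph_sum; apply: eq_bigr => i _ /=.
  by rewrite -rmorphM; congr (_%:C%C); rewrite /T; ring.
by rewrite normcR; lra.
Qed.

(** Stated for general [A] and [B] because it is used in both directions. The test function is
    periodic, so beyond [pi / delta - 1] it may be large again, and [F] bounds the mass of [B]
    there. Of the three copies of [ktail], two come from the terms of [A] inside and one from those
    of [B] outside. *)
Lemma window_compare (A B : nat -> R) X N (delta kappa a b M D F : R) :
  (forall n, 0 <= A n) -> (forall n, 0 <= B n) -> 0 < delta -> 0 <= kappa ->
  0 < kappa -> a <= b -> -1 <= a - kappa -> b + kappa <= pi / delta ->
  b - a + 2 * kappa <= pi / delta ->
  0 <= ktail N delta kappa ->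
  \sum_(n < X) A n <= M -> \sum_(n < X) B n <= M ->
  \sum_(n < X | pi / delta - 1 < ln n%:R) B n <= F ->
  `|\sum_(n < X) (A n - B n) * ktest N delta (a - kappa) (b + kappa) (ln n%:R)| <= D ->
  2 * ktop N delta * \sum_(n < X | a <= ln n%:R <= b) A n <=
  2 * ktop N delta * \sum_(n < X | a - 3 * kappa < ln n%:R <= b + 3 * kappa) B n +
  3 * ktail N delta kappa * M + 2 * ktop N delta * F + D.
Proof.
move=> A0 B0 d0 k0 k1 ab a1 b1 ba t0 hA hB hF hD.
set Om := ktest N delta (a - kappa) (b + kappa) in hD.
set c0 := ktop N delta; set tau := ktail N delta kappa in t0 *.
have ak : a - kappa <= b + kappa by lra.
have c00 : 0 <= c0.
  by rewrite mulr_ge0 ?divr_ge0 ?pi_ge0 ?kweight_ge0 // ltW.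
have Om0 y : 0 <= Om y by apply: ktest_ge0.
have Om2 y : Om y <= 2 * c0.
  apply: ktest_le => //; have := pi_ge0 R.
  have : 0 <= pi / delta by rewrite divr_ge0 ?pi_ge0 // ltW.
  by rewrite -mulrA; lra.
have i1 (L : R) : a <= L <= b -> 2 * c0 - 2 * tau <= Om L.
  by move=> /andP[h1 h2]; apply: ktest_inside => //; lra.
have h1 : (2 * c0 - 2 * tau) * \sum_(n < X | a <= ln n%:R <= b) A n <= \sum_(n < X) A n * Om (ln n%:R).
  rewrite mulr_sumr big_mkcond; apply: ler_sum => n _.
  case: ifP => h; last by rewrite mulr_ge0.
  by rewrite mulrC ler_wpM2l // i1.
have h2 : \sum_(n < X) B n * Om (ln n%:R) <=
    2 * c0 * (\sum_(n < X | a - 3 * kappa < ln n%:R <= b + 3 * kappa) B n) +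
    tau * (\sum_(n < X) B n) + 2 * c0 * (\sum_(n < X | pi / delta - 1 < ln n%:R) B n).
  rewrite !mulr_sumr [X in _ <= X + _ + _]big_mkcond [X in _ <= _ + X]big_mkcond -!big_split /=.
  apply: ler_sum => n _; set L : R := ln n%:R.
  have L0 : 0 <= L := ln_nat_ge0 _ _.
  have BO : B n * Om L <= 2 * c0 * B n by rewrite mulrC ler_wpM2r.
  have tB : 0 <= tau * B n by rewrite mulr_ge0.
  have cB : 0 <= 2 * c0 * B n := mulr_ge0 (mulr_ge0 (ler0n _ 2) c00) (B0 n).
  case: (boolP (a - 3 * kappa < L <= b + 3 * kappa)) => [_|hw]; first by case: ifP => _; lra.
  case: (ltrP (pi / delta - 1) L) => hL; first by lra.
  rewrite addr0 add0r mulrC ler_wpM2r //; apply: ktest_outside => //.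
  - by move: hw; rewrite negb_and -leNgt -ltNge => /orP[h|h]; [left|right]; lra.
  - by rewrite ler_norml; lra.
  - by rewrite ler_norml; lra.
have h3 : \sum_(n < X) A n * Om (ln n%:R) <= \sum_(n < X) B n * Om (ln n%:R) + D.
  rewrite -lerBlDl -sumrB; apply: le_trans (ler_norm _) _.
  by apply: le_trans hD; rewrite le_eqVlt; apply/orP; left; apply/eqP;
     congr (`|_|); apply: eq_bigr => n _; rewrite mulrBl.
have h4 : \sum_(n < X | a <= ln n%:R <= b) A n <= M.
  apply: le_trans hA; rewrite big_mkcond; apply: ler_sum => n _.
  by case: ifP.
have h5 := ler_wpM2l t0 h4; have h6 := ler_wpM2l t0 hB.
have h7 := ler_wpM2l (_ : 0 <= 2 * c0) hF.
have {}h7 := h7 ltac:(lra).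
move: h1; rewrite mulrBl; lra.
Qed.

End TestSums.

(** * Choice of the kernel's parameters *)

Section WindowEstimate.
Variable R : realType.

Lemma expo_beats_power q (x : R) : 0 <= x -> x ^+ q * expR (- (x / 2)) <= q`!%:R * 2 ^+ q.
Proof.
move=> x0; rewrite expRN ler_pdivrMr ?expR_gt0 //.
have := @ln_exp_le R x q 2^-1 _ x0; rewrite invr_gt0 => /(_ (ltr0Sn _ _)).
by rewrite exprVn invrK [2^-1 * x]mulrC.
Qed.

(** The exponent [p] of the polylogarithmic bounds disappears here: at frequencies up to [m ^ q], a
    power of [ell] is a power of [1 + ln m], hence [O(m)]. *)
Lemma ell_power_le (K : R) p q : 0 < K -> exists2 Q : R, 0 < Q &
  forall m, (0 < m)%N -> K * ell (m%:R ^+ q) ^+ p <= Q * m%:R.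
Proof.
move=> K0; have c0 : 0 < (5 + q%:R : R) by rewrite ltr_pwDl.
exists (K * ((5 + q%:R) ^+ p * (p`!%:R * expR 1))).
  by rewrite mulr_gt0 // mulr_gt0 ?exprn_gt0 // mulr_gt0 ?expR_gt0 // ltr0n fact_gt0.
move=> m m0; have m1 := nat_ge1 R m0.
have mq : 1 <= m%:R ^+ q :> R by exact: exprn_ege1.
have L0 := ln_nat_ge0 R m.
have h : ell (m%:R ^+ q) <= (5 + q%:R) * (1 + ln m%:R) :> R.
  rewrite /ell ger0_norm; last by lra.
  have : ln (m%:R ^+ q + 3) <= ln (4 * m%:R ^+ q) :> R by rewrite ler_ln_pos //; lra.
  rewrite lnM ?posrE //; last by lra.
  rewrite lnXn; last by lra.
  have -> : ln m%:R *+ q = q%:R * ln m%:R :> R by rewrite mulr_natl.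
  have := @ln_sublinear R 4 ltac:(lra).
  have : 0 <= q%:R :> R by rewrite ler0n.
  lra.
rewrite -mulrA ler_pM2l // -!mulrA.
apply: (@le_trans _ _ ((5 + q%:R) ^+ p * (1 + ln m%:R) ^+ p)).
  rewrite -exprMn; apply: lerXn2r => //; rewrite nnegrE; first exact: ltW (ell_gt0 _).
  by rewrite mulr_ge0 ?(ltW c0) // addr_ge0.
rewrite ler_pM2l ?exprn_gt0 //.
have := @exprn_le_expR R (1 + ln m%:R) p; rewrite expRD lnK ?posrE; last by lra.
by apply; lra.
Qed.

(** A majorant for the total mass of [rho k] and of [lrho k] at [s = 1 + 1/M]; the index [k.+1]
    accounts for [Lambda <= ln]. *)
Definition mass2 k (M : R) : R := mass k.+1 (2 * M)^-1 + mass k (2 * M)^-1.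

Lemma mass2_le k : exists2 Q : R, 0 < Q & forall M : R, 1 <= M -> mass2 k M <= Q * M ^+ k.+2.
Proof.
have mass_le j : forall M : R, 1 <= M -> mass j (2 * M)^-1 <= j`!%:R * 4 ^+ j * 5 * M ^+ j.+1.
  move=> M M1; have M0 : M != 0 by rewrite gt_eqF //; lra.
  rewrite /mass -invfM -exprVn !invrK (_ : 2 * M * 2 = 4 * M); last by ring.
  rewrite exprMn exprSr -!mulrA ler_pM2l ?ltr0n ?fact_gt0 //.
  rewrite ler_pM2l ?exprn_gt0 // mulrCA ler_pM2l ?exprn_gt0 //; lra.
exists (k.+1`!%:R * 4 ^+ k.+1 * 5 + k`!%:R * 4 ^+ k * 5).
  by rewrite addr_gt0 // !mulr_gt0 ?exprn_gt0 ?ltr0n ?fact_gt0.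
move=> M M1; rewrite mulrDl lerD ?mass_le //.
apply: (le_trans (mass_le k M M1)); rewrite ler_wpM2l ?ler_weXn2l //.
Qed.

Definition lrho k s n : R := mangoldt R n * rho k s n.

Lemma lrho_ge0 k s n : 0 <= lrho k s n.
Proof. by rewrite mulr_ge0 ?mangoldt_ge0 ?rho_ge0. Qed.

Lemma lrho_le k s n : lrho k s n <= rho k.+1 s n.
Proof.
rewrite /lrho /rho mulrA exprS ler_wpM2r ?npow_ge0 // ler_wpM2r ?mangoldt_le_ln //.
by rewrite exprn_ge0 // ln_nat_ge0.
Qed.

(** Half of the exponent [1/M] keeps the series summable, while the other half makes the terms with
    [ln n] much larger than [M] negligible. *)
Lemma rho_half k (M : R) n : 0 < M -> rho k (1 + M^-1) n =
  expR (- (ln n%:R / (2 * M))) * rho k (1 + (2 * M)^-1) n.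
Proof.
move=> M0; rewrite /rho mulrCA; congr (_ * _); case: n => [|n]; first by rewrite mulr0.
by rewrite /npow -expRD; congr expR; field; rewrite gt_eqF.
Qed.

Lemma sum_rho_le k (M : R) X : 0 < M -> \sum_(n < X) rho k (1 + M^-1) n <= mass k (2 * M)^-1.
Proof.
move=> M0; apply: le_trans (sum_ln_npow k X _); last by rewrite invr_gt0 mulr_gt0.
apply: ler_sum => n _; rewrite rho_half //.
rewrite -[leRHS]mul1r ler_wpM2r ?rho_ge0 // expR_le1 oppr_le0.
by rewrite divr_ge0 ?ln_nat_ge0 // mulr_ge0 // ltW.
Qed.

Lemma sum_rho_far k (M T : R) X : 0 < M ->
  \sum_(n < X | T < ln n%:R) rho k (1 + M^-1) n <= expR (- (T / (2 * M))) * mass k (2 * M)^-1.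
Proof.
move=> M0; have M2 : 0 < 2 * M by rewrite mulr_gt0.
have iM : 0 < (2 * M)^-1 by rewrite invr_gt0.
apply: (@le_trans _ _ (expR (- (T / (2 * M))) * \sum_(n < X) rho k (1 + (2 * M)^-1) n)).
  rewrite mulr_sumr big_mkcond; apply: ler_sum => n _.
  case: ifP => h; last by rewrite mulr_ge0 ?expR_ge0 ?rho_ge0.
  rewrite rho_half // ler_wpM2r ?rho_ge0 // ler_expR lerN2.
  by rewrite ler_pM2r // ltW.
by rewrite ler_wpM2l ?expR_ge0 //; exact: sum_ln_npow.
Qed.

(** Here [M] is the logarithmic scale, not the number of faces. The sums over frequencies contribute
    [O(M^3)]; division by the height [ktop], at least [pi * M^2 / (3 N)] with [N = M^(4b+6)], yields
    the exponent [4b + 7]. Only [Q] depends on [k], which leaves [k] free. *)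
Lemma window_est b k : exists2 Q : R, 0 < Q & exists m0 : nat, forall m, (m0 <= m)%N ->
  let M : R := m%:R in let kappa := M ^- (2 * b) in let s := 1 + M^-1 in
  forall a c : R, 0 <= a -> a <= c -> c <= a + 1 -> c <= M + 1 ->
  exists X0, forall X, (X0 <= X)%N ->
  \sum_(n < X | a <= ln n%:R <= c) lrho k s n <=
    \sum_(n < X | a - 3 * kappa < ln n%:R <= c + 3 * kappa) rho k s n + Q * M ^+ (4 * b + 7) /\
  \sum_(n < X | a <= ln n%:R <= c) rho k s n <=
    \sum_(n < X | a - 3 * kappa < ln n%:R <= c + 3 * kappa) lrho k s n + Q * M ^+ (4 * b + 7).
Proof.
have n1 : (4 * b + 6 = 2 + (2 + 2 * b) * 2)%N by lia.
have n2 : (4 * b + 6 = 4 * b + 4 + 2)%N by lia.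
have n3 : (4 * b + 7 = (4 * b + 6).+1)%N by lia.
have [r [r0 r1 her]] := err_polylog R.
have [K K0 [p hK]] := polylog_pos (her k).
have [Q1 Q10 hQ1] := @ell_power_le K p (4 * b + 4) K0.
have [Q2 Q20 hQ2] := mass2_le k.
pose q := (4 * b + 6 + k.+2)%N.
pose P : R := q`!%:R * 2 ^+ q.
have P0 : 0 < P by rewrite mulr_gt0 ?exprn_gt0 // ltr0n fact_gt0.
(* The three summands pay for the tails of the kernel, for the far terms, and for the sums over
   frequencies. *)
exists (5 * Q2 * P + Q2 * P + (5 * Q1 + 1) * 3).
  by rewrite !addr_gt0 ?mulr_gt0 // addr_gt0 // mulr_gt0.
have [m1 hm1] := nat_above (r^-1).
exists (maxn m1 4) => m; rewrite geq_max => /andP[/hm1 mr m4] M kappa s a c a0 ac ca cM.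
have M4 : 4 <= M by rewrite (ler_nat R 4).
have M1 : 1 <= M by lra.
have M0 : 0 < M by lra.
have m0 : (0 < m)%N by exact: leq_trans m4.
pose N := (m ^ (4 * b + 6))%N.
have NM : N%:R = M ^+ (4 * b + 6) by rewrite natrX.
have hE := hQ1 m m0; rewrite -/M in hE mr.
clearbody M N.
have Mi : 0 < M^-1 by rewrite invr_gt0.
have ss : 1 < s <= 1 + r.
  rewrite /s ltrDl Mi /= lerD2l -[leRHS]invrK lef_pV2 ?posrE ?invr_gt0 //.
(* [N * (delta * kappa) ^ 2 = M ^ 2], so the kernel has width [kappa] up to
   [exp (- M^2 / 8)], and [pi / delta] exceeds the logarithms that matter. *)
pose delta := M ^- 2.
have d0 : 0 < delta by rewrite invr_gt0 exprn_gt0.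
have k0 : 0 < kappa by rewrite invr_gt0 exprn_gt0.
have k1 : kappa <= 1 by rewrite invf_le1 ?exprn_gt0 // exprn_ege1.
have N1 : 1 <= N%:R :> R by rewrite NM exprn_ege1.
have pi2 := pi_ge2 R.
have M21 : 1 <= M ^+ 2 by exact: exprn_ege1.
have pd : pi / delta = pi * M ^+ 2 by rewrite /delta invrK.
have M2 : 4 * M <= M ^+ 2 by rewrite expr2 ler_pM2r.
have pM : 2 * M ^+ 2 <= pi / delta by rewrite pd ler_wpM2r // exprn_ge0 // ltW.
have [u1 u2 u3] : [/\ -1 <= a - kappa, c + kappa <= pi / delta & c - a + 2 * kappa <= pi / delta].
  by split; lra.
have [u4 u5 u6] : [/\ 1 <= 2 * pi :> R, c + kappa - (a - kappa) + 2 / delta <= 5 * M ^+ 2 &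
    0 <= c + kappa - (a - kappa) + 2 / delta].
  by rewrite /delta invrK; split; lra.
have N0 : 0 < N%:R :> R by lra.
have tl : ktail N delta kappa <= pi / delta * expR (- (M / 2)).
  have dk : delta * kappa <= 1.
    rewrite -[leRHS]mul1r ler_pM //; first exact: ltW.
      exact: ltW.
    by rewrite invf_le1 ?exprn_gt0 // exprn_ege1.
  apply: (le_trans (ktail_le N d0 (ltW k0) dk)).
  rewrite ler_wpM2l ?divr_ge0 ?(ltW d0) ?pi_ge0 // ler_expR lerN2 NM.
  have -> : M ^+ (4 * b + 6) * (delta * kappa) ^+ 2 / 8 = M ^+ 2 / 8.
    congr (_ / _); rewrite /delta /kappa -invfM -exprD exprVn -exprM.
    by rewrite n1 exprD mulfK // expf_neq0 // gt_eqF.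
  lra.
have t0 : 0 <= ktail N delta kappa.
  rewrite /ktail mulr_ge0 ?divr_ge0 ?(ltW d0) ?pi_ge0 //.
  by rewrite -muln2 mulnC exprM exprn_ge0 // sqr_ge0.
have km := kmean_ge R N.
have c0 : pi / delta / (3 * N%:R) <= ktop N delta.
  rewrite /ktop ler_wpM2l ?divr_ge0 ?(ltW d0) ?pi_ge0 //; apply: le_trans km.
  by rewrite lef_pV2 ?posrE //; lra.
have pd0 : 0 < pi / delta by rewrite divr_gt0 // pi_gt0.
have c00 : 0 < ktop N delta.
  by apply: lt_le_trans c0; rewrite !divr_gt0 ?mulr_gt0 // pi_gt0.
have [X0 hX0] := @ktest_sum R k K r s delta (a - kappa) (c + kappa) p N hK K0 ss d0 ltac:(lra).
have ndE : N%:R * delta = M ^+ (4 * b + 4).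
  by rewrite NM /delta n2 exprD mulfK // expf_neq0 // gt_eqF.
have m2M : mass k.+1 (2 * M)^-1 <= mass2 k M /\ mass k (2 * M)^-1 <= mass2 k M.
  have iM : 0 < (2 * M)^-1 by rewrite invr_gt0 mulr_gt0.
  by rewrite /mass2 lerDl lerDr !mass_ge0.
have far0 : expR (- ((pi / delta - 1) / (2 * M))) <= expR (- (M / 2)).
  rewrite ler_expR lerN2 ler_pdivlMr; last by lra.
  rewrite (_ : M / 2 * (2 * M) = M ^+ 2); last by field.
  by lra.
have PM : M ^+ q * expR (- (M / 2)) <= P by exact: expo_beats_power (ltW M0).
have Ms := hQ2 M M1.
have ms0 : 0 <= mass2 k M by case: m2M => h _; apply: le_trans h; apply: mass_ge0; rewrite invr_gt0 mulr_gt0.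
have NMs : N%:R * mass2 k M * expR (- (M / 2)) <= Q2 * P.
  apply: (@le_trans _ _ (Q2 * (M ^+ q * expR (- (M / 2))))); last by rewrite ler_pM2l.
  rewrite mulrA ler_wpM2r ?expR_ge0 // NM.
  have -> : M ^+ q = M ^+ (4 * b + 6) * M ^+ k.+2 by rewrite -exprD.
  by rewrite mulrCA ler_wpM2l // exprn_ge0 // ltW.
have M7 : 1 <= M ^+ (4 * b + 7) by exact: exprn_ege1.
have key (A B : nat -> R) X : (forall n, 0 <= A n) -> (forall n, 0 <= B n) ->
  \sum_(n < X) A n <= mass2 k M -> \sum_(n < X) B n <= mass2 k M ->
  \sum_(n < X | pi / delta - 1 < ln n%:R) B n <= expR (- (M / 2)) * mass2 k M ->
  `|\sum_(n < X) (A n - B n) * ktest N delta (a - kappa) (c + kappa) (ln n%:R)| <=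
    (c + kappa - (a - kappa) + 2 / delta) * (K * ell (N%:R * delta) ^+ p) + 1 ->
  \sum_(n < X | a <= ln n%:R <= c) A n <=
  \sum_(n < X | a - 3 * kappa < ln n%:R <= c + 3 * kappa) B n +
   (5 * Q2 * P + Q2 * P + (5 * Q1 + 1) * 3) * M ^+ (4 * b + 7).
  move=> A0 B0 hA hB hF hD.
  have := window_compare A0 B0 d0 (ltW k0) k0 ac u1 u2 u3 t0 hA hB hF hD.
  set SA := \sum_(n < X | _) A n; set SB := \sum_(n < X | _) B n.
  set c1 := ktop N delta in c0 c00 *; set tau := ktail N delta kappa in tl t0 *.
  move=> hw.
  have e1 : 3 * tau * mass2 k M <= 2 * c1 * (5 * (Q2 * P)).
    apply: (@le_trans _ _ (3 * (pi / delta * expR (- (M / 2))) * mass2 k M)).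
      by rewrite ler_wpM2r // ler_pM2l.
    apply: (@le_trans _ _ (2 * (pi / delta / (3 * N%:R)) * (5 * (N%:R * mass2 k M * expR (- (M / 2)))))); last first.
      have N30 : 0 < 3 * N%:R :> R by rewrite mulr_gt0.
      apply: ler_pM.
      - by apply: mulr_ge0 => //; apply: divr_ge0; exact: ltW.
      - apply: mulr_ge0 => //; apply: mulr_ge0 (expR_ge0 _).
        by apply: mulr_ge0 => //; exact: le_trans N1.
      - by rewrite ler_pM2l.
      - by rewrite ler_pM2l.
    have -> : 2 * (pi / delta / (3 * N%:R)) * (5 * (N%:R * mass2 k M * expR (- (M / 2)))) =
      10 / 3 * (pi / delta * expR (- (M / 2)) * mass2 k M).
      by field; rewrite !lt0r_neq0.
    rewrite (_ : 3 * _ * _ = 3 * (pi / delta * expR (- (M / 2)) * mass2 k M)); last by ring.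
    apply: ler_wpM2r; first exact: mulr_ge0 (mulr_ge0 (ltW pd0) (expR_ge0 _)) ms0.
    by rewrite ler_pdivlMr // -!natrM ler_nat.
  have e2 : expR (- (M / 2)) * mass2 k M <= Q2 * P.
    apply: le_trans NMs; rewrite mulrC ler_wpM2r ?expR_ge0 // ler_peMl //.
  have e3 : (c + kappa - (a - kappa) + 2 / delta) * (K * ell (N%:R * delta) ^+ p) + 1 <=
      2 * c1 * ((5 * Q1 + 1) * 3 * M ^+ (4 * b + 7)).
    rewrite ndE.
    have hE0 : 0 <= K * ell (M ^+ (4 * b + 4)) ^+ p.
      by rewrite mulr_ge0 ?exprn_ge0 ?(ltW (ell_gt0 _)) ?(ltW K0).
    have M3 : 1 <= M ^+ 3 by exact: exprn_ege1.
    apply: (@le_trans _ _ (5 * M ^+ 2 * (Q1 * M) + M ^+ 3)).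
      by apply: lerD => //; apply: ler_pM.
    have -> : 5 * M ^+ 2 * (Q1 * M) + M ^+ 3 = (5 * Q1 + 1) * M ^+ 3 by ring.
    apply: (@le_trans _ _ (2 * (pi / delta / (3 * N%:R)) * ((5 * Q1 + 1) * 3 * M ^+ (4 * b + 7)))); last first.
      rewrite ler_wpM2r //; last by rewrite ler_pM2l.
      by rewrite mulr_ge0 ?exprn_ge0 ?(ltW M0) // mulr_ge0 // addr_ge0 // mulr_ge0 // ltW.
    have -> : 2 * (pi / delta / (3 * N%:R)) * ((5 * Q1 + 1) * 3 * M ^+ (4 * b + 7)) =
       (5 * Q1 + 1) * (2 * pi * M ^+ 3).
      have -> : M ^+ (4 * b + 7) = N%:R * M by rewrite NM n3 exprSr.
      by rewrite pd; field; rewrite lt0r_neq0.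
    rewrite ler_pM2l; last by rewrite addr_gt0 // mulr_gt0.
    by rewrite ler_peMl ?exprn_ge0 ?(ltW M0).
  have c2 : 0 < 2 * c1 by rewrite mulr_gt0.
  rewrite -(ler_pM2l c2); apply: (le_trans hw).
  have QP : 0 <= Q2 * P by rewrite mulr_ge0 // ltW.
  have q2 : 5 * (Q2 * P) <= 5 * Q2 * P * M ^+ (4 * b + 7).
    by rewrite -[5 * Q2 * P]mulrA ler_peMr // mulr_ge0.
  have q3 : Q2 * P <= Q2 * P * M ^+ (4 * b + 7) by rewrite ler_peMr.
  rewrite (_ : 2 * c1 * (SB + _) = 2 * c1 * SB + 2 * c1 * (5 * Q2 * P * M ^+ (4 * b + 7)) +
    2 * c1 * (Q2 * P * M ^+ (4 * b + 7)) +
    2 * c1 * ((5 * Q1 + 1) * 3 * M ^+ (4 * b + 7))); last by ring.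
  apply: lerD e3; apply: lerD.
    by apply: lerD => //; apply: (le_trans e1); rewrite ler_pM2l.
  by rewrite ler_pM2l //; exact: le_trans e2 q3.
exists X0 => X XX; have h0 := hX0 X XX.
have sA : \sum_(n < X) lrho k s n <= mass2 k M.
  apply: le_trans m2M.1; apply: le_trans (sum_rho_le k.+1 X M0).
  by apply: ler_sum => n _; exact: lrho_le.
have sB : \sum_(n < X) rho k s n <= mass2 k M.
  by apply: le_trans m2M.2; exact: sum_rho_le.
have fB : \sum_(n < X | pi / delta - 1 < ln n%:R) rho k s n <= expR (- (M / 2)) * mass2 k M.
  apply: (le_trans (sum_rho_far k _ X M0)); by rewrite ler_pM ?expR_ge0 ?mass_ge0 ?m2M.2 // invr_gt0 mulr_gt0.
have fA : \sum_(n < X | pi / delta - 1 < ln n%:R) lrho k s n <= expR (- (M / 2)) * mass2 k M.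
  apply: (@le_trans _ _ (\sum_(n < X | pi / delta - 1 < ln n%:R) rho k.+1 s n)).
    by apply: ler_sum => n _; exact: lrho_le.
  apply: (le_trans (sum_rho_far k.+1 _ X M0)); by rewrite ler_pM ?expR_ge0 ?mass_ge0 ?m2M.1 // invr_gt0 mulr_gt0.
split; apply: key => //; try exact: lrho_ge0; try exact: rho_ge0.
  apply: le_trans h0; rewrite le_eqVlt; apply/orP; left; apply/eqP; congr (`|_|).
  by apply: eq_bigr => n _; congr (_ * _); rewrite /excess /lrho mulrBl mul1r.
apply: le_trans h0; rewrite -normrN -sumrN le_eqVlt; apply/orP; left; apply/eqP; congr (`|_|).
by apply: eq_bigr => n _; rewrite /excess /lrho; ring.
Qed.

End WindowEstimate.

(** * The prime number theorem with a logarithmic saving *)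

Section PrimeNumberTheorem.
Variable R : realType.

Lemma ler_truncn (x : R) n : 0 <= x -> (n <= Num.truncn x)%N = (n%:R <= x).
Proof. by move=> x0; rewrite truncn_ge_nat. Qed.

Lemma sum_ord_indicator (f : nat -> R) t X : (t < X)%N ->
  \sum_(n < t.+1) f n = \sum_(n < X) (n <= t)%N%:R * f n.
Proof.
move=> tX; rewrite (big_ord_widen X f tX) big_mkcond; apply: eq_bigr => n _.
by rewrite ltnS; case: leqP; rewrite ?mul1r ?mul0r.
Qed.

Lemma sum_window (f : nat -> R) (a c : R) X : 0 <= a -> a <= c ->
  (Num.truncn (expR c) < X)%N ->
  \sum_(n < X | a < ln n%:R <= c) f n =
  \sum_(n < (Num.truncn (expR c)).+1) f n - \sum_(n < (Num.truncn (expR a)).+1) f n.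
Proof.
move=> a0 ac cX; have aX : (Num.truncn (expR a) < X)%N.
  by apply: leq_ltn_trans cX; apply: le_truncn; rewrite ler_expR.
rewrite (sum_ord_indicator f cX) (sum_ord_indicator f aX) -sumrB big_mkcond.
apply: eq_bigr => n _; rewrite !ler_truncn ?expR_ge0 // -mulrBl.
case: (nat_of_ord n) => [|i].
  by rewrite ln0 // ltNge a0 /= !expR_ge0 subrr mul0r.
have i0 : 0 < i.+1%:R :> R by rewrite ltr0n.
have lnE (x : R) : (i.+1%:R <= expR x) = (ln i.+1%:R <= x).
  by rewrite -{1}(@lnK R i.+1%:R) ?posrE // ler_expR.
rewrite !lnE ltNge; have [h1|h1] := lerP (ln i.+1%:R) a => /=.
  by rewrite (le_trans h1 ac) subrr mul0r.
by case: (ln i.+1%:R <= c); rewrite ?subr0 ?mul1r // mul0r.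
Qed.

Definition psi (x : R) : R := \sum_(n < (Num.truncn x).+1) mangoldt R n.

Lemma truncn_bounds (x : R) : 0 <= x -> x - 1 <= (Num.truncn x)%:R <= x.
Proof.
move=> x0; have := truncnS_gt x; rewrite -natr1 => h.
by apply/andP; split; [lra | rewrite truncn_le].
Qed.

Lemma count_window (a c : R) X : 0 <= a -> a <= c -> (Num.truncn (expR c) < X)%N ->
  expR c - expR a - 1 <= \sum_(n < X | a < ln n%:R <= c) (1 : R) <= expR c - expR a + 1.
Proof.
move=> a0 ac cX; rewrite (sum_window (fun=> 1)) // !sumr_const !card_ord.
have /andP[h1 h2] := truncn_bounds (expR_ge0 c).
have /andP[h3 h4] := truncn_bounds (expR_ge0 a).
by rewrite -!natr1; lra.
Qed.

Lemma expR_le_2x (x : R) : 0 <= x <= 2^-1 -> expR x <= 1 + 2 * x.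
Proof.
move=> /andP[x0 x1]; have := expR_ge1Dx (- x); have := expRxMexpNx_1 x.
have := expR_gt0 x; move: (expR x) (expR (- x)) => a b; nra.
Qed.

Lemma near_ratio (x y d : R) : 1 <= y -> 0 <= d -> x - y <= d -> x <= y * expR d.
Proof.
move=> y1 d0 xy; have := expR_ge1Dx d => h.
apply: (@le_trans _ _ (y * (1 + d))); last by rewrite ler_pM2l //; lra.
nra.
Qed.

(** The logarithmic derivative [k / y - s] of [y^k e^(-s y)] is at most [k + 2] in absolute value
    for [y >= 1] and [0 <= s <= 2]. *)
Lemma rho_near k (s y d : R) n : 0 <= s <= 2 -> 0 <= d -> 1 <= y -> 1 <= ln n%:R :> R ->
  `|ln n%:R - y| <= d ->
  rho k s n <= y ^+ k * expR (- s * y) * expR ((k%:R + 2) * d) /\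
  y ^+ k * expR (- s * y) <= rho k s n * expR ((k%:R + 2) * d).
Proof.
move=> /andP[s0 s2] d0 y1 L1; rewrite ler_norml => /andP[h1 h2].
have n0 : (0 < n)%N.
  by move: L1; case: n h1 h2 => // _ _; rewrite ln0 // => /(lt_le_trans ltr01); rewrite ltxx.
have -> : rho k s n = ln n%:R ^+ k * expR (- s * ln n%:R) by rewrite /rho; case: n n0 {h1 h2 L1}.
set L : R := ln n%:R in h1 h2 L1 *.
have key u v : 1 <= u -> 1 <= v -> u - v <= d -> v - u <= d ->
    u ^+ k * expR (- s * u) <= v ^+ k * expR (- s * v) * expR ((k%:R + 2) * d).
  move=> u1 v1 uv vu.
  have e : expR ((k%:R + 2) * d) = expR d ^+ k * expR (2 * d).
    by rewrite -expRM_natl -expRD; congr expR; ring.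
  rewrite e mulrACA ler_pM ?exprn_ge0 ?expR_ge0 //; first by lra.
    rewrite -exprMn lerXn2r ?nnegrE ?mulr_ge0 ?expR_ge0 //; try lra.
    exact: near_ratio.
  rewrite -expRD ler_expR; nra.
by split; apply: key => //; lra.
Qed.

(** Arithmetic of [psi_window_upper] with the exponentials replaced by variables under linear
    bounds: [Y = e^y], [eh = e^h], [e1 = e^(c h)], [e2 = e1^2], [k1] and [k2] are [e^(3 h^2)] and
    its inverse, and [W] counts the integers of the widened window. *)
Lemma window_upper_arith (c h Y W eh e1 e2 k1 k2 Q1 Q2 : R) :
  0 < c -> 0 < h -> 0 < Y -> 0 < Q1 -> 0 <= W -> c * h <= 4^-1 -> h <= 32^-1 ->
  1 <= Q2 * Y * h ^+ 2 -> 1 + h <= eh -> eh <= 1 + 2 * h -> e1 <= 2 -> 0 <= e2 ->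
  e2 <= 1 + 2 * (2 * (c * h)) -> k1 <= 1 + 6 * h ^+ 2 -> 1 - 3 * h ^+ 2 <= k2 ->
  W <= Y * eh * k1 - Y * k2 + 1 ->
  e2 * W + e1 * (Q1 * Y * h ^+ 2) <=
  Y * (eh - 1) + (8 * c + 40 + 4 * Q1 + 4 * Q2) * Y * h ^+ 2.
Proof.
move=> c0 h0 Y0 Q10 W0 ch h32 one eh1 eh2 e1h e20 e2h k1h k2h hW.
have v0 : 0 < Y * h ^+ 2 by rewrite mulr_gt0 ?exprn_gt0.
have hh0 : 0 < h ^+ 2 by rewrite exprn_gt0.
have w1 : eh * k1 - k2 <= eh - 1 + 15 * h ^+ 2.
  have : eh * k1 <= eh * (1 + 6 * h ^+ 2) by rewrite ler_pM2l //; lra.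
  have : eh * (6 * h ^+ 2) <= 2 * (6 * h ^+ 2) by rewrite ler_pM2r ?mulr_gt0 //; lra.
  by rewrite mulrDr mulr1; lra.
have W1 : W <= Y * (eh - 1) + 15 * (Y * h ^+ 2) + 1.
  apply: (le_trans hW); have := ler_wpM2l (ltW Y0) w1; rewrite mulrBr mulrDr !mulrA; lra.
have W2 : W <= 2 * (Y * h) + 15 * (Y * h ^+ 2) + 1.
  apply: (le_trans W1); have : Y * (eh - 1) <= Y * (2 * h) by rewrite ler_pM2l //; lra.
  lra.
have t0 : 0 < c * h by rewrite mulr_gt0.
have e2W : e2 * W <= W + 4 * (c * h) * W.
  have := ler_wpM2r W0 e2h; lra.
have t1 : 4 * (c * h) * W <= 4 * (c * h) * (2 * (Y * h)) + 15 * (Y * h ^+ 2) + 1.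
  have := ler_wpM2l (ltW t0) W2.
  have : (c * h) * (15 * (Y * h ^+ 2) + 1) <= 4^-1 * (15 * (Y * h ^+ 2) + 1).
    by rewrite ler_wpM2r //; lra.
  lra.
have t2 : 4 * (c * h) * (2 * (Y * h)) = 8 * c * (Y * h ^+ 2) by ring.
have t3 : e1 * (Q1 * Y * h ^+ 2) <= 2 * (Q1 * (Y * h ^+ 2)).
  by rewrite -mulrA ler_wpM2r // mulr_ge0 ?ltW.
rewrite -[Q2 * Y * _]mulrA in one.
have : 0 < Q1 * (Y * h ^+ 2) by rewrite mulr_gt0.
rewrite -[(_ + _) * Y * _]mulrA; lra.
Qed.

Lemma window_lower_arith (c h Y W S eh e1 e2 k1 k2 Q1 Q2 : R) :
  0 < c -> 0 < h -> 0 < Y -> 0 < Q1 -> 0 <= W -> 0 <= S -> c * h <= 4^-1 -> h <= 32^-1 ->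
  1 <= Q2 * Y * h ^+ 2 -> 1 + h <= eh -> eh <= 1 + 2 * h -> e1 <= 2 -> 1 <= e2 ->
  e2 <= 1 + 2 * (2 * (c * h)) -> k1 <= 1 + 6 * h ^+ 2 -> 1 - 3 * h ^+ 2 <= k2 ->
  Y * eh * k2 - Y * k1 - 1 <= W ->
  W <= e2 * S + e1 * (Q1 * Y * h ^+ 2) ->
  Y * (eh - 1) - (8 * c + 40 + 4 * Q1 + 4 * Q2) * Y * h ^+ 2 <= S.
Proof.
move=> c0 h0 Y0 Q10 W0 S0 ch h32 one eh1 eh2 e1h e21 e2h k1h k2h hW hS.
have v0 : 0 < Y * h ^+ 2 by rewrite mulr_gt0 ?exprn_gt0.
have hh0 : 0 < h ^+ 2 by rewrite exprn_gt0.
have w1 : eh - 1 - 12 * h ^+ 2 <= eh * k2 - k1.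
  have : eh * (1 - 3 * h ^+ 2) <= eh * k2 by rewrite ler_pM2l //; lra.
  have : eh * (3 * h ^+ 2) <= 2 * (3 * h ^+ 2) by rewrite ler_pM2r ?mulr_gt0 //; lra.
  by rewrite mulrBr mulr1; lra.
have W1 : Y * (eh - 1) - 12 * (Y * h ^+ 2) - 1 <= W.
  apply: le_trans hW; have := ler_wpM2l (ltW Y0) w1; rewrite [Y * (eh * k2 - k1)]mulrBr mulrBr !mulrA; lra.
have t3 : e1 * (Q1 * Y * h ^+ 2) <= 2 * (Q1 * (Y * h ^+ 2)).
  by rewrite -mulrA ler_wpM2r // mulr_ge0 ?ltW.
rewrite -[Q2 * Y * _]mulrA in one.
have q0 : 0 < Q1 * (Y * h ^+ 2) by rewrite mulr_gt0.
have t0 : 0 < c * h by rewrite mulr_gt0.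
have e2S : e2 * S <= S + 4 * (c * h) * S.
  have := ler_wpM2r S0 e2h; lra.
have A0 : Y * (eh - 1) <= 2 * (Y * h).
  have : Y * (eh - 1) <= Y * (2 * h) by rewrite ler_pM2l //; lra.
  lra.
have t2 : 4 * (c * h) * (2 * (Y * h)) = 8 * c * (Y * h ^+ 2) by ring.
rewrite -[(_ + _) * Y * _]mulrA.
(* If [S] already exceeds [Y (e^h - 1)] there is nothing to prove. *)
have [big|small] := lerP (Y * (eh - 1)) S.
  have : 0 < (8 * c + 40 + 4 * Q1 + 4 * Q2) * (Y * h ^+ 2); last by lra.
  rewrite mulr_gt0 //; have : 0 < Q2 by have := lt_le_trans ltr01 one; rewrite pmulr_lgt0.
  lra.
have : 4 * (c * h) * S <= 4 * (c * h) * (2 * (Y * h)).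
  by rewrite ler_wpM2l //; lra.
have : 0 < c * (Y * h ^+ 2) by rewrite mulr_gt0.
lra.
Qed.

Lemma psi_window (y h : R) X : 0 <= y -> 0 <= h -> (Num.truncn (expR (y + h)) < X)%N ->
  psi (expR (y + h)) - psi (expR y) = \sum_(n < X | y < ln n%:R <= y + h) mangoldt R n.
Proof. by move=> y0 h0 hX; rewrite sum_window // lerDl. Qed.

Lemma window_constants (c h : R) : 0 < c -> 0 < h -> c * h <= 4^-1 -> h <= 32^-1 ->
  [/\ expR (c * h) * expR (c * h) <= 1 + 2 * (2 * (c * h)), expR (c * h) <= 2,
      1 + h <= expR h <= 1 + 2 * h,
      expR (3 * h ^+ 2) <= 1 + 6 * h ^+ 2 & 1 - 3 * h ^+ 2 <= expR (- (3 * h ^+ 2))].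
Proof.
move=> c0 h0 ch h32; have t0 : 0 < c * h by rewrite mulr_gt0.
have hh0 : 0 < h ^+ 2 by rewrite exprn_gt0.
have hh : h ^+ 2 <= 32^-1 * h by rewrite expr2 ler_pM2r.
split.
- have -> : expR (c * h) * expR (c * h) = expR (2 * (c * h)).
    by rewrite -expRD; congr expR; ring.
  by apply: expR_le_2x; apply/andP; split; lra.
- by have := @expR_le_2x (c * h) ltac:(apply/andP; split; lra); lra.
- by rewrite expR_ge1Dx expR_le_2x //; apply/andP; split; lra.
- by have := @expR_le_2x (3 * h ^+ 2) ltac:(apply/andP; split; lra); lra.
- by have := expR_ge1Dx (- (3 * h ^+ 2)); lra.
Qed.

(** Replacing the weight by its value [r0] at [y], once for [Lambda] and once for 1, costs a
    relative error [O(c h)] on a mass [O(h e^y)]. With [kappa = h^2] the boundary strips cost the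
    same order [h^2 e^y]. *)
Lemma psi_window_upper k (s c h y r0 E Q1 Q2 : R) X :
  0 < c -> 0 < h -> c * h <= 4^-1 -> h <= 32^-1 -> 16 <= y -> 0 < r0 -> 0 < Q1 ->
  E <= Q1 * expR y * h ^+ 2 * r0 -> 1 <= Q2 * expR y * h ^+ 2 ->
  (forall n, y - 4 * h <= ln n%:R <= y + 4 * h ->
    rho k s n <= r0 * expR (c * h) /\ r0 <= rho k s n * expR (c * h)) ->
  (Num.truncn (expR (y + h + 3 * h ^+ 2)) < X)%N ->
  \sum_(n < X | y <= ln n%:R <= y + h) lrho k s n <=
    \sum_(n < X | y - 3 * h ^+ 2 < ln n%:R <= y + h + 3 * h ^+ 2) rho k s n + E ->
  psi (expR (y + h)) - psi (expR y) <=
    expR y * (expR h - 1) + (8 * c + 40 + 4 * Q1 + 4 * Q2) * expR y * h ^+ 2.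
Proof.
move=> c0 h0 ch h8 y16 r00 Q10 Er one rho_n X1 hE.
have kp : 0 < h ^+ 2 by rewrite exprn_gt0.
have kh : h ^+ 2 <= 32^-1 * h by rewrite expr2 ler_pM2r.
have [w1 w2 w3] : [/\ 0 <= y, 0 <= y - 3 * h ^+ 2 & y - 3 * h ^+ 2 <= y + h + 3 * h ^+ 2].
  by split; lra.
have near w : y - 3 * h ^+ 2 <= w -> w <= y + h + 3 * h ^+ 2 -> y - 4 * h <= w <= y + 4 * h.
  by move=> v1 v2; apply/andP; split; lra.
have lo w : y < w -> y - 3 * h ^+ 2 <= w by lra.
have hi w : w <= y + h -> w <= y + h + 3 * h ^+ 2 by lra.
have X2 : (Num.truncn (expR (y + h)) < X)%N.
  by apply: leq_ltn_trans X1; apply: le_truncn; rewrite ler_expR hi.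
rewrite (psi_window w1 (ltW h0) X2).
have [g1 g2 /andP[g3 g4] g5 g6] := window_constants c0 h0 ch h8.
have /andP[_ hW] := count_window w2 w3 X1.
set W := \sum_(n < X | y - 3 * h ^+ 2 < ln n%:R <= y + h + 3 * h ^+ 2) (1 : R) in hW *.
set S := \sum_(n < X | _) mangoldt R n.
have q1 : r0 * S <= expR (c * h) * (\sum_(n < X | y <= ln n%:R <= y + h) lrho k s n).
  rewrite mulr_sumr mulr_sumr big_mkcond [leRHS]big_mkcond; apply: ler_sum => n _.
  case: ifP => [/andP[v1 v2]|_]; last first.
    by case: ifP => // _; rewrite mulr_ge0 ?expR_ge0 ?lrho_ge0.
  rewrite (ltW v1) v2 /= /lrho mulrCA mulrC ler_wpM2l ?mangoldt_ge0 // mulrC.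
  by apply: (rho_n n _).2; apply: near; [exact: lo | exact: hi].
have q2 : \sum_(n < X | y - 3 * h ^+ 2 < ln n%:R <= y + h + 3 * h ^+ 2) rho k s n <=
    r0 * expR (c * h) * W.
  rewrite /W mulr_sumr; apply: ler_sum => n /andP[v1 v2]; rewrite mulr1.
  by apply: (rho_n n _).1; apply: near => //; exact: ltW.
have q3 : r0 * S <= r0 * (expR (c * h) * expR (c * h) * W + expR (c * h) * (Q1 * expR y * h ^+ 2)).
  apply: (le_trans q1).
  have -> : r0 * (expR (c * h) * expR (c * h) * W + expR (c * h) * (Q1 * expR y * h ^+ 2)) =
    expR (c * h) * (r0 * expR (c * h) * W + Q1 * expR y * h ^+ 2 * r0) by ring.
  by rewrite ler_pM2l ?expR_gt0 //; apply: (le_trans hE); exact: lerD.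
rewrite ler_pM2l // in q3; apply: (le_trans q3).
apply: (@window_upper_arith c h (expR y) W (expR h) _ _ (expR (3 * h ^+ 2)) (expR (- (3 * h ^+ 2)))) => //.
- exact: expR_gt0.
- exact: sumr_ge0.
- by apply: (le_trans hW); rewrite !expRD.
Qed.

(** The window for 1 is first shrunk by [3 h^2] at both ends, so that the widening in [window_est]
    brings it back to [(y, y + h]]. *)
Lemma psi_window_lower k (s c h y r0 E Q1 Q2 : R) X :
  0 < c -> 0 < h -> c * h <= 4^-1 -> h <= 32^-1 -> 16 <= y -> 0 < r0 -> 0 < Q1 ->
  E <= Q1 * expR y * h ^+ 2 * r0 -> 1 <= Q2 * expR y * h ^+ 2 ->
  (forall n, y - 4 * h <= ln n%:R <= y + 4 * h ->
    rho k s n <= r0 * expR (c * h) /\ r0 <= rho k s n * expR (c * h)) ->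
  (Num.truncn (expR (y + h)) < X)%N ->
  \sum_(n < X | y + 3 * h ^+ 2 <= ln n%:R <= y + h - 3 * h ^+ 2) rho k s n <=
    \sum_(n < X | y < ln n%:R <= y + h) lrho k s n + E ->
  expR y * (expR h - 1) - (8 * c + 40 + 4 * Q1 + 4 * Q2) * expR y * h ^+ 2 <=
    psi (expR (y + h)) - psi (expR y).
Proof.
move=> c0 h0 ch h8 y16 r00 Q10 Er one rho_n X2 hE.
have kp : 0 < h ^+ 2 by rewrite exprn_gt0.
have kh : h ^+ 2 <= 32^-1 * h by rewrite expr2 ler_pM2r.
have [w1 w2 w3] : [/\ 0 <= y, 0 <= y + 3 * h ^+ 2 & y + 3 * h ^+ 2 <= y + h - 3 * h ^+ 2].
  by split; lra.
have near w : y < w -> w <= y + h -> y - 4 * h <= w <= y + 4 * h.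
  by move=> v1 v2; apply/andP; split; lra.
have lo w : y + 3 * h ^+ 2 < w -> y < w by lra.
have hi w : w <= y + h - 3 * h ^+ 2 -> w <= y + h by lra.
have X1 : (Num.truncn (expR (y + h - 3 * h ^+ 2)) < X)%N.
  by apply: leq_ltn_trans X2; apply: le_truncn; rewrite ler_expR hi.
rewrite (psi_window w1 (ltW h0) X2).
have [g1 g2 /andP[g3 g4] g5 g6] := window_constants c0 h0 ch h8.
have /andP[hW _] := count_window w2 w3 X1.
set W := \sum_(n < X | y + 3 * h ^+ 2 < ln n%:R <= y + h - 3 * h ^+ 2) (1 : R) in hW *.
set S := \sum_(n < X | _) mangoldt R n.
have q1 : r0 * W <= expR (c * h) * (\sum_(n < X | y + 3 * h ^+ 2 <= ln n%:R <= y + h - 3 * h ^+ 2) rho k s n).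
  rewrite mulr_sumr mulr_sumr big_mkcond [leRHS]big_mkcond; apply: ler_sum => n _.
  case: ifP => [/andP[v1 v2]|_]; last first.
    by case: ifP => // _; rewrite mulr_ge0 ?expR_ge0 ?rho_ge0.
  rewrite (ltW v1) v2 /= mulr1 mulrC.
  by apply: (rho_n n _).2; apply: near; [exact: lo | exact: hi].
have q2 : \sum_(n < X | y < ln n%:R <= y + h) lrho k s n <= r0 * expR (c * h) * S.
  rewrite /S mulr_sumr; apply: ler_sum => n /andP[v1 v2].
  rewrite /lrho mulrC ler_wpM2r ?mangoldt_ge0 //.
  by apply: (rho_n n _).1; exact: near.
have q3 : r0 * W <= r0 * (expR (c * h) * expR (c * h) * S + expR (c * h) * (Q1 * expR y * h ^+ 2)).
  apply: (le_trans q1).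
  have -> : r0 * (expR (c * h) * expR (c * h) * S + expR (c * h) * (Q1 * expR y * h ^+ 2)) =
    expR (c * h) * (r0 * expR (c * h) * S + Q1 * expR y * h ^+ 2 * r0) by ring.
  by rewrite ler_pM2l ?expR_gt0 //; apply: (le_trans hE); exact: lerD.
rewrite ler_pM2l // in q3.
apply: (@window_lower_arith c h (expR y) W S (expR h) _ _ (expR (3 * h ^+ 2)) (expR (- (3 * h ^+ 2)))) q3 => //.
- exact: expR_gt0.
- exact: sumr_ge0.
- by apply: sumr_ge0 => n _; exact: mangoldt_ge0.
- by rewrite -expRD -[leLHS]expR0 ler_expR addr_ge0 // mulr_ge0 ?ltW.
- by apply: le_trans hW; rewrite !expRD.
Qed.

(* With [k = 6b + 7] the weight [ln n ^ k], of order [M ^ k] on the window,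
   exceeds the error [M ^ (4b + 7)] of [window_est] by the factor [h ^ -2]. *)
Lemma local_psi b : (0 < b)%N -> exists2 Q : R, 0 < Q & exists m0 : nat,
  forall m, (m0 <= m)%N -> let M : R := m%:R in let h := M ^- b in
  forall y : R, M / 2 <= y <= M ->
  `|psi (expR (y + h)) - psi (expR y) - expR y * (expR h - 1)| <= Q * expR y * h ^+ 2.
Proof.
move=> b0; pose k := (6 * b + 7)%N.
have kEq : (4 * b + 7 + 2 * b = k)%N by rewrite /k; lia.
have [Q0 Q00 [m1 hw]] := window_est R b k.
(* From [rho_near] at distance [d = 4 h], which covers the widened windows. *)
pose c : R := 4 * (k%:R + 2).
have c0 : 0 < c by rewrite mulr_gt0 // ltr_wpDl // ler0n.
have c8 : 8 <= c by rewrite /c; have := ler0n R k; lra.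
pose Q1 := Q0 * (expR 1 * 2 ^+ k).
pose Q2 : R := (2 * b)`!%:R * 2 ^+ (2 * b).
have Q10 : 0 < Q1 by rewrite !mulr_gt0 ?expR_gt0 // exprn_gt0.
have Q20 : 0 < Q2 by rewrite mulr_gt0 ?exprn_gt0 // ltr0n fact_gt0.
exists (8 * c + 40 + 4 * Q1 + 4 * Q2); first by rewrite !addr_gt0 // mulr_gt0.
have [m2 hm2] := nat_above (4 * c).
exists (maxn m1 m2) => m; rewrite geq_max => /andP[mm1 /hm2 mc] M h y /andP[yM1 yM].
move: hw => /(_ m mm1) /= hw; rewrite -/M in hw mc; clearbody M.
have kE : M ^- (2 * b) = h ^+ 2 by rewrite /h exprVn -exprM mulnC.
rewrite kE in hw.
have [M32 M0] : 32 <= M /\ 0 < M by split; lra.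
have h0 : 0 < h by rewrite invr_gt0 exprn_gt0.
have hM : h <= M^-1.
  by rewrite lef_pV2 ?posrE ?exprn_gt0 // -[leLHS]expr1 ler_weXn2l //; lra.
have ch : c * h <= 4^-1.
  apply: (@le_trans _ _ (c * M^-1)); first by rewrite ler_pM2l.
  by rewrite ler_pdivrMr //; lra.
have h8 : h <= 32^-1 by apply: (le_trans hM); rewrite lef_pV2 ?posrE.
pose s : R := 1 + M^-1.
have s02 : 0 <= s <= 2.
  have Mi : 0 < M^-1 by rewrite invr_gt0.
  have Mi1 : M^-1 <= 1 by rewrite invf_le1 //; lra.
  by rewrite /s; apply/andP; split; lra.
have [y0 y16] : 0 < y /\ 16 <= y by split; lra.
pose r0 := y ^+ k * expR (- s * y).
have r00 : 0 < r0 by rewrite mulr_gt0 ?expR_gt0 // exprn_gt0.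
(* [M^(4b+7) = M^k h^2] and [M <= 2 y], which explains [2 ^ k]; moreover [e^y e^(-s y) = e^(-y/M)]
   is at least [1/e], which explains [expR 1]. *)
have Er : Q0 * M ^+ (4 * b + 7) <= Q1 * expR y * h ^+ 2 * r0.
  have -> : Q1 * expR y * h ^+ 2 * r0 = Q0 * ((2 ^+ k * (y ^+ k * h ^+ 2)) * (expR 1 * (expR y * expR (- s * y)))).
    by rewrite /Q1 /r0; ring.
  rewrite ler_pM2l // -[leLHS]mulr1; apply: ler_pM => //; first by rewrite exprn_ge0 // ltW.
    rewrite mulrA -exprMn -kE ler_pdivlMr ?exprn_gt0 // -exprD.
    by rewrite kEq lerXn2r ?nnegrE ?(ltW M0) ?mulr_ge0 ?(ltW y0) //; lra.
  rewrite -!expRD -[leLHS]expR0 ler_expR /s.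
  have : M^-1 * y <= 1 by rewrite ler_pdivrMl // mulr1.
  lra.
have one : 1 <= Q2 * expR y * h ^+ 2.
  have := @expo_beats_power R (2 * b) M (ltW M0); rewrite -/Q2 => h1.
  have e1 : expR (- (M / 2)) * expR y >= 1 by rewrite -expRD -[leLHS]expR0 ler_expR; lra.
  rewrite -kE ler_pdivlMr ?exprn_gt0 // mul1r.
  apply: (@le_trans _ _ (M ^+ (2 * b) * (expR (- (M / 2)) * expR y))).
    by rewrite ler_peMr // exprn_ge0 // ltW.
  by rewrite mulrA ler_pM2r ?expR_gt0.
have rho_n n : (y - 4 * h <= ln n%:R <= y + 4 * h) ->
    rho k s n <= r0 * expR (c * h) /\ r0 <= rho k s n * expR (c * h).
  move=> /andP[q1 q2]; have -> : c * h = (k%:R + 2) * (4 * h) by rewrite /c; ring.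
  have [z1 z2 z3] : [/\ 0 <= 4 * h, 1 <= y & 1 <= ln (n%:R : R)] by split; lra.
  apply: rho_near => //; rewrite ler_norml; apply/andP; split; lra.
have ord (q : R) : 0 < q -> q <= 32^-1 * h ->
    [/\ 0 <= y, y <= y + h, y + h <= y + 1 & y + h <= M + 1] /\
    [/\ 0 <= y + 3 * q, y + 3 * q <= y + h - 3 * q, y + h - 3 * q <= y + 3 * q + 1 &
        y + h - 3 * q <= M + 1].
  by move: h0 h8 y16 yM; clear; move: h => h *; split; split; lra.
have hh0 : 0 < h ^+ 2 by rewrite exprn_gt0.
have hh : h ^+ 2 <= 32^-1 * h by rewrite expr2 ler_pM2r.
have [[p1 p2 p3 p4] [p5 p6 p7 p8]] := ord (h ^+ 2) hh0 hh.
have [X0 hX0] := hw y (y + h) p1 p2 p3 p4.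
have [X0' hX0'] := hw (y + 3 * h ^+ 2) (y + h - 3 * h ^+ 2) p5 p6 p7 p8.
have up := psi_window_upper c0 h0 ch h8 y16 r00 Q10 Er one rho_n
  (leq_maxr X0 _) (hX0 _ (leq_maxl X0 _)).1.
have lo := (hX0' _ (leq_maxl X0' (Num.truncn (expR (y + h))).+1)).2.
rewrite addrK subrK in lo.
have {}lo := psi_window_lower c0 h0 ch h8 y16 r00 Q10 Er one rho_n (leq_maxr X0' _) lo.
by rewrite ler_distl lo up.
Qed.

End PrimeNumberTheorem.

Section PrimeNumberTheoremGlobal.
Variable R : realType.

Lemma psi_crude (Y : R) : 0 <= Y -> `|psi (expR Y) - expR Y| <= expR Y * (2 * Y + 1).
Proof.
move=> Y0; have e1 : 1 <= expR Y by rewrite -[leLHS]expR0 ler_expR.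
have p0 : 0 <= psi (expR Y) by apply: sumr_ge0 => n _; exact: mangoldt_ge0.
have p1 : psi (expR Y) <= (expR Y + 1) * Y.
  apply: (@le_trans _ _ (\sum_(n < (Num.truncn (expR Y)).+1) Y)).
    apply: ler_sum => -[[|n] hn] _ /=; first by rewrite (le_trans (mangoldt_le_ln _ _)) // ln0.
    apply: (le_trans (mangoldt_le_ln _ _)).
    rewrite ltnS ler_truncn ?expR_ge0 // in hn.
    by rewrite -ler_expR lnK // posrE ltr0n.
  rewrite sumr_const card_ord -mulr_natl ler_wpM2r // -natr1 lerD2r.
  by rewrite truncn_le // expR_ge0.
have : Y <= expR Y * Y by rewrite ler_peMl.
rewrite ler_norml => hY; apply/andP; split; lra.
Qed.

(* Chains windows of length [h] up from [M / 2]; the errors [Q * e^y * h^2] form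
   a geometric series of sum [O(h * e^Y)]. *)
Lemma psi_asymptotics b : (0 < b)%N -> exists2 C : R, 0 < C & exists m0 : nat,
  forall m, (m0 <= m)%N -> forall Y : R, 0 <= Y <= m%:R ->
  `|psi (expR Y) - expR Y| <= C * m%:R ^- b * expR m%:R.
Proof.
move=> b0; have [Q Q0 [m1 hloc]] := local_psi R b0.
pose C0 : R := 2 * expR 1 * ((b.+1)`!%:R * 2 ^+ b.+1).
have C00 : 0 < C0 by rewrite !mulr_gt0 ?expR_gt0 ?ltr0n ?fact_gt0 // exprn_gt0.
exists (C0 + 2 * Q); first by rewrite addr_gt0 // mulr_gt0.
exists (maxn m1 3) => m; rewrite geq_max => /andP[mm1 m3] Y /andP[Y0 YM].
have [j hj] := nat_above (m%:R * m%:R ^+ b : R).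
have M3 : 3 <= m%:R :> R by rewrite ler_nat.
have := hloc m mm1; move: (m%:R : R) M3 YM hj => M M3 YM hj /=.
set h := M ^- b => hl.
have M0 : 0 < M by lra.
have h0 : 0 < h by rewrite invr_gt0 exprn_gt0.
have h1 : h <= 1 by rewrite invf_le1 ?exprn_gt0 // exprn_ege1 //; lra.
pose F (y : R) := psi (expR y) - expR y.
(* Here the trivial bound suffices, since [e^(M/2)] falls short of [e^M] by more than any power of
   [M]. *)
have base y : 0 <= y -> y <= M / 2 + 1 -> `|F y| <= C0 * h * expR M.
  move=> y0 yM; apply: (le_trans (psi_crude y0)).
  have eb := @expo_beats_power R b.+1 M (ltW M0).
  apply: (@le_trans _ _ (expR (M / 2 + 1) * (2 * M))).
    by rewrite ler_pM ?expR_ge0 ?ler_expR //; lra.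
  have e1 : expR (M / 2 + 1) = expR 1 * expR (- (M / 2)) * expR M.
    by rewrite -!expRD; congr expR; field.
  have -> : expR (M / 2 + 1) * (2 * M) = 2 * expR 1 * (M ^+ b.+1 * expR (- (M / 2))) * h * expR M.
    rewrite e1 /h exprS; field; rewrite expf_neq0 //; exact: lt0r_neq0.
  by rewrite ler_pM2r ?expR_gt0 // ler_pM2r // ler_pM2l // mulr_gt0 ?expR_gt0.
have step i : forall y, 0 <= y -> y <= M -> y <= M / 2 + 1 + i%:R * h ->
    `|F y| <= C0 * h * expR M + 2 * Q * h * expR y.
  elim: i => [|i IH] y y0 yM yi.
    rewrite mul0r addr0 in yi; apply: (le_trans (base y y0 yi)).
    by rewrite lerDl !mulr_ge0 ?expR_ge0 ?(ltW Q0) ?(ltW h0).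
  have [ys|yl] := lerP y (M / 2 + 1); first by apply: IH => //; have := ler0n R i; nra.
  have yi' : y - h <= M / 2 + 1 + i%:R * h.
    by move: yi; rewrite -(natr1 i) mulrDl mul1r; lra.
  have IHy := IH (y - h) ltac:(lra) ltac:(lra) yi'.
  have := hl (y - h) ltac:(apply/andP; split; lra).
  rewrite subrK => lo.
  have e1 : F y = F (y - h) + (psi (expR y) - psi (expR (y - h)) - expR (y - h) * (expR h - 1)).
    by rewrite /F mulrBr mulr1 -expRD subrK; ring.
  have e2 : expR y = expR (y - h) * expR h by rewrite -expRD subrK.
  rewrite e1; apply: (le_trans (ler_normD _ _)); apply: (le_trans (lerD IHy lo)).
  rewrite -addrA lerD2l e2.
  have -> : 2 * Q * h * expR (y - h) + Q * expR (y - h) * h ^+ 2 =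
    Q * h * expR (y - h) * (2 + h) by ring.
  have -> : 2 * Q * h * (expR (y - h) * expR h) = Q * h * expR (y - h) * (2 * expR h) by ring.
  rewrite ler_pM2l ?mulr_gt0 ?expR_gt0 //; have := expR_ge1Dx h; lra.
have jh : M <= j%:R * h by rewrite ler_pdivlMr ?exprn_gt0 // hj.
apply: (le_trans (step j Y Y0 YM _)); first by lra.
have -> : (C0 + 2 * Q) * h * expR M = C0 * h * expR M + 2 * Q * h * expR M by ring.
by rewrite lerD2l ler_wpM2l ?ler_expR // !mulr_ge0 ?(ltW Q0) ?(ltW h0).
Qed.

End PrimeNumberTheoremGlobal.

(** * From the von Mangoldt function to counts of primes *)

Section PrimesInWindows.
Variable R : realType.
Local Notation Lam := (mangoldt R).

Lemma sum_pos_le n t : (\sum_(i < n) (0 < i <= t) <= minn n.-1 t)%N.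
Proof.
elim: n => [|n IH]; first by rewrite big_ord0.
rewrite big_ord_recr /= (leq_trans (leq_add IH (leqnn _))) //.
by case: n {IH} => [|n] /=; rewrite ?min0n //; case: leqP => /=; lia.
Qed.

Lemma sum_pow_le p N : prime p -> (0 < N)%N ->
  \sum_(2 <= a < N.+1) (p ^ a <= N)%N%:R * ln p%:R <= (p ^ 2 <= N)%N%:R * ln N%:R :> R.
Proof.
move=> pp N0; have p1 := prime_gt1 pp.
case: leqP => [p2|p2]; last first.
  rewrite mul0r big_nat big1 // => a /andP[a2 _].
  by rewrite leqNgt (leq_trans p2) ?mul0r // leq_exp2l.
rewrite mul1r -big_distrl /=.
apply: (@le_trans _ _ ((trunc_log p N)%:R * ln p%:R)).
  rewrite ler_wpM2r ?ln_nat_ge0 // -natr_sum ler_nat.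
  rewrite (eq_big_nat _ _ (F2 := fun a => nat_of_bool (a <= trunc_log p N)%N)); last first.
    move=> a _; congr nat_of_bool; apply/idP/idP => [|h]; first exact: trunc_log_max.
    by apply: leq_trans (trunc_logP p1 N0); rewrite leq_exp2l.
  rewrite big_geq_mkord big_mkcond.
  apply: leq_trans (geq_minr N.+1.-1 (trunc_log p N)); apply: leq_trans (sum_pos_le N.+1 _).
  by apply: leq_sum => a _; case: ifP => // /ltnW ->.
rewrite mulr_natl -lnXn ?ltr0n ?(ltnW p1) // -natrX ler_ln_pos ?ltr0n ?expn_gt0 ?(ltnW p1) //.
by rewrite ler_nat trunc_logP.
Qed.

(** Only the primes [p <= sqrt N] have higher powers up to [N], and those of one prime weigh at most
    [floor (log_p N) * ln p <= ln N] in total. *)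
Lemma sum_mangoldt_nonprime N : (0 < N)%N ->
  \sum_(n < N.+1 | ~~ prime n) Lam n <= Num.sqrt N%:R * ln N%:R.
Proof.
move=> N0.
have widen (n : 'I_N.+1) : ~~ prime n ->
    Lam n = \sum_(p < N.+1 | prime p) \sum_(2 <= a < N.+1) (p ^ a == n)%N%:R * ln p%:R.
  move=> npr; rewrite (mangoldt_widen R (_ : n <= N)%N); last by rewrite -ltnS.
  apply: eq_bigr => p pp; rewrite big_ltn ?ltnS // expn1.
  by rewrite (_ : (nat_of_ord p == n) = false) ?mul0r ?add0r //; apply: contraNF npr => /eqP <-.
rewrite (eq_bigr _ widen) exchange_big /=.
apply: (@le_trans _ _ (\sum_(p < N.+1 | prime p) (p ^ 2 <= N)%N%:R * ln N%:R)).
  apply: ler_sum => p pp; apply: le_trans (sum_pow_le pp N0).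
  rewrite exchange_big /=; apply: ler_sum => a _.
  rewrite -big_distrl /= ler_wpM2r ?ln_nat_ge0 //.
  have [pN|pN] := leqP (p ^ a)%N N; last first.
    rewrite big1 // => n _; rewrite (_ : (_ == _) = false) //.
    by apply: contraTF pN => /eqP ->; rewrite -leqNgt -ltnS.
  rewrite big_mkcond /= (bigD1 (Ordinal (pN : (p ^ a < N.+1)%N))) //= eqxx big1 ?addr0.
    by case: ifP.
  move=> n; rewrite -val_eqE /= eq_sym => /negbTE ->; by case: ifP.
rewrite -big_distrl /= ler_wpM2r ?ln_nat_ge0 //.
set t := Num.truncn (Num.sqrt N%:R : R).
have tE p : (p ^ 2 <= N)%N = (p <= t)%N.
  rewrite ler_truncn ?sqrtr_ge0 // -(ler_nat R) natrX -[p%:R in RHS]ger0_norm ?ler0n // -sqrtr_sqr.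
  by rewrite ler_psqrt ?nnegrE ?exprn_ge0.
apply: (@le_trans _ _ t%:R); last by rewrite truncn_le ?sqrtr_ge0.
rewrite -natr_sum ler_nat.
apply: (@leq_trans (\sum_(p < N.+1) (0 < p <= t)%N)).
  rewrite big_mkcond; apply: leq_sum => p _; case: ifP => // pp.
  by rewrite tE prime_gt0.
by apply: leq_trans (sum_pos_le _ _) _; exact: geq_minr.
Qed.

(** The error is measured at [X] and not at [N], so both ends of a window obey one bound even when
    its lower end is small. *)
Lemma psi_nat : exists2 C : R, 0 < C & exists2 x0 : R, 1 <= x0 &
  forall X : R, x0 <= ln X -> 0 < X -> forall N : nat, N%:R <= X ->
  `|\sum_(n < N.+1) Lam n - N%:R| <= C * X * (ln X) ^- 5.
Proof.
have [C C0 [m0 hp]] := @psi_asymptotics R 5 isT.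
exists (C * expR 1); first by rewrite mulr_gt0 ?expR_gt0.
exists (1 + m0%:R); first by rewrite lerDl.
move=> X hX X0 N NX; set L := ln X in hX *.
have L1 : 1 <= L by have := ler0n R m0; lra.
have L0 : 0 < L by lra.
have b0 : 0 <= C * expR 1 * X * L ^- 5.
  by rewrite !mulr_ge0 ?expR_ge0 ?(ltW C0) ?(ltW X0) // invr_ge0 exprn_ge0 // ltW.
case: N NX => [|N] NX; first by rewrite big_ord_recl big_ord0 mangoldt0 !subr0 addr0 normr0.
(* [psi_asymptotics] lives at integer scales; rounding [ln X] up costs the factor [expR 1]. *)
pose m := (Num.truncn L).+1.
have mL : L <= m%:R by rewrite ltW // truncnS_gt.
have mL1 : m%:R <= L + 1 by rewrite -natr1 lerD2r truncn_le // ltW.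
have m0m : (m0 <= m)%N by rewrite -(ler_nat R); lra.
have N0 : 0 < N.+1%:R :> R by rewrite ltr0n.
have := hp m m0m (ln N.+1%:R).
rewrite ln_nat_ge0 (le_trans (ler_ln_pos N0 NX)) // => /(_ isT).
rewrite lnK ?posrE // /psi natrK => h; apply: (le_trans h).
have -> : C * expR 1 * X * L ^- 5 = C * L ^- 5 * expR (L + 1).
  by rewrite expRD lnK ?posrE //; ring.
apply: ler_pM; rewrite ?expR_ge0 ?ler_expR //.
  by rewrite mulr_ge0 ?(ltW C0) // invr_ge0 exprn_ge0.
rewrite ler_pM2l // lef_pV2 ?posrE ?exprn_gt0 ?ltr0n // lerXn2r ?nnegrE ?ler0n //; lra.
Qed.

Definition prime_count (s M : nat) : nat := (\sum_(k < M) prime (s + k.+1))%N.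

Lemma sum_window_nat (f : nat -> R) s M :
  \sum_(k < M) f (s + k.+1)%N = \sum_(n < (s + M).+1) f n - \sum_(n < s.+1) f n.
Proof.
rewrite -addSn big_split_ord /= addrAC subrr add0r.
by apply: eq_bigr => k _; rewrite addnS.
Qed.

(** A prime above [z] contributes more than [w] to the sum of [Lambda], and at most [z] members of
    the window do not exceed [z]. *)
Lemma prime_count_upper s M (z w : R) : 0 <= w -> 0 < z -> ln z = w ->
  w * (prime_count s M)%:R <= \sum_(k < M) Lam (s + k.+1)%N + w * z.
Proof.
move=> w0 z0 zw.
have tz : (Num.truncn z)%:R <= z by rewrite truncn_le // ltW.
apply: (@le_trans _ _ (\sum_(k < M) Lam (s + k.+1)%N + w * (\sum_(k < M.+1) (0 < k <= Num.truncn z)%N)%:R)).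
  rewrite /prime_count !natr_sum !mulr_sumr big_ord_recl /= mulr0 add0r -big_split /=.
  apply: ler_sum => k _; set n := (s + k.+1)%N.
  have [pn|_] := boolP (prime n); last by rewrite mulr0 addr_ge0 ?mangoldt_ge0 // mulr_ge0.
  rewrite mulr1; have [nz|nz] := lerP n%:R z.
    rewrite (_ : (k.+1 <= _)%N) ?mulr1 ?lerDr ?mangoldt_ge0 //.
    by rewrite ler_truncn ?(ltW z0) // (le_trans _ nz) // ler_nat leq_addl.
  rewrite mangoldt_prime //; apply: (@le_trans _ _ (ln n%:R)).
    by rewrite -zw ler_ln_pos // ltW.
  by rewrite lerDl mulr_ge0.
rewrite lerD2l ler_wpM2l //; apply: le_trans tz; rewrite ler_nat.
by apply: leq_trans (sum_pos_le _ _) _; exact: geq_minr.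
Qed.

Lemma prime_count_lower s M : (0 < M)%N ->
  \sum_(k < M) Lam (s + k.+1)%N <=
  ln (s + M)%:R * (prime_count s M)%:R + Num.sqrt (s + M)%:R * ln (s + M)%:R.
Proof.
move=> M0; have N0 : (0 < s + M)%N by rewrite addn_gt0 M0 orbT.
apply: (@le_trans _ _ (ln (s + M)%:R * (prime_count s M)%:R +
    \sum_(n < (s + M).+1 | ~~ prime n) Lam n)); last by rewrite lerD2l sum_mangoldt_nonprime.
rewrite -addSn big_split_ord /=.
rewrite addrCA -[leLHS]add0r lerD //.
  by apply: sumr_ge0 => n _; exact: mangoldt_ge0.
rewrite [X in _ + X]big_mkcond /=.
rewrite /prime_count natr_sum mulr_sumr -big_split /=.
apply: ler_sum => k _; rewrite addSn -addnS; have [pn|pn] := boolP (prime _) => /=.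
  rewrite mulr1 addr0 (le_trans (mangoldt_le_ln _ _)) // ler_ln_pos ?ltr0n ?addnS //.
  by rewrite ler_nat -addnS leq_add2l.
by rewrite mulr0 add0r.
Qed.

End PrimesInWindows.

Section PrimeWindows.
Variable R : realType.

(** Arithmetic for [prime_window]: [pc] is the number of primes of the window and [S] its sum of
    [Lambda]. The coefficient [L - 2 lam] is [ln (x / L^2)], from [prime_count_upper] with
    [z = x / L^2]; the third [lam] absorbs the errors. *)
Lemma window_upper_bound (x L lam D pc S : R) :
  0 < x -> 0 <= pc -> 0 <= D -> 2 <= lam -> D <= L -> 6 * lam <= L ->
  S <= x + D * x / L ^+ 2 ->
  (L - 2 * lam) * pc <= S + (L - 2 * lam) * (x / L ^+ 2) -> pc <= x / (L - 3 * lam).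
Proof.
move=> x0 pc0 D0 l2 DL lL hS hp.
have L0 : 0 < L by lra.
have w0 : 0 < L - 2 * lam by lra.
have L20 : 0 < L ^+ 2 by rewrite exprn_gt0.
rewrite ler_pdivlMr; last by lra.
have t0 : 0 < x / L ^+ 2 by rewrite divr_gt0.
have e1 : x / L ^+ 2 * L ^+ 2 = x by rewrite divfK // lt0r_neq0.
rewrite -mulrA in hS; move: (x / L ^+ 2) t0 e1 hS hp => t t0 e1 hS hp.
set w := L - 2 * lam in w0 hp.
rewrite -(ler_pM2l w0).
have h1 : w * pc <= x + (D + w) * t by lra.
have -> : w * (pc * (L - 3 * lam)) = w * pc * (w - lam) by rewrite /w; ring.
apply: (@le_trans _ _ ((x + (D + w) * t) * (w - lam))).
  by rewrite ler_wpM2r // /w; lra.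
rewrite -e1; have -> : (t * L ^+ 2 + (D + w) * t) * (w - lam) = t * ((L ^+ 2 + (D + w)) * (w - lam)) by ring.
rewrite [leRHS]mulrC -mulrA ler_pM2l // expr2.
have wL : w <= L by rewrite /w; lra.
have wl : 0 <= w - lam by rewrite /w; lra.
have : (D + w) * (w - lam) <= (L + L) * L by apply: ler_pM; lra.
have : 2 * (L * L) <= lam * (L * L) by rewrite ler_wpM2r // mulr_ge0 ?(ltW L0).
lra.
Qed.

(** [v = L + 4 lam] bounds [v' = ln (s + M)] when [s + M <= 2 x L^3], and [q = sqrt (s + M)] comes
    from the prime powers. The fifth [lam] absorbs the errors. *)
Lemma window_lower_bound (x L lam D pc S v v' q : R) :
  0 < x -> 0 <= pc -> 0 <= D -> 2 <= lam -> 4 * D <= L -> 6 * lam <= L -> 0 <= v' ->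
  0 <= q -> q * L ^+ 2 <= x / 8 -> v' <= v -> v = L + 4 * lam ->
  x - D * x / L ^+ 2 <= S ->
  S <= v' * pc + q * v' -> x / (L + 5 * lam) <= pc.
Proof.
move=> x0 pc0 D0 l2 DL lL v'0 q0 qx vv vE hS hp.
have L0 : 0 < L by lra.
have L20 : 0 < L ^+ 2 by rewrite exprn_gt0.
rewrite ler_pdivrMr; last by lra.
have t0 : 0 < x / L ^+ 2 by rewrite divr_gt0.
have e1 : x / L ^+ 2 * L ^+ 2 = x by rewrite divfK // lt0r_neq0.
rewrite -mulrA in hS; move: (x / L ^+ 2) t0 e1 hS hp => t t0 e1 hS hp.
have qt : q <= t / 8 by rewrite -(ler_pM2r L20); lra.
have v2 : v <= 2 * L by lra.
have tL : 0 < t * L by rewrite mulr_gt0.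
have h1 : q * v' <= t * L / 4.
  have : q * v' <= t / 8 * (2 * L) by apply: ler_pM => //; lra.
  lra.
have h2' : 4 * D * t <= L * t by rewrite ler_pM2r.
have h2 : D * t <= t * L / 4 by lra.
have h3 : v' * pc <= v * pc by rewrite ler_wpM2r.
have h4 : t * L ^+ 2 - t * L / 2 <= v * pc by lra.
have v0 : 0 < v by lra.
rewrite -(ler_pM2l v0).
have -> : v * (pc * (L + 5 * lam)) = v * pc * (v + lam) by rewrite vE; ring.
apply: (@le_trans _ _ ((t * L ^+ 2 - t * L / 2) * (v + lam))); last first.
  by rewrite ler_wpM2r //; lra.
rewrite -e1; have -> : v * (t * L ^+ 2) = t * L * (v * L) by ring.
have -> : (t * L ^+ 2 - t * L / 2) * (v + lam) = t * L * ((L - 2^-1) * (v + lam)) by field.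
rewrite ler_pM2l //.
have : 2 * L <= lam * L by rewrite ler_pM2r.
have : lam * 12 <= lam * L by rewrite ler_wpM2l //; lra.
lra.
Qed.

Lemma ln_gt0_lt (x : R) : 0 < ln x -> 1 < x.
Proof.
move=> h; rewrite ltNge; apply/negP => x1.
by have := ln_le0 x1; rewrite leNgt h.
Qed.

Lemma prime_window : exists2 l0 : R, 12 <= l0 & forall M : nat,
  let x : R := M%:R in let L := ln x in let lam := ln L in l0 <= lam ->
  6 * lam <= L /\ forall s, s%:R <= x * L ^+ 3 ->
  x / (L + 5 * lam) <= (prime_count s M)%:R <= x / (L - 3 * lam).
Proof.
have [C C0 [x0 x01 hpsi]] := psi_nat R.
have [F f0 hF] : exists2 F : R, 1 <= F & forall y, 0 <= y -> y ^+ 8 <= F * expR y.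
  by exists 8`!%:R => [|y y0]; [rewrite nat_ge1 // fact_gt0 | exact: exprn_le_expR].
(* Each end of the window has an error of at most [C * (2 x L^3) * L^-5 = 2 C x / L^2]. *)
pose D := 4 * C; have D0 : 0 < D by rewrite mulr_gt0.
exists (12 + x0 + 4 * D + 128 * F).
  by lra.
move=> M x L lam lam0.
have [l12 lx lD lf] : [/\ 12 <= lam, x0 <= lam, 4 * D <= lam & 128 * F <= lam].
  by split; lra.
have L1 : 1 < L by apply: ln_gt0_lt; rewrite -/lam; lra.
have x1 : 1 < x by apply: ln_gt0_lt; rewrite -/L; lra.
have L0 : 0 < L by lra.
have x00 : 0 < x by lra.
have Le : expR lam = L by rewrite lnK.
have xe : expR L = x by rewrite lnK.
have lamL : lam <= L by rewrite -Le; have := expR_ge1Dx lam; lra.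
have l6 : 6 * lam <= L.
  have := @exprn_le_expR R lam 2; rewrite Le (_ : 2`! = 2%N) // expr2.
  have lp : 0 < lam by lra.
  have l2' : 12 * lam <= lam * lam by rewrite ler_pM2r.
  move=> /(_ (ltW lp)); lra.
(* This is [sqrt (2 x L^3) * L^2 <= x / 8] squared, which makes the prime powers negligible. *)
have L7 : 128 * L ^+ 7 <= x.
  have := hF L (ltW L0); rewrite xe => h8.
  have h7 : 128 * F * L ^+ 7 <= L ^+ 8.
    by rewrite [L ^+ 8]exprS ler_pM2r ?exprn_gt0 //; lra.
  have : F * (128 * L ^+ 7) <= F * x.
    by apply: le_trans h8; apply: le_trans h7; rewrite mulrA [_ * 128]mulrC.
  by rewrite ler_pM2l // (lt_le_trans ltr01).
split=> // s sM.
have M0 : (0 < M)%N by rewrite -(ltr_nat R); lra.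
pose X := 2 * x * L ^+ 3.
have L31 : 1 <= L ^+ 3 by rewrite exprn_ege1 // ltW.
have L30 : 0 < L ^+ 3 by lra.
have X0 : 0 < X by rewrite !mulr_gt0.
have sX : (s + M)%:R <= X.
  rewrite natrD /X -/x; have : x * 1 <= x * L ^+ 3 by rewrite ler_pM2l.
  lra.
have lnX : ln X = ln 2 + L + 3 * lam.
  by rewrite /X lnM ?posrE ?mulr_gt0 // lnM ?posrE // lnXn // -/L -/lam mulr_natl.
have ln2 : 0 <= ln (2 : R) <= 1.
  by rewrite ln_ge0 ?ler1n //= -[leRHS]expRK ler_ln_pos //; have := @expR_ge1Dx R 1; lra.
have {}lnX2 : L <= ln X by rewrite lnX; lra.
have err : 2 * (C * X * ln X ^- 5) <= D * x / L ^+ 2.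
  have -> : D * x / L ^+ 2 = 2 * (C * X * L ^- 5).
    by rewrite /D /X; field; rewrite lt0r_neq0.
  rewrite ler_pM2l // ler_pM2l ?mulr_gt0 // lef_pV2 ?posrE ?exprn_gt0 //; last by lra.
  by rewrite lerXn2r ?nnegrE //; lra.
have x0X : x0 <= ln X by lra.
have p1 := hpsi X x0X X0 (s + M)%N sX.
have sX' : s%:R <= X by apply: le_trans sX; rewrite ler_nat leq_addr.
have p2 := hpsi X x0X X0 s sX'.
have sumE := sum_window_nat (mangoldt R) s M.
have nE : (s + M)%:R = s%:R + x by rewrite natrD.
rewrite nE in p1; move: p1 p2; rewrite !ler_norml => /andP[p1 p1'] /andP[p2 p2'].
set S := \sum_(k < M) _ in sumE.
have S1 : S <= x + D * x / L ^+ 2 by rewrite sumE; lra.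
have S2 : x - D * x / L ^+ 2 <= S by rewrite sumE; lra.
have l2 : 2 <= lam by lra.
apply/andP; split.
  have N0 : 0 < (s + M)%:R :> R by rewrite ltr0n addn_gt0 M0 orbT.
  apply: (@window_lower_bound x L lam D (prime_count s M)%:R S (L + 4 * lam) (ln (s + M)%:R) (Num.sqrt (s + M)%:R)) => //; rewrite ?ler0n ?sqrtr_ge0 ?ln_nat_ge0 ?(ltW D0) //.
  - by lra.
  - have q1 : 0 <= x / (8 * L ^+ 2) by rewrite divr_ge0 ?mulr_ge0 ?exprn_ge0 ?ltW.
    have -> : x / 8 = x / (8 * L ^+ 2) * L ^+ 2 by field; rewrite lt0r_neq0.
    rewrite ler_pM2r ?exprn_gt0 // -[leRHS]ger0_norm // -sqrtr_sqr ler_sqrt; last by rewrite exprn_ge0.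
    apply: (le_trans sX); rewrite /X expr_div_n ler_pdivlMr ?exprn_gt0 ?mulr_gt0 ?exprn_gt0 //.
    have -> : 2 * x * L ^+ 3 * (8 * L ^+ 2) ^+ 2 = x * (128 * L ^+ 7) by ring.
    by rewrite expr2 ler_pM2l.
  - by apply: (le_trans (ler_ln_pos N0 sX)); rewrite lnX; lra.
  - exact: prime_count_lower.
apply: (@window_upper_bound x L lam D _ S) => //; rewrite ?ler0n ?(ltW D0) //; first by lra.
apply: prime_count_upper; first by lra.
  by rewrite divr_gt0 ?exprn_gt0.
by rewrite ln_div ?posrE ?exprn_gt0 // lnXn // -/L -/lam mulr_natl.
Qed.

End PrimeWindows.

(** * The dice game *)

Section Dice.
Variable R : realType.

(* The probability that [r] rolls, starting from the sum [s], hit no prime. *)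
Fixpoint survive (M r s : nat) : R :=
  if r is r'.+1 then
    M%:R^-1 * \sum_(k < M | ~~ prime (s + k.+1)) survive M r' (s + k.+1)
  else 1.

(** The starting sum [s] is what makes induction on the first roll possible; the game itself is
    [s = 0]. *)
Definition first_prime_from (s M r : nat) (eta : {ffun 'I_r -> 'I_M}) : bool :=
  [forall l : 'I_r, (0 < l)%N ==> ~~ prime (s + roll_sum eta l)] && prime (s + roll_sum eta r).

Definition ffun_cons (M r : nat) (x : 'I_M * {ffun 'I_r -> 'I_M}) : {ffun 'I_r.+1 -> 'I_M} :=
  [ffun i => if unlift ord0 i is Some j then x.2 j else x.1].

Definition ffun_uncons (M r : nat) (eta : {ffun 'I_r.+1 -> 'I_M}) :=
  (eta ord0, [ffun j => eta (lift ord0 j)] : {ffun 'I_r -> 'I_M}).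

Lemma ffun_consK M r : cancel (@ffun_cons M r) (@ffun_uncons M r).
Proof.
move=> [k eta]; congr pair; first by rewrite ffunE unlift_none.
by apply/ffunP => j; rewrite !ffunE liftK.
Qed.

Lemma ffun_unconsK M r : cancel (@ffun_uncons M r) (@ffun_cons M r).
Proof.
move=> eta; apply/ffunP => i; rewrite ffunE /=.
by case: unliftP => [j ->|->]; rewrite ?ffunE.
Qed.

Lemma roll_sum_cons M r (k : 'I_M) (eta : {ffun 'I_r -> 'I_M}) l :
  roll_sum (ffun_cons (k, eta)) l.+1 = (k.+1 + roll_sum eta l)%N.
Proof.
rewrite /roll_sum big_mkcond big_ord_recl /= ffunE unlift_none /=.
congr addn; rewrite [RHS]big_mkcond; apply: eq_bigr => i _.
by rewrite ffunE liftK /= ltnS.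
Qed.

Lemma roll_sum0 M r (eta : {ffun 'I_r -> 'I_M}) : roll_sum eta 0 = 0%N.
Proof. by rewrite /roll_sum big_pred0. Qed.

Lemma first_prime_from_cons s M r (k : 'I_M) (eta : {ffun 'I_r -> 'I_M}) :
  first_prime_from s (ffun_cons (k, eta)) =
  ((0 < r)%N ==> ~~ prime (s + k.+1)) && first_prime_from (s + k.+1) eta.
Proof.
rewrite /first_prime_from roll_sum_cons addnA andbA; congr andb.
apply/forallP/andP => [h|[h1 /forallP h2] l].
  split; last first.
    by apply/forallP => l; have := h (lift ord0 l); rewrite /= roll_sum_cons addnA; case: ltnP.
  apply/implyP => r0; have := h (lift ord0 (Ordinal r0)).
  by rewrite /= /bump /= roll_sum_cons roll_sum0 addn0.
case: (unliftP ord0 l) => [j ->|-> //]; rewrite /= roll_sum_cons addnA.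
have [j0|j0] := posnP j; last by have := h2 j; rewrite j0.
have r0 : (0 < r)%N by apply: leq_ltn_trans (ltn_ord j).
by rewrite j0 roll_sum0 addn0; rewrite r0 in h1.
Qed.

Definition first_prime_prob (M r s : nat) : R :=
  M%:R ^- r * (\sum_(eta : {ffun 'I_r -> 'I_M}) first_prime_from s eta)%N%:R.

Lemma PrP_first_prime_prob M r : PrP R M r = first_prime_prob M r 0.
Proof.
rewrite /PrP /first_prime_prob; congr (_ * _%:R).
rewrite -sum1_card big_mkcond; apply: eq_bigr => eta _.
rewrite inE /first_prime_from add0n.
rewrite (_ : [forall l : 'I_r, _] = [forall l : 'I_r, (0 < l)%N ==> ~~ prime (0 + roll_sum eta l)]).
  by case: (_ && _).
by apply: eq_forallb => l; rewrite add0n.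
Qed.

(** When [r = 0] the first roll is also the last and must hit a prime, so the condition that it
    misses is imposed only for [0 < r]. *)
Lemma first_prime_prob_rec M r s : first_prime_prob M r.+1 s =
  M%:R^-1 * \sum_(k < M | (0 < r)%N ==> ~~ prime (s + k.+1)) first_prime_prob M r (s + k.+1).
Proof.
rewrite /first_prime_prob -mulr_sumr mulrA -invfM -exprS; congr (_ * _).
rewrite -natr_sum; congr (_%:R).
rewrite (reindex (@ffun_cons M r)) /=; last first.
  by exists (@ffun_uncons M r) => ? _; rewrite ?ffun_consK ?ffun_unconsK.
rewrite -(pair_bigA _ (fun k eta => nat_of_bool (first_prime_from s (ffun_cons (k, eta))))) /=.
rewrite [RHS]big_mkcond; apply: eq_bigr => k _.
case: ifP => h.
  by apply: eq_bigr => eta _; rewrite first_prime_from_cons h.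
by rewrite big1 // => eta _; rewrite first_prime_from_cons h.
Qed.

Lemma card_ord_split M (P : pred 'I_M) :
  M%:R = \sum_(k < M | P k) 1 + \sum_(k < M | ~~ P k) 1 :> R.
Proof. by rewrite -{1}[M]card_ord -sum1_card natr_sum (bigID P). Qed.

Lemma first_prime_prob_diff M r s : (0 < M)%N ->
  first_prime_prob M r.+1 s = survive M r s - survive M r.+1 s.
Proof.
move=> M0; have Mn : M%:R != 0 :> R by rewrite pnatr_eq0 -lt0n.
elim: r s => [|r IH] s; rewrite first_prime_prob_rec /=.
  rewrite -[X in X - _](mulVf Mn) -mulrBr; congr (_ * _).
  rewrite [X in X - _](card_ord_split (fun k : 'I_M => prime (s + k.+1))).
  rewrite addrK [LHS](bigID (fun k : 'I_M => prime (s + k.+1))) /= [X in _ + X]big1 ?addr0.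
    apply: eq_bigr => k pk; rewrite /first_prime_prob expr0 invr1 mul1r -[RHS]/1%:R.
    apply: f_equal; rewrite (eq_bigr (fun=> 1%N)) ?sum1_card ?card_ffun ?card_ord ?expn0 // => eta _.
    rewrite /first_prime_from roll_sum0 addn0 pk andbT.
    by rewrite (_ : [forall l, _] = true) //; apply/forallP => -[].
  move=> k /negbTE pk; rewrite /first_prime_prob big1 ?mulr0 // => eta _.
  by rewrite /first_prime_from roll_sum0 addn0 pk andbF.
rewrite -mulrBr -sumrB; congr (_ * _).
by apply: eq_bigr => k _; rewrite IH.
Qed.

Lemma PrP_survive M r : (0 < M)%N -> PrP R M r.+1 = survive M r 0 - survive M r.+1 0.
Proof. by move=> M0; rewrite PrP_first_prime_prob first_prime_prob_diff. Qed.

Lemma PrP_ge0 M r : 0 <= PrP R M r.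
Proof. by rewrite mulr_ge0 ?ler0n // invr_ge0 exprn_ge0. Qed.

Lemma survive_ge0 M r s : 0 <= survive M r s.
Proof.
elim: r s => [|r IH] s //=.
by rewrite mulr_ge0 ?invr_ge0 // sumr_ge0.
Qed.

Lemma survive_decr M r r' : (0 < M)%N -> (r <= r')%N -> survive M r' 0 <= survive M r 0.
Proof.
move=> M0 /subnK <-; elim: (r' - r)%N => [|n IH] //.
apply: le_trans IH; rewrite addSn -subr_ge0 -PrP_survive //; exact: PrP_ge0.
Qed.

Lemma sum_nonprime s M : (0 < M)%N ->
  M%:R^-1 * \sum_(k < M | ~~ prime (s + k.+1)) (1 : R) = 1 - (prime_count s M)%:R / M%:R.
Proof.
move=> M0; have Mn : M%:R != 0 :> R by rewrite pnatr_eq0 -lt0n.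
rewrite -[X in X - _](mulVf Mn) [_ / M%:R]mulrC -mulrBr; congr (_ * _).
rewrite [X in X - _](card_ord_split (fun k : 'I_M => prime (s + k.+1))).
have -> : (prime_count s M)%:R = \sum_(k < M | prime (s + k.+1)) 1 :> R.
  rewrite /prime_count natr_sum [RHS]big_mkcond; apply: eq_bigr => k _.
  by case: (prime _).
by rewrite addrAC subrr add0r.
Qed.

(** A roll adds at most [M], so [s + M * r <= T] keeps every sum that is met in the range where the
    density of primes is controlled. *)
Lemma survive_bounds M T (a b : R) : (0 < M)%N -> 0 <= a -> b <= 1 ->
  (forall s, (s <= T)%N -> a <= (prime_count s M)%:R / M%:R <= b) ->
  forall r s, (s + M * r <= T)%N -> (1 - b) ^+ r <= survive M r s <= (1 - a) ^+ r.
Proof.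
move=> M0 a0 b1 hT; elim=> [|r IH] s hs; first by rewrite !expr0 lexx.
have sT : (s <= T)%N by apply: leq_trans hs; exact: leq_addr.
have /andP[ap pb] := hT s sT.
have a1 : 0 <= 1 - a by rewrite subr_ge0 (le_trans ap) // (le_trans pb).
have IHk (k : 'I_M) : (1 - b) ^+ r <= survive M r (s + k.+1) <= (1 - a) ^+ r.
  by apply: IH; apply: leq_trans hs; rewrite mulnS addnA leq_add2r leq_add2l.
have Mi : 0 <= M%:R^-1 :> R by rewrite invr_ge0.
have e (c : R) : M%:R^-1 * \sum_(k < M | ~~ prime (s + k.+1)) c = c * (1 - (prime_count s M)%:R / M%:R).
  rewrite -sum_nonprime // [RHS]mulrCA [c * _]mulr_sumr; congr (_ * _).
  by apply: eq_bigr => k _; rewrite mulr1.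
apply/andP; split => /=.
  apply: (@le_trans _ _ (M%:R^-1 * \sum_(k < M | ~~ prime (s + k.+1)) (1 - b) ^+ r)).
    by rewrite e exprSr ler_wpM2l ?exprn_ge0 ?subr_ge0 // lerD2l lerN2.
  by rewrite ler_wpM2l // ler_sum // => k _; have /andP[] := IHk k.
apply: (@le_trans _ _ (M%:R^-1 * \sum_(k < M | ~~ prime (s + k.+1)) (1 - a) ^+ r)).
  by rewrite ler_wpM2l // ler_sum // => k _; have /andP[] := IHk k.
by rewrite e exprSr ler_wpM2l ?exprn_ge0 // lerD2l lerN2.
Qed.

Lemma prime_countD s a b : prime_count s (a + b) = (prime_count s a + prime_count (s + a) b)%N.
Proof.
by rewrite /prime_count big_split_ord /=; congr addn; apply: eq_bigr => k _; rewrite -addnS addnA.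
Qed.

Lemma prime_count_mono s a b : (a <= b)%N -> (prime_count s a <= prime_count s b)%N.
Proof. by move=> /subnKC <-; rewrite prime_countD leq_addr. Qed.

Lemma bernoulli_le (x : R) n : 0 <= x <= 1 -> 1 - n%:R * x <= (1 - x) ^+ n.
Proof.
move=> /andP[x0 x1]; elim: n => [|n IH]; first by rewrite mul0r subr0 expr0.
rewrite exprS; have x1' : 0 <= 1 - x by rewrite subr_ge0.
apply: le_trans (ler_wpM2l x1' IH); rewrite -natr1.
have : 0 <= n%:R * x * x by rewrite !mulr_ge0.
lra.
Qed.

(* If the window of the next roll contains [J] primes, that roll is survived with
   probability [1 - J / M <= (1 - 1 / M) ^ J], and it skips at most these [J]
   primes. *)
Lemma survive_prime_count M r s : (0 < M)%N ->
  survive M r s <= (1 - M%:R^-1) ^+ prime_count s r.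
Proof.
move=> M0; have Mn : M%:R != 0 :> R by rewrite pnatr_eq0 -lt0n.
have Mi : 0 <= M%:R^-1 :> R by rewrite invr_ge0.
have Mi1 : M%:R^-1 <= 1 :> R by rewrite invf_le1 ?ltr0n // nat_ge1.
set beta : R := 1 - M%:R^-1; have b0 : 0 <= beta by rewrite subr_ge0.
have b1 : beta <= 1 by rewrite gerBl.
elim: r s => [|r IH] s; first by rewrite /prime_count big_ord0 expr0.
set T := prime_count s r.+1; pose J := prime_count s M.
apply: (@le_trans _ _ (M%:R^-1 * \sum_(k < M | ~~ prime (s + k.+1)) beta ^+ (T - J))).
  rewrite /= ler_wpM2l // ler_sum // => k _; apply: (le_trans (IH _)).
  apply: ler_wiXn2l => //; rewrite leq_subLR /T.
  apply: (@leq_trans (prime_count s (k.+1 + r))).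
    by apply: prime_count_mono; rewrite addSn ltnS leq_addl.
  by rewrite prime_countD leq_add2r prime_count_mono.
have -> : M%:R^-1 * \sum_(k < M | ~~ prime (s + k.+1)) beta ^+ (T - J) =
    (1 - J%:R / M%:R) * beta ^+ (T - J).
  rewrite -sum_nonprime // -mulrA mulr_suml; congr (_ * _).
  by apply: eq_bigr => k _; rewrite mul1r.
apply: (@le_trans _ _ (beta ^+ J * beta ^+ (T - J))).
  by rewrite ler_wpM2r ?exprn_ge0 // bernoulli_le ?Mi.
by rewrite -exprD ler_wiXn2l // -maxnE leq_maxr.
Qed.

Lemma sum_by_parts (f g : nat -> R) m n : (forall r, g r.+1 = f r - f r.+1) -> (m <= n)%N ->
  \sum_(m.+1 <= r < n.+1) r%:R * g r =
  m%:R * f m + \sum_(m <= r < n) f r - n%:R * f n.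
Proof.
move=> gf /subnKC <-; elim: (n - m)%N => [|i IH].
  by rewrite addn0 !big_geq // addr0 addrN.
rewrite addnS big_nat_recr ?ltnS ?leq_addr //= IH [X in _ = _ + X - _]big_nat_recr ?leq_addr //=.
by rewrite gf -(natr1 (m + i)); ring.
Qed.

Lemma sum_geom_inv (a : R) n : 0 < a <= 1 ->
  \sum_(0 <= r < n) (1 - a) ^+ r = (1 - (1 - a) ^+ n) / a.
Proof.
move=> /andP[a0 a1]; apply: (canRL (mulfK _)); first exact: lt0r_neq0.
elim: n => [|n IH]; first by rewrite big_geq // mul0r expr0 subrr.
by rewrite big_nat_recr //= mulrDl IH exprSr; ring.
Qed.

End Dice.

(** * Asymptotics of the head and decay of the tail *)

Section DiceAsymptotics.
Variable R : realType.

(** A weak bound, but valid for all large [N] whatever the number of faces, which is what the tail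
    needs beyond [R1] rolls. *)
Lemma sqrt_le_prime_count : exists N1 : nat, forall N, (N1 <= N)%N ->
  Num.sqrt N%:R <= (prime_count 0 N)%:R :> R.
Proof.
have [C C0 [x0 x01 hpsi]] := psi_nat R.
(* [2 C <= l] brings the error below [N / 2]; [96 = 16 * 3!] gives [16 l^2 <= e^l], that is
   [4 l <= sqrt N]. *)
have [N1 hN1] := nat_above (expR (x0 + 2 * C + 96)).
exists (maxn N1 1) => N; rewrite geq_max => /andP[/hN1 hN N0].
have Np : 0 < N%:R :> R by rewrite ltr0n.
set l := ln (N%:R : R).
have l0 : x0 + 2 * C + 96 <= l by rewrite -(expRK (x0 + 2 * C + 96)) ler_ln_pos ?expR_gt0.
have [lx lC l96] : [/\ x0 <= l, 2 * C <= l & 96 <= l] by split; lra.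
have le : expR l = N%:R by rewrite lnK.
have lp : 0 < l by lra.
have h1 := hpsi N%:R lx Np N (lexx _).
have h2 := @prime_count_lower R 0 N N0.
rewrite add0n -/l sum_window_nat [X in _ - X]big_ord_recl big_ord0 mangoldt0 addr0 subr0 add0n in h2.
have h3 : C * N%:R * l ^- 5 <= N%:R / 2.
  rewrite mulrAC mulrC ler_pM2l // ler_pdivrMr ?exprn_gt0 //.
  have : l <= l ^+ 5 by rewrite -[leLHS]expr1 ler_weXn2l //; lra.
  lra.
move: h1; rewrite ler_norml -/l => /andP[h1 _].
set u := Num.sqrt (N%:R : R) in h2 *.
have uu : u ^+ 2 = N%:R by rewrite sqr_sqrtr.
have u0 : 0 < u by rewrite sqrtr_gt0.
have l4 : 4 * l <= u.
  have l40 : 0 <= 4 * l by lra.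
  rewrite -(ler_pXn2r (n := 2)) ?nnegrE ?(ltW u0) // uu -le.
  have := @exprn_le_expR R l 3 (ltW lp); rewrite (_ : 3`! = 6)%N // => h.
  have : 96 * l ^+ 2 <= l * l ^+ 2 by rewrite ler_pM2r ?exprn_gt0.
  rewrite -exprS exprMn; lra.
set p : R := (prime_count 0 N)%:R in h2 *.
have p0 : 0 <= p by exact: ler0n.
have h4 : u ^+ 2 / 2 <= l * (p + u) by rewrite uu; lra.
have h5 : 4 * l * (p + u) <= u * (p + u) by rewrite ler_wpM2r //; lra.
rewrite expr2 in h4.
have : u * u <= u * p by lra.
by rewrite ler_pM2l.
Qed.

(* The geometric mean of the bounds [exp (- al)] and [exp (- sqrt r / M)]. *)
Lemma survive_decay M r N1 : (0 < M)%N -> (0 < r)%N -> (N1 <= r)%N ->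
  (forall N, (N1 <= N)%N -> Num.sqrt N%:R <= (prime_count 0 N)%:R :> R) ->
  forall al : R, survive R M r 0 <= expR (- al) ->
  survive R M r 0 <= expR (- (al / 2)) * (24 * 16 * M%:R ^+ 4) * r%:R ^- 2.
Proof.
move=> M0 r0 Nr hN al hal.
have Mp : 0 < M%:R :> R by rewrite ltr0n.
have rp : 0 < r%:R :> R by rewrite ltr0n.
pose u := Num.sqrt (r%:R : R).
have u0 : 0 < u by rewrite sqrtr_gt0.
have uu : u ^+ 2 = r%:R by rewrite sqr_sqrtr // ltW.
pose be := u / M%:R; have be0 : 0 < be by rewrite divr_gt0.
have hbe : survive R M r 0 <= expR (- be).
  apply: (le_trans (survive_prime_count R r 0 M0)).
  apply: (@le_trans _ _ (expR (- M%:R^-1) ^+ prime_count 0 r)).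
    rewrite lerXn2r ?nnegrE ?expR_ge0 //; last by have := expR_ge1Dx (- (M%:R : R)^-1); lra.
    by rewrite subr_ge0 invf_le1 // nat_ge1.
  rewrite -expRM_natl ler_expR mulrN lerN2 /be ler_pM2r ?invr_gt0 //.
  exact: hN.
apply: (@le_trans _ _ (expR (- (al / 2)) * expR (- (be / 2)))).
  rewrite -expRD; have [h|h] := lerP al be.
    by apply: (le_trans hbe); rewrite ler_expR; lra.
  by apply: (le_trans hal); rewrite ler_expR; lra.
rewrite -mulrA ler_pM2l ?expR_gt0 //.
have b20 : 0 <= be / 2 by lra.
(* The fourth power turns [exp (- sqrt r / (2 M))] into a multiple of [r ^ -2], which is
   summable. *)
have := @exprn_le_expR R (be / 2) 4 b20; rewrite (_ : 4`! = 24)%N // => h4.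
have e1 : (be / 2) ^+ 4 = r%:R ^+ 2 / (16 * M%:R ^+ 4).
  by rewrite -uu /be; field; rewrite lt0r_neq0.
rewrite e1 ler_pdivrMr ?mulr_gt0 ?exprn_gt0 // in h4.
rewrite ler_pdivlMr ?exprn_gt0 // expRN mulrC ler_pdivrMr ?expR_gt0 //.
by apply: (le_trans h4); rewrite le_eqVlt; apply/orP; left; apply/eqP; ring.
Qed.

Lemma sum_inv_sqr m n : (0 < m)%N -> \sum_(m <= r < n) r%:R ^- 2 <= 2 :> R.
Proof.
move=> m0; have [nm|mn] := leqP n m; first by rewrite big_geq.
rewrite -(subnKC (ltnW mn)); move: (n - m)%N => i.
have mp : 0 < m%:R :> R by rewrite ltr0n.
apply: (@le_trans _ _ (2 / m%:R - 2 / (m + i)%:R)); last first.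
  have h : m%:R^-1 <= 1 :> R by rewrite invf_le1 // nat_ge1.
  have : 0 <= (m + i)%:R^-1 :> R by rewrite invr_ge0.
  lra.
elim: i => [|i IH]; first by rewrite addn0 big_geq // subrr.
rewrite addnS big_nat_recr ?leq_addr //=; apply: (le_trans (lerD IH (lexx _))).
have q0 : 0 < (m + i)%:R :> R by rewrite ltr0n addn_gt0 m0.
have q1 : 1 <= (m + i)%:R :> R by rewrite nat_ge1 // addn_gt0 m0.
rewrite -(natr1 (m + i)); move: ((m + i)%:R : R) q0 q1 => q q0 q1.
rewrite -addrA lerD2l.
have -> : - (2 / q) + q ^- 2 = - (2 / (q + 1)) - (q - 1) / (q ^+ 2 * (q + 1)).
  by field; rewrite !lt0r_neq0 //; lra.
rewrite gerBl divr_ge0 //; first by lra.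
by rewrite mulr_ge0 ?exprn_ge0 //; lra.
Qed.

Lemma dice_estimates : exists2 K : R, 0 <= K & exists2 l0 : R, 1 <= l0 & forall M : nat,
  let x : R := M%:R in let L := ln x in let lam := ln L in l0 <= lam ->
  `|head_sum R M - L| <= 6 * lam /\
  forall n, \sum_((R1 R M).+1 <= r < n) r%:R * PrP R M r <= K / x.
Proof.
have [l0 l012 hw] := prime_window R.
have [N1 hN1] := sqrt_le_prime_count.
(* 6 is for the boundary term [R1 * Q R1]; the rest is the constant of [survive_decay] times the
   bound 2 of [sum_inv_sqr]. *)
exists (6 + 24 * 16 * 2); first by rewrite addr_ge0 // !mulr_ge0.
exists (l0 + N1%:R + 100); first by have := ler0n R N1; lra.
move=> M x L lam hlam.
have [la lN l100] : [/\ l0 <= lam, N1%:R + 1 <= lam & 100 <= lam].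
  by have := ler0n R N1; split; lra.
have [lL hwin] := hw M la; rewrite -/x -/L -/lam in lL hwin.
have L1 : 1 < L by apply: ln_gt0_lt; rewrite -/lam; lra.
have x1 : 1 < x by apply: ln_gt0_lt; rewrite -/L; lra.
have L0 : 0 < L by lra.
have x0 : 0 < x by lra.
have xe : expR L = x by rewrite lnK.
have M0 : (0 < M)%N by rewrite -(ltr_nat R).
set m := R1 R M.
have L30 : 0 <= L ^+ 3 by rewrite exprn_ge0 // ltW.
have /andP[m1 m2] : L ^+ 3 - 1 <= m%:R <= L ^+ 3 by exact: truncn_bounds.
have Mx : M%:R = x by [].
have headE : head_sum R M = \sum_(1 <= r < m.+1) r%:R * PrP R M r by [].
clearbody m lam L x.
pose a := (L + 5 * lam)^-1; pose b := (L - 3 * lam)^-1.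
have a0 : 0 < a by rewrite invr_gt0; lra.
have a1 : a <= 1 by rewrite invf_le1; lra.
have b0 : 0 < b by rewrite invr_gt0; lra.
have b1 : b <= 1 by rewrite invf_le1; lra.
have window s : (s <= M * m)%N -> a <= (prime_count s M)%:R / M%:R <= b.
  move=> sM; have sx : s%:R <= x * L ^+ 3.
    apply: (@le_trans _ _ (M * m)%:R); first by rewrite ler_nat.
    by rewrite natrM Mx ler_pM2l.
  have /andP[w1 w2] := hwin s sx.
  by rewrite Mx ler_pdivlMr // ler_pdivrMr // mulrC w1 mulrC w2.
have surv r : (r <= m)%N -> (1 - b) ^+ r <= survive R M r 0 <= (1 - a) ^+ r.
  by move=> rm; apply: (survive_bounds M0 (ltW a0) b1 window); rewrite add0n leq_mul2l rm orbT.
have Lsq : 100 * L <= L ^+ 2 by rewrite expr2 ler_pM2r //; lra.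
have L3 : 100 * L ^+ 2 <= L ^+ 3 by rewrite exprS ler_pM2r ?exprn_gt0 //; lra.
(* [m >= L^3 / 2] rolls, each hitting a prime with probability at least [a >= 1 / (2 L)], give
   [a * m >= L^2 / 4]. *)
pose al := L ^+ 2 / 4; pose E := expR (- al).
have aE : (1 - a) ^+ m <= E.
  apply: (@le_trans _ _ (expR (- a) ^+ m)).
    by rewrite lerXn2r ?nnegrE ?expR_ge0 ?subr_ge0 //; have := expR_ge1Dx (- a); lra.
  rewrite -expRM_natl ler_expR mulrN lerN2 /a ler_pdivlMr; last by lra.
  apply: (@le_trans _ _ (al * (2 * L))); first by rewrite ler_wpM2l /al //; lra.
  have -> : al * (2 * L) = L ^+ 3 / 2 by rewrite /al; field.
  lra.
have E0 : 0 < E := expR_gt0 _.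
have L3E : L ^+ 3 * E <= 6 / x.
  have := @exprn_le_expR R L 3 (ltW L0); rewrite (_ : 3`! = 6)%N // => h.
  apply: (le_trans (ler_wpM2r (ltW E0) h)); rewrite -mulrA ler_pM2l // -expRD.
  by rewrite -xe -expRN ler_expR /al; lra.
have x6 : 6 / x <= 6 by rewrite ler_pdivrMr // ler_peMr // ltW.
have /andP[Qm0 QmE] := surv m (leqnn m).
have {}QmE := le_trans QmE aE.
have parts := @sum_by_parts R (fun r => survive R M r 0) (PrP R M).
have {}parts := fun m n => parts m n (fun r => PrP_survive R r M0).
split.
  have hd : head_sum R M = \sum_(0 <= r < m) survive R M r 0 - m%:R * survive R M m 0.
    by rewrite headE (parts 0%N m) // mul0r add0r.
  have up : \sum_(0 <= r < m) survive R M r 0 <= L + 5 * lam.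
    apply: (@le_trans _ _ (\sum_(0 <= r < m) (1 - a) ^+ r)).
      by rewrite !big_mkord; apply: ler_sum => r _; have /andP[] := surv r (ltnW (ltn_ord r)).
    rewrite sum_geom_inv ?a0 // /a invrK -[leRHS]mul1r ler_wpM2r //; first by lra.
    by rewrite gerBl exprn_ge0 // subr_ge0.
  have dn : L - 3 * lam - L ^+ 3 * E <= \sum_(0 <= r < m) survive R M r 0.
    apply: (@le_trans _ _ (\sum_(0 <= r < m) (1 - b) ^+ r)); last first.
      by rewrite !big_mkord; apply: ler_sum => r _; have /andP[] := surv r (ltnW (ltn_ord r)).
    rewrite sum_geom_inv ?b0 // /b invrK.
    have h : (1 - b) ^+ m <= E := le_trans Qm0 QmE.
    have : (1 - b) ^+ m * (L - 3 * lam) <= E * L ^+ 3.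
      by apply: ler_pM => //; [rewrite exprn_ge0 // subr_ge0 | lra | lra].
    rewrite -/b; lra.
  have mQ0 : 0 <= m%:R * survive R M m 0 by rewrite mulr_ge0 // survive_ge0.
  have mQ : m%:R * survive R M m 0 <= L ^+ 3 * E by rewrite ler_pM // survive_ge0.
  rewrite hd; move: up dn mQ0 mQ L3E x6 l100.
  move: (\sum_(0 <= r < m) survive R M r 0) (m%:R * survive R M m 0) (L ^+ 3 * E) (6 / x).
  by move=> ? ? ? ? *; rewrite ler_norml; apply/andP; split; lra.
move=> n; have [nm|mn] := leqP n m.+1.
  by rewrite big_geq // divr_ge0 ?(ltW x0) // addr_ge0 // !mulr_ge0.
case: n mn => // n; rewrite !ltnS => mn.
rewrite (parts _ _ (ltnW mn)).
have mN : N1%:R <= m%:R :> R by lra.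
rewrite ler_nat in mN.
have mp : (0 < m)%N by rewrite -(ltr_nat R); lra.
have mQ : m%:R * survive R M m 0 <= 6 / x.
  by apply: le_trans L3E; rewrite ler_pM // survive_ge0.
have tl : \sum_(m <= r < n) survive R M r 0 <= 24 * 16 * 2 / x.
  pose c := expR (- (al / 2)) * (24 * 16 * M%:R ^+ 4).
  have c0 : 0 < c by rewrite /c Mx mulr_gt0 ?expR_gt0 // mulr_gt0 ?mulr_gt0 // exprn_gt0.
  apply: (@le_trans _ _ (\sum_(m <= r < n) c * r%:R ^- 2)).
    rewrite big_nat [leRHS]big_nat; apply: ler_sum => r /andP[mr _].
    apply: (survive_decay M0 (leq_trans mp mr) (leq_trans mN mr) hN1).
    exact: le_trans (survive_decr R M0 mr) QmE.
  rewrite -mulr_sumr; apply: (le_trans (ler_wpM2l (ltW c0) (sum_inv_sqr n mp))).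
  have -> : c * 2 = 24 * 16 * 2 * (expR (- (al / 2)) * x ^+ 4) by rewrite /c Mx; ring.
  rewrite ler_pM2l ?mulr_gt0 // -xe -expRM_natl -expRD -expRN ler_expR /al; lra.
have : 0 <= n%:R * survive R M n 0 by rewrite mulr_ge0 // survive_ge0.
lra.
Qed.

End DiceAsymptotics.

(** [fine] sends an infinite value to 0, so the finiteness of the tail is asserted beside its
    decay. *)
Theorem theorem2 (R : realType) :
  (fun M : nat => head_sum R M) =
    (fun M : nat => ln (M%:R : R)) +O_\oo (fun M : nat => ln (ln (M%:R : R)))
  /\ ((\forall M \near \oo, tail_sum R M \is a fin_num)
     /\ (fun M : nat => fine (tail_sum R M)) =o_\oo (fun _ : nat => 1 : R)).
Proof.
have [K K0 [l0 l01 hd]] := dice_estimates R.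
have [N0 hN0] := nat_above (expR (expR l0)).
have large M : (N0 <= M)%N -> l0 <= ln (ln (M%:R : R)).
  move=> /hN0 h; have h1 : expR l0 <= ln M%:R :> R.
    by rewrite -[leLHS]expRK ler_ln_pos ?expR_gt0.
  by rewrite -[leLHS]expRK ler_ln_pos ?expR_gt0.
have tail_bounds M : (N0 <= M)%N -> (0 <= tail_sum R M <= (K / M%:R)%:E)%E.
  move=> /large /hd[_ h].
  have ge0 n : ((R1 R M).+1 <= n)%N -> true -> (0 <= (n%:R * PrP R M n)%:E)%E.
    by move=> _ _; rewrite lee_fin mulr_ge0 // PrP_ge0.
  apply/andP; split; first exact: nneseries_ge0.
  apply: lime_le; first exact: is_cvg_nneseries.
  by apply: nearW => n; rewrite sumEFin lee_fin.
have fin M : (N0 <= M)%N -> tail_sum R M \is a fin_num.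
  move=> /tail_bounds /andP[h1 h2]; rewrite ge0_fin_numE //.
  exact: le_lt_trans h2 (ltry _).
split; last split.
- apply/eqaddOP; near=> k.
  have k6 : 6 <= k by near: k; apply: nbhs_pinfty_ge; exact: num_real.
  near=> M.
  have MN : (N0 <= M)%N by near: M; exact: nbhs_infty_ge.
  have [h _] := hd M (large M MN).
  have ll0 : 0 <= ln (ln M%:R) :> R by apply: le_trans (large M MN); lra.
  by apply: (le_trans h); rewrite (ger0_norm ll0) ler_wpM2r.
- by near=> M; apply: fin; near: M; exact: nbhs_infty_ge.
- apply/eqoP => e e0; near=> M.
  have MN : (N0 <= M)%N by near: M; exact: nbhs_infty_ge.
  have /andP[h1 h2] := tail_bounds M MN.
  rewrite normr1 mulr1 ger0_norm ?fine_ge0 //.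
  apply: (@le_trans _ _ (K / M%:R)).
    by rewrite -lee_fin fineK // fin.
  have Me : K / e <= M%:R by near: M; exact: nbhs_infty_ger.
  have [M00|M0] := posnP M; first by rewrite M00 invr0 mulr0 ltW.
  by rewrite ler_pdivrMr ?ltr0n // mulrC -ler_pdivrMr.
Unshelve. all: by end_near.
Qed.
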